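(* Let $p\ge1$ and $k\ge0$ be integers (of either parity). The monomials $\alpha^a\beta^b$ with integers $a,b\ge0$, $a+b=k$ and $a-b\equiv0\pmod p$, together with all their siblings (restricted to $S^3$), form a basis of the space of modes of wavenumber $k$ of the lens space $L(p,1)=S^3/Z_p$. This space has dimension $(2\lfloor k/p\rfloor+1)(k+1)$ if $p$ and $k$ are even; $0$ if $p$ is even and $k$ is odd; $(2\lfloor k/(2p)\rfloor+1)(k+1)$ if $p$ is odd and $k$ is even; $2(\lfloor (k-p)/(2p)\rfloor+1)(k+1)$ if $p$ and $k$ are odd. In particular for $p=2n$ the dimension is $(2\lfloor\frac{k/2}{n}\rfloor+1)(k+1)$ for even $k$ and $0$ for odd $k$.
   Context: Identify $\mathbb R^4$ with $\mathbb C^2$ via $\alpha=x+iy$, $\beta=z+iw$, $S^3=\{|\alpha|^2+|\beta|^2=1\}$. Wirtinger derivatives $\frac{\partial}{\partial\alpha}=\frac12(\partial_x-i\partial_y)$, similarly for $\beta$ with $(z,w)$. $\mathrm{twist}_-=-\bar\beta\frac{\partial}{\partial\alpha}+\bar\alpha\frac{\partial}{\partial\beta}$. For a polynomial $f$ in $\alpha,\beta$ only, homogeneous of degree $k$, its siblings are $\mathrm{twist}_-^j f$, $j=0,\dots,k$. $\gamma\in SU(2)$ acts on $\mathbb C^2$ by $(\alpha,\beta)^T\mapsto\gamma(\alpha,\beta)^T$ and on functions by $(R_\gamma F)(x)=F(\gamma^{-1}x)$. For a finite subgroup $\Gamma\subset SU(2)$, the space of modes of wavenumber $k$ of $S^3/\Gamma$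 is the complex vector space of $\Gamma$-invariant $F:S^3\to\mathbb C$ with $\Delta_{S^3}F=-k(k+2)F$. $Z_p\subset SU(2)$ is the cyclic group generated by $\mathrm{diag}(e^{2\pi i/p},e^{-2\pi i/p})$, and $L(p,1)=S^3/Z_p$. *)

(* Defs.v *)
From Stdlib Require Import Reals ZArith List.
From Coquelicot Require Import Coquelicot.
Open Scope R_scope.

(* Functions on R^4 = C^2, written in real coordinates (x,y,z,w),
   alpha = x + i y, beta = z + i w. *)
Definition fn4R := R -> R -> R -> R -> R.
Definition fn4C := R -> R -> R -> R -> C.

Definition onS3 (x y z w : R) : Prop := x*x + y*y + z*z + w*w = 1.
Definition nonzero4 (x y z w : R) : Prop := ~ (x = 0 /\ y = 0 /\ z = 0 /\ w = 0).

Definition pd (i : nat) (g : fn4R) : fn4R := fun x y z w =>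
  match i with
  | 0%nat => Derive (fun t => g t y z w) x
  | 1%nat => Derive (fun t => g x t z w) y
  | 2%nat => Derive (fun t => g x y t w) z
  | _ => Derive (fun t => g x y z t) w
  end.

Definition exd (i : nat) (g : fn4R) (x y z w : R) : Prop :=
  match i with
  | 0%nat => ex_derive (fun t => g t y z w) x
  | 1%nat => ex_derive (fun t => g x t z w) y
  | 2%nat => ex_derive (fun t => g x y t w) z
  | _ => ex_derive (fun t => g x y z t) w
  end.

Definition cont4 (g : fn4R) (x y z w : R) : Prop :=
  continuous (fun p : R * R * R * R => let '(a, b, c, d) := p in g a b c d)
             (x, y, z, w).

Definition C2_off0 (g : fn4R) : Prop :=
  forall x y z w, nonzero4 x y z w ->
    cont4 g x y z w /\
    (forall i, (i < 4)%nat -> exd i g x y z w /\ cont4 (pd i g) x y z w) /\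
    (forall i j, (i < 4)%nat -> (j < 4)%nat ->
        exd j (pd i g) x y z w /\ cont4 (pd j (pd i g)) x y z w).

Definition lap4 (g : fn4R) : fn4R := fun x y z w =>
  pd 0 (pd 0 g) x y z w + pd 1 (pd 1 g) x y z w
  + pd 2 (pd 2 g) x y z w + pd 3 (pd 3 g) x y z w.

Definition ReF (F : fn4C) : fn4R := fun x y z w => Re (F x y z w).
Definition ImF (F : fn4C) : fn4R := fun x y z w => Im (F x y z w).

Definition pdC (i : nat) (F : fn4C) : fn4C := fun x y z w =>
  (pd i (ReF F) x y z w, pd i (ImF F) x y z w).
Definition lap4C (F : fn4C) : fn4C := fun x y z w =>
  (lap4 (ReF F) x y z w, lap4 (ImF F) x y z w).

(* A function on S^3 is represented by any F : fn4C; only its values on S^3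
   matter. Its degree-0 homogeneous extension to R^4 \ {0}: *)
Definition ext0 (F : fn4C) : fn4C := fun x y z w =>
  let r := sqrt (x*x + y*y + z*z + w*w) in F (x / r) (y / r) (z / r) (w / r).

(* Laplace-Beltrami operator of S^3, evaluated at points of S^3:
   Delta_{S^3} F = (Delta_{R^4} ext0 F) restricted to S^3. *)
Definition lapS3 (F : fn4C) : fn4C := lap4C (ext0 F).

Definition C2_S3 (F : fn4C) : Prop :=
  C2_off0 (ReF (ext0 F)) /\ C2_off0 (ImF (ext0 F)).

Definition Ci : C := (0, 1).
Definition d_alpha (F : fn4C) : fn4C := fun x y z w =>
  Cmult (RtoC (1/2)) (Cminus (pdC 0 F x y z w) (Cmult Ci (pdC 1 F x y z w))).
Definition d_beta (F : fn4C) : fn4C := fun x y z w =>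
  Cmult (RtoC (1/2)) (Cminus (pdC 2 F x y z w) (Cmult Ci (pdC 3 F x y z w))).

Definition twist_minus (F : fn4C) : fn4C := fun x y z w =>
  Cplus (Cmult (Copp (Cconj (z, w))) (d_alpha F x y z w))
        (Cmult (Cconj (x, y)) (d_beta F x y z w)).

Fixpoint cpow (u : C) (n : nat) : C :=
  match n with 0%nat => RtoC 1 | S n => Cmult u (cpow u n) end.

Definition monomial (a b : nat) : fn4C := fun x y z w =>
  Cmult (cpow (x, y) a) (cpow (z, w) b).

Definition sibling (j : nat) (f : fn4C) : fn4C := Nat.iter j twist_minus f.

(* gamma_p m = diag(e^{2 pi i m/p}, e^{-2 pi i m/p}) = g^m for the generator
   g = diag(e^{2 pi i/p}, e^{-2 pi i/p}); Z_p = { gamma_p m | m : Z }. *)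
Definition zeta_pow (p : nat) (m : Z) : C :=
  (cos (2 * PI * IZR m / INR p), sin (2 * PI * IZR m / INR p)).

Definition diag_act (u v : C) (F : fn4C) : fn4C := fun x y z w =>
  let a := Cmult u (x, y) in let b := Cmult v (z, w) in
  F (fst a) (snd a) (fst b) (snd b).

(* (R_gamma F)(x) = F(gamma^{-1} x) with gamma = gamma_p m, so that
   gamma^{-1} = diag(e^{-2 pi i m/p}, e^{2 pi i m/p}) = gamma_p (-m). *)
Definition R_Zp (p : nat) (m : Z) (F : fn4C) : fn4C :=
  diag_act (zeta_pow p (- m)) (zeta_pow p m) F.

Definition Zp_invariant (p : nat) (F : fn4C) : Prop :=
  forall (m : Z) x y z w, onS3 x y z w -> R_Zp p m F x y z w = F x y z w.

Definition mode (p k : nat) (F : fn4C) : Prop :=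
  C2_S3 F /\ Zp_invariant p F /\
  forall x y z w, onS3 x y z w ->
    lapS3 F x y z w = Cmult (RtoC (- INR (k * (k + 2)))) (F x y z w).

Definition good_a (p k a : nat) : bool :=
  Z.eqb (Z.modulo (Z.of_nat a - Z.of_nat (k - a)) (Z.of_nat p)) 0.

(* index list of the basis: (a, j) stands for twist_-^j (alpha^a beta^(k-a)) *)
Definition basis_idx (p k : nat) : list (nat * nat) :=
  list_prod (filter (good_a p k) (seq 0 (S k))) (seq 0 (S k)).

Definition basis_fn (k : nat) (aj : nat * nat) : fn4C :=
  sibling (snd aj) (monomial (fst aj) (k - fst aj)).

Definition lincomb (k : nat) (L : list (nat * nat)) (c : nat * nat -> C) : fn4C :=
  fun x y z w =>
    fold_right Cplus (RtoC 0) (map (fun aj => Cmult (c aj) (basis_fn k aj x y z w)) L).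

Definition dim_formula (p k : nat) : Z :=
  let P := Z.of_nat p in let K := Z.of_nat k in
  if Nat.even p then
    (if Nat.even k then (2 * (K / P) + 1) * (K + 1) else 0)
  else
    (if Nat.even k then (2 * (K / (2 * P)) + 1) * (K + 1)
     else 2 * ((K - P) / (2 * P) + 1) * (K + 1)).

(* Main.v *)
Require Import Defs.
From Stdlib Require Import Reals ZArith List.
From Stdlib Require Import Lra Lia Classical IndefiniteDescription FunctionalExtensionality.
From Coquelicot Require Import Coquelicot.
Import ListNotations.
Open Scope R_scope.

(** Let [u] be the degree-0 extension of the real or imaginary part of an eigenfunction. By
    Euler's relation [H = r^k u] is harmonic on R^4 minus the origin and homogeneous of degree
    [k]. The maximum principle, applied to the odd part of a harmonic function on a half ball
    with a quadratic barrier, shows that a difference along a coordinate axis gains one order of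
    decay at infinity. Hence every [(k+1)]-fold difference of [H] tends to 0 at infinity; it is
    harmonic off finitely many points near which it is bounded, so comparison with multiples of
    [1 / |v - q|^2] makes it vanish. By homogeneity [k! H(x)] is the [k]-fold difference of [H]
    at 0 in direction [x], and [k]-fold differences are now additive and continuous, hence
    linear, in each direction: [H] is a homogeneous polynomial.

    Write such a polynomial in the monomials alpha^A beta^B conj(alpha)^C conj(beta)^D.
    Harmonicity is a two-term recurrence along the lines [A + D = a], [C + D = j], so each line
    carries one free constant, and the [j]-th sibling of alpha^a beta^(k-a) is supported on
    exactly that line with nonzero entries there. Invariance under [Z_p] selects the lines with
    [a - (k - a)] divisible by [p]. *)

Lemma locally_norm_iff {V : NormedModule R_AbsRing} (v : V) (P : V -> Prop) :
  locally v P <-> exists d, 0 < d /\ forall w, norm (minus w v) < d -> P w.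
Proof.
  split.
  - intro H. destruct (locally_norm_le_locally v P H) as [d Hd].
    exists d. split; [apply cond_pos|exact Hd].
  - intros [d [Hd H]]. apply locally_le_locally_norm. exists (mkposreal d Hd). exact H.
Qed.

Lemma locally_R_iff (x : R) (P : R -> Prop) :
  locally x P <-> exists d, 0 < d /\ forall t, Rabs (t - x) < d -> P t.
Proof. apply (locally_norm_iff (V := R_NormedModule)). Qed.

Lemma locally_lt {U : UniformSpace} (f : U -> R) (v : U) (a : R) :
  continuous f v -> f v < a -> locally v (fun w => f w < a).
Proof. intros Hc Ha. exact (Hc _ (open_lt a _ Ha)). Qed.

Lemma locally_gt {U : UniformSpace} (f : U -> R) (v : U) (a : R) :
  continuous f v -> a < f v -> locally v (fun w => a < f w).
Proof. intros Hc Ha. exact (Hc _ (open_gt a _ Ha)). Qed.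

Lemma continuous_Rplus {U : UniformSpace} (f g : U -> R) (x : U) :
  continuous f x -> continuous g x -> continuous (fun y => f y + g y) x.
Proof. apply (@continuous_plus U R_AbsRing R_NormedModule). Qed.

Lemma continuous_Rminus {U : UniformSpace} (f g : U -> R) (x : U) :
  continuous f x -> continuous g x -> continuous (fun y => f y - g y) x.
Proof. apply (@continuous_minus U R_AbsRing R_NormedModule). Qed.

Lemma continuous_Rmult {U : UniformSpace} (f g : U -> R) (x : U) :
  continuous f x -> continuous g x -> continuous (fun y => f y * g y) x.
Proof. apply (@continuous_mult U R_AbsRing). Qed.

(** * Euclidean space of dimension four *)

Definition R4 : NormedModule R_AbsRing :=
  prod_NormedModule R_AbsRing
    (prod_NormedModule R_AbsRing
      (prod_NormedModule R_AbsRing R_NormedModule R_NormedModule) R_NormedModule) R_NormedModule.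

(* [plus], [minus] and [scal] fixed at one instance: canonical structures reach [R4] along several
   convertible but syntactically different paths, between which [rewrite] fails. *)
Definition vplus (v w : R4) : R4 := plus v w.
Definition vminus (v w : R4) : R4 := minus v w.
Definition vscal (t : R) (v : R4) : R4 := scal t v.
Definition origin : R4 := (0, 0, 0, 0).

Infix "⊕" := vplus (at level 50, left associativity).
Infix "⊖" := vminus (at level 50, left associativity).
Infix "⊙" := vscal (at level 40, left associativity).

(* As in [pd], every index above 2 stands for the last coordinate. *)
Definition coord (i : nat) (v : R4) : R :=
  let '(x, y, z, w) := v in
  match i with 0%nat => x | 1%nat => y | 2%nat => z | _ => w end.

Definition basis (i : nat) : R4 :=
  match i with
  | 0%nat => (1, 0, 0, 0) | 1%nat => (0, 1, 0, 0) | 2%nat => (0, 0, 1, 0) | _ => (0, 0, 0, 1)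
  end.

Definition sum4 (g : nat -> R) : R := g 0%nat + g 1%nat + g 2%nat + g 3%nat.

Definition dot (v w : R4) : R := sum4 (fun i => coord i v * coord i w).

Ltac index_cases i := destruct i as [|[|[|i]]].

Lemma coord_plus (i : nat) (v w : R4) : coord i (v ⊕ w) = coord i v + coord i w.
Proof. destruct v as [[[? ?] ?] ?], w as [[[? ?] ?] ?]; index_cases i; reflexivity. Qed.

Lemma coord_minus (i : nat) (v w : R4) : coord i (v ⊖ w) = coord i v - coord i w.
Proof. destruct v as [[[? ?] ?] ?], w as [[[? ?] ?] ?]; index_cases i; reflexivity. Qed.

Lemma coord_scal (i : nat) (t : R) (v : R4) : coord i (t ⊙ v) = t * coord i v.
Proof. destruct v as [[[? ?] ?] ?]; index_cases i; reflexivity. Qed.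

Lemma coord_origin (i : nat) : coord i origin = 0.
Proof. index_cases i; reflexivity. Qed.

Lemma R4_ext (v w : R4) : (forall i, coord i v = coord i w) -> v = w.
Proof.
  destruct v as [[[? ?] ?] ?], w as [[[? ?] ?] ?]. intro H.
  pose proof (H 0%nat); pose proof (H 1%nat); pose proof (H 2%nat); pose proof (H 3%nat).
  simpl in *; subst; reflexivity.
Qed.

Ltac coords := apply R4_ext; let i := fresh "i" in
  intro i; repeat rewrite ?coord_plus, ?coord_minus, ?coord_scal, ?coord_origin.

Lemma vminus_eq_origin (v w : R4) : v ⊖ w = origin -> v = w.
Proof.
  intro E. apply R4_ext. intro i. apply (f_equal (coord i)) in E.
  rewrite coord_minus, coord_origin in E. lra.
Qed.

Lemma coord_basis_same (i : nat) : coord i (basis i) = 1.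
Proof. index_cases i; reflexivity. Qed.

Lemma dot_self_nonneg (v : R4) : 0 <= dot v v.
Proof. unfold dot, sum4. nra. Qed.

Lemma norm_sqr (v : R4) : norm v * norm v = dot v v.
Proof.
  destruct v as [[[x y] z] w].
  change (norm ((x, y, z, w) : R4)) with
    (sqrt ((sqrt ((sqrt (Rabs x ^ 2 + Rabs y ^ 2)) ^ 2 + Rabs z ^ 2)) ^ 2 + Rabs w ^ 2)).
  rewrite !pow2_abs. rewrite (pow2_sqrt (x ^ 2 + y ^ 2)) by nra.
  rewrite (pow2_sqrt (_ + z ^ 2)), sqrt_sqrt by nra. unfold dot, sum4; simpl. ring.
Qed.

Lemma dot_basis_r (i : nat) (v : R4) : dot v (basis i) = coord i v.
Proof. destruct v as [[[? ?] ?] ?]; unfold dot, sum4; index_cases i; simpl; ring. Qed.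

Lemma dot_origin : dot origin origin = 0.
Proof. unfold dot, sum4. rewrite !coord_origin. ring. Qed.

Lemma dot_plus_self (v w : R4) : dot (v ⊕ w) (v ⊕ w) = dot v v + 2 * dot v w + dot w w.
Proof. unfold dot, sum4. rewrite !coord_plus. ring. Qed.

Lemma dot_scal_self (t : R) (v : R4) : dot (t ⊙ v) (t ⊙ v) = t * t * dot v v.
Proof. unfold dot, sum4. rewrite !coord_scal. ring. Qed.

Lemma dot_scal_r (t : R) (v w : R4) : dot v (t ⊙ w) = t * dot v w.
Proof. unfold dot, sum4. rewrite !coord_scal. ring. Qed.

Lemma dot_basis_self (i : nat) : dot (basis i) (basis i) = 1.
Proof. rewrite dot_basis_r. apply coord_basis_same. Qed.

Lemma norm_sqrt (v : R4) : norm v = sqrt (dot v v).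
Proof. rewrite <- norm_sqr, sqrt_square; [reflexivity|apply norm_ge_0]. Qed.

Lemma norm_scal_R4 (t : R) (v : R4) : norm (t ⊙ v) = Rabs t * norm v.
Proof.
  rewrite !norm_sqrt, dot_scal_self, sqrt_mult by (apply dot_self_nonneg || nra).
  f_equal. apply sqrt_Rsqr_abs.
Qed.

Lemma norm_scal_basis (t : R) (i : nat) : norm (t ⊙ basis i) = Rabs t.
Proof. rewrite norm_scal_R4, norm_sqrt, dot_basis_self, sqrt_1. ring. Qed.

Lemma norm_gt_0 (v : R4) : v <> origin -> 0 < norm v.
Proof.
  intro Hv. destruct (norm_ge_0 v) as [|E]; [assumption|].
  contradiction Hv. exact (norm_eq_zero v (eq_sym E)).
Qed.

Lemma dot_self_gt_0 (v : R4) : v <> origin -> 0 < dot v v.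
Proof. intro Hv. rewrite <- norm_sqr. pose proof (norm_gt_0 v Hv). nra. Qed.

Lemma dot_1_neq_origin (v : R4) : dot v v = 1 -> v <> origin.
Proof. intros E ->. rewrite dot_origin in E. lra. Qed.

Definition normalize (v : R4) : R4 := / norm v ⊙ v.

Lemma dot_normalize (v : R4) : v <> origin -> dot (normalize v) (normalize v) = 1.
Proof.
  intro Hv. pose proof (norm_gt_0 v Hv). unfold normalize.
  rewrite dot_scal_self, <- norm_sqr. field. lra.
Qed.

Lemma normalize_scal (t : R) (v : R4) : 0 < t -> normalize (t ⊙ v) = normalize v.
Proof.
  intro Ht. unfold normalize. rewrite norm_scal_R4, Rabs_pos_eq, Rinv_mult by lra. coords.
  transitivity (/ t * t * (/ norm v * coord i v)); [ring|]. rewrite Rinv_l by lra. ring.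
Qed.

Lemma normalize_sphere (v : R4) : dot v v = 1 -> normalize v = v.
Proof. intro Hv. unfold normalize. rewrite norm_sqrt, Hv, sqrt_1, Rinv_1. coords. ring. Qed.

Lemma norm_scal_normalize (v : R4) : v <> origin -> norm v ⊙ normalize v = v.
Proof. intro Hv. unfold normalize. coords. field. pose proof (norm_gt_0 v Hv). lra. Qed.

Lemma coord_le_norm (i : nat) (v : R4) : Rabs (coord i v) <= norm v.
Proof.
  rewrite <- (Rabs_pos_eq (norm v)) by apply norm_ge_0. apply Rsqr_le_abs_0.
  unfold Rsqr. rewrite norm_sqr.
  destruct v as [[[? ?] ?] ?]; unfold dot, sum4; index_cases i; simpl; nra.
Qed.

Lemma norm_lt_of_coord (d : R) (v : R4) : (forall i, Rabs (coord i v) < d / 2) -> norm v < d.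
Proof.
  intro H.
  assert (Hsq : forall i, coord i v * coord i v < d / 2 * (d / 2)).
  { intro i. specialize (H i). apply Rabs_def2 in H. nra. }
  pose proof (Hsq 0%nat). pose proof (Hsq 1%nat). pose proof (Hsq 2%nat). pose proof (Hsq 3%nat).
  assert (0 < d) by (specialize (H 0%nat); pose proof (Rabs_pos (coord 0 v)); lra).
  pose proof (norm_sqr v) as E. unfold dot, sum4 in E. pose proof (norm_ge_0 v). nra.
Qed.

Lemma locally_R4_iff (v : R4) (P : R4 -> Prop) :
  locally v P <-> exists d, 0 < d /\ forall w, norm (w ⊖ v) < d -> P w.
Proof. exact (locally_norm_iff v P). Qed.

Lemma continuous_coord (i : nat) (v : R4) : continuous (coord i) v.
Proof.
  intros P [e HP]. apply locally_R4_iff. exists e. split; [apply cond_pos|].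
  intros w Hw. apply HP. change (Rabs (coord i w - coord i v) < e). rewrite <- coord_minus.
  eapply Rle_lt_trans; [apply coord_le_norm|exact Hw].
Qed.

Lemma continuous_norm (v : R4) : continuous norm v.
Proof. exact (filterlim_norm v). Qed.

Lemma continuous_norm_pow (k : nat) (v : R4) : continuous (fun w : R4 => norm w ^ k) v.
Proof.
  apply (continuous_comp (fun w : R4 => norm w) (fun s => s ^ k)); [apply continuous_norm|].
  apply (ex_derive_continuous (V := R_NormedModule)). auto_derive. exact I.
Qed.

Lemma continuous_dot_self (v : R4) : continuous (fun w => dot w w) v.
Proof.
  unfold dot, sum4. repeat apply continuous_Rplus; apply continuous_Rmult; apply continuous_coord.
Qed.

Lemma locally_axis (i : nat) (v : R4) (P : R4 -> Prop) :
  locally v P -> locally 0 (fun t => P (v ⊕ t ⊙ basis i)).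
Proof.
  rewrite locally_R4_iff, locally_R_iff. intros [d [Hd H]]. exists d. split; [exact Hd|].
  intros t Ht. apply H.
  replace ((v ⊕ t ⊙ basis i) ⊖ v) with (t ⊙ basis i) by (coords; ring).
  rewrite norm_scal_basis. replace t with (t - 0) by ring. exact Ht.
Qed.

Lemma locally_neq (p v : R4) : v <> p -> locally v (fun w => w <> p).
Proof.
  intro Hv. apply locally_R4_iff. exists (norm (p ⊖ v)). split.
  - apply norm_gt_0. intro E. apply Hv. symmetry. apply vminus_eq_origin, E.
  - intros w Hw ->. lra.
Qed.

Lemma continuous_vplus {U : UniformSpace} (f g : U -> R4) (x : U) :
  continuous f x -> continuous g x -> continuous (fun y => f y ⊕ g y) x.
Proof. apply (@continuous_plus U R_AbsRing R4). Qed.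

Lemma continuous_vscal {U : UniformSpace} (f : U -> R) (g : U -> R4) (x : U) :
  continuous f x -> continuous g x -> continuous (fun y => f y ⊙ g y) x.
Proof. apply (@continuous_scal U R_AbsRing R4). Qed.

Lemma continuous_translate {U : UniformSpace} (f : R4 -> U) (u v : R4) :
  continuous f (v ⊕ u) -> continuous (fun w => f (w ⊕ u)) v.
Proof.
  apply (continuous_comp (fun w => w ⊕ u) f), continuous_vplus;
    [apply continuous_id|apply continuous_const].
Qed.

Lemma locally_translate (u v : R4) (P : R4 -> Prop) :
  locally (v ⊕ u) P -> locally v (fun w => P (w ⊕ u)).
Proof. exact (continuous_translate (fun w => w) u v (continuous_id _) P). Qed.

Lemma closed_ball_finite_cover (r : R) (delta : R4 -> posreal) :
  exists l, forall v, norm v <= r -> exists u, In u l /\ norm (v ⊖ u) < delta u.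
Proof.
  set (point := fun t : Compactness.Tn 4 R => let '(x, (y, (z, (w, _)))) := t in (x, y, z, w) : R4).
  set (corner := fun s : R => (s, (s, (s, (s, tt)))) : Compactness.Tn 4 R).
  destruct (NNPP _ (compactness_list 4 (corner (- r)) (corner r)
    (fun t => pos_div_2 (delta (point t))))) as [l Hl].
  exists (map point l). intros [[[x y] z] w] Hv.
  assert (Hbox : forall i, - r <= coord i (x, y, z, w) <= r).
  { intro i. apply Rabs_le_between. eapply Rle_trans; [apply coord_le_norm|exact Hv]. }
  pose proof (Hbox 0%nat). pose proof (Hbox 1%nat).
  pose proof (Hbox 2%nat). pose proof (Hbox 3%nat).
  destruct (Hl (x, (y, (z, (w, tt))))) as [t [Ht [_ Hclose]]]; [simpl in *; tauto|].
  exists (point t). split; [apply in_map, Ht|].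
  apply norm_lt_of_coord. intro i. rewrite coord_minus.
  destruct t as [a [b [c [d []]]]]. simpl in *. index_cases i; tauto.
Qed.

Lemma exists_max_In {T : Type} (a : T -> R) (x : T) (l : list T) :
  exists y, forall z, In z (x :: l) -> a z <= a y.
Proof.
  induction l as [|u l [y Hy]].
  - exists x. intros z [->|[]]. apply Rle_refl.
  - destruct (Rle_dec (a u) (a y)) as [Hu|Hu]; [exists y|exists u];
      intros z [->|[->|Hz]]; try apply Rle_refl; try exact Hu; try (apply Hy; simpl; tauto);
      (apply Rle_trans with (a y); [apply Hy; simpl; tauto|lra]).
Qed.

(* The conclusion says that [g] comes arbitrarily close to its supremum over [dom], possibly
   infinite, in every neighbourhood of [v]. *)
Lemma exists_sup_limit_point (g : R4 -> R) (dom : R4 -> Prop) (r : R) :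
  (forall u, dom u -> norm u <= r) ->
  exists v, forall a, locally v (fun w => dom w -> g w <= a) -> forall u, dom u -> g u <= a.
Proof.
  intro Hr. apply NNPP. intro Hno.
  assert (Hbad : forall v, exists b : R * posreal * R4,
    dom (snd b) /\ fst (fst b) < g (snd b) /\
    forall w, norm (w ⊖ v) < snd (fst b) -> dom w -> g w <= fst (fst b)).
  { intro v. pose proof (not_ex_all_not _ _ Hno v) as H.
    apply not_all_ex_not in H. destruct H as [a H].
    apply imply_to_and in H. destruct H as [Hloc H].
    apply not_all_ex_not in H. destruct H as [u H]. apply imply_to_and in H.
    apply locally_R4_iff in Hloc. destruct Hloc as [d [Hd Hloc]].
    exists (a, mkposreal d Hd, u). simpl. repeat split; [tauto|lra|exact Hloc]. }
  apply functional_choice in Hbad. destruct Hbad as [b Hb].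
  destruct (closed_ball_finite_cover r (fun v => snd (fst (b v)))) as [l Hl].
  destruct (exists_max_In (fun v => fst (fst (b v))) origin l) as [v Hv].
  destruct (Hb v) as [Hu [Hlt _]].
  destruct (Hl _ (Hr _ Hu)) as [c [Hc Hclose]].
  pose proof (Hv c (or_intror Hc)). destruct (Hb c) as [_ [_ Hle]]. specialize (Hle _ Hclose Hu).
  simpl in *. lra.
Qed.

(** * Second derivatives and the Laplacian *)

Lemma is_derive_Rmult (f g : R -> R) (t a b : R) :
  is_derive f t a -> is_derive g t b -> is_derive (fun s => f s * g s) t (a * g t + f t * b).
Proof. intros Hf Hg. apply (is_derive_mult f g t a b Hf Hg). intros; apply Rmult_comm. Qed.

Lemma is_derive_continuous {V : NormedModule R_AbsRing} (f : R -> V) (x : R) (l : V) :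
  is_derive f x l -> continuous f x.
Proof. intro H. apply ex_derive_continuous. exists l. exact H. Qed.

Definition is_jet2 (f : R -> R) (x a b : R) : Prop :=
  exists f' : R -> R, locally x (fun t => is_derive f t (f' t)) /\ f' x = a /\ is_derive f' x b.

Lemma is_jet2_ext_loc (f g : R -> R) (x a b : R) :
  locally x (fun t => f t = g t) -> is_jet2 f x a b -> is_jet2 g x a b.
Proof.
  intros E [f' [Hf H]]. exists f'. split; [|exact H].
  generalize (filter_and _ _ (locally_locally _ _ E) Hf). apply filter_imp.
  intros t [Et Ht]. exact (is_derive_ext_loc _ _ _ _ Et Ht).
Qed.

Lemma is_jet2_affine (c d x : R) : is_jet2 (fun t => c + t * d) x d 0.
Proof.
  exists (fun _ => d). split; [|split; [reflexivity|]].
  - apply filter_forall. intro t. auto_derive; [exact I|ring].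
  - apply (is_derive_const d).
Qed.

Lemma is_jet2_plus (f g : R -> R) (x a b a' b' : R) :
  is_jet2 f x a b -> is_jet2 g x a' b' -> is_jet2 (fun t => f t + g t) x (a + a') (b + b').
Proof.
  intros [f' [Hf [<- Hf']]] [g' [Hg [<- Hg']]]. exists (fun t => f' t + g' t).
  split; [|split; [reflexivity|]].
  - generalize (filter_and _ _ Hf Hg). apply filter_imp. intros t [? ?].
    apply (is_derive_plus f g); assumption.
  - apply (is_derive_plus f' g'); assumption.
Qed.

Lemma is_jet2_mult (f g : R -> R) (x a b a' b' : R) :
  is_jet2 f x a b -> is_jet2 g x a' b' ->
  is_jet2 (fun t => f t * g t) x (a * g x + f x * a') (b * g x + 2 * (a * a') + f x * b').
Proof.
  intros [f' [Hf [<- Hf']]] [g' [Hg [<- Hg']]]. exists (fun t => f' t * g t + f t * g' t).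
  split; [|split; [reflexivity|]].
  - generalize (filter_and _ _ Hf Hg). apply filter_imp. intros t [? ?].
    apply is_derive_Rmult; assumption.
  - replace (b * g x + 2 * (f' x * g' x) + f x * b')
      with ((b * g x + f' x * g' x) + (f' x * g' x + f x * b')) by ring.
    apply (is_derive_plus (fun t => f' t * g t) (fun t => f t * g' t)); apply is_derive_Rmult;
      try assumption; [exact (locally_singleton _ _ Hg)|exact (locally_singleton _ _ Hf)].
Qed.

Lemma is_jet2_comp (f g : R -> R) (x a b p q : R) :
  is_jet2 f (g x) p q -> is_jet2 g x a b ->
  is_jet2 (fun t => f (g t)) x (a * p) (b * p + a * a * q).
Proof.
  intros [f' [Hf [<- Hf']]] [g' [Hg [<- Hg']]]. exists (fun t => g' t * f' (g t)).
  pose proof (locally_singleton _ _ Hg) as Hgx. split; [|split; [reflexivity|]].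
  - assert (Hfg : locally x (fun t => is_derive f (g t) (f' (g t))))
      by exact (is_derive_continuous _ _ _ Hgx _ Hf).
    generalize (filter_and _ _ Hfg Hg). apply filter_imp. intros t [Hft Hgt].
    exact (is_derive_comp f g t (f' (g t)) (g' t) Hft Hgt).
  - rewrite Rmult_assoc. apply (is_derive_Rmult g' (fun t => f' (g t))); [exact Hg'|].
    exact (is_derive_comp f' g x q (g' x) Hf' Hgx).
Qed.

Lemma is_jet2_unique (f : R -> R) (x a b a' b' : R) :
  is_jet2 f x a b -> is_jet2 f x a' b' -> b = b'.
Proof.
  intros [f1 [H1 [_ H1']]] [f2 [H2 [_ H2']]].
  apply is_derive_unique in H1'. rewrite <- H1'. apply is_derive_unique.
  apply (is_derive_ext_loc f2); [|exact H2'].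
  generalize (filter_and _ _ H1 H2). apply filter_imp. intros t [D1 D2].
  apply is_derive_unique in D1, D2. congruence.
Qed.

Lemma is_derive_local_max (f : R -> R) (x a : R) :
  is_derive f x a -> locally x (fun t => f t <= f x) -> a = 0.
Proof.
  intros D Hmax. apply locally_R_iff in Hmax. destruct Hmax as [d [Hd Hmax]].
  apply is_derive_Reals in D. set (pr := exist _ a D : derivable_pt f x).
  apply (deriv_maximum f (x - d) (x + d) x pr); try lra.
  intros t H1 H2. apply Hmax. apply Rabs_def1; lra.
Qed.

Lemma is_derive_pos_increasing_right (f : R -> R) (x a : R) :
  is_derive f x a -> 0 < a -> locally x (fun t => x < t -> f x < f t).
Proof.
  intros D Ha. apply is_derive_Reals in D. destruct (D a Ha) as [d Hd].
  apply locally_R_iff. exists d. split; [apply cond_pos|]. intros t Ht Hxt.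
  specialize (Hd (t - x)). replace (x + (t - x)) with t in Hd by ring.
  assert (Hne : t - x <> 0) by lra. specialize (Hd Hne Ht). apply Rabs_def2 in Hd.
  assert (Hslope : 0 < (f t - f x) / (t - x)) by lra.
  apply (Rmult_lt_compat_r (t - x)) in Hslope; [|lra].
  replace ((f t - f x) / (t - x) * (t - x)) with (f t - f x) in Hslope by (field; exact Hne). lra.
Qed.

Lemma is_jet2_local_max (f : R -> R) (x a b : R) :
  is_jet2 f x a b -> locally x (fun t => f t <= f x) -> b <= 0.
Proof.
  intros [f' [Hf [_ Hf']]] Hmax. apply Rnot_lt_le. intro Hb.
  pose proof (is_derive_local_max _ _ _ (locally_singleton _ _ Hf) Hmax) as Hcrit.
  pose proof (filter_and _ _ (filter_and _ _ Hf Hmax)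
    (is_derive_pos_increasing_right _ _ _ Hf' Hb)) as H.
  apply locally_R_iff in H. destruct H as [d [Hd H]].
  assert (Hin : forall t, x <= t <= x + d / 2 -> Rabs (t - x) < d)
    by (intros t Ht; apply Rabs_def1; lra).
  destruct (MVT_cor2 f f' x (x + d / 2)) as [c [E Hc]]; [lra| |].
  - intros c Hc. apply is_derive_Reals. apply H, Hin, Hc.
  - destruct (H c) as [_ Hpos]; [apply Hin; lra|].
    destruct (H (x + d / 2)) as [[_ Hle] _]; [apply Hin; lra|].
    rewrite Hcrit in Hpos. specialize (Hpos (proj1 Hc)). nra.
Qed.

Definition line (f : R4 -> R) (v : R4) (i : nat) : R -> R :=
  fun t => f (v ⊕ t ⊙ basis i).

Definition is_grad_lap (f : R4 -> R) (v : R4) (g : nat -> R) (l : R) : Prop :=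
  exists d, (forall i, is_jet2 (line f v i) 0 (g i) (d i)) /\ l = sum4 d.

Definition is_lap (f : R4 -> R) (v : R4) (l : R) : Prop := exists g, is_grad_lap f v g l.

Definition harmonic_at (f : R4 -> R) (v : R4) : Prop := is_lap f v 0 /\ continuous f v.

Lemma line_0 (f : R4 -> R) (v : R4) (i : nat) : line f v i 0 = f v.
Proof. unfold line. f_equal. coords. ring. Qed.

Lemma is_grad_lap_ext_loc (f h : R4 -> R) (v : R4) (g : nat -> R) (l : R) :
  locally v (fun w => f w = h w) -> is_grad_lap f v g l -> is_grad_lap h v g l.
Proof.
  intros E [d [Hd ->]]. exists d. split; [|reflexivity]. intro i.
  apply (is_jet2_ext_loc (line f v i)); [|apply Hd].
  exact (locally_axis i v (fun w => f w = h w) E).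
Qed.

Lemma is_grad_lap_const (c : R) (v : R4) : is_grad_lap (fun _ => c) v (fun _ => 0) 0.
Proof.
  exists (fun _ => 0). split; [|unfold sum4; ring]. intro i.
  apply (is_jet2_ext_loc (fun t => c + t * 0)); [|apply is_jet2_affine].
  apply filter_forall. intro t. unfold line. ring.
Qed.

Lemma is_grad_lap_coord (j : nat) (v : R4) :
  is_grad_lap (coord j) v (fun i => coord j (basis i)) 0.
Proof.
  exists (fun _ => 0). split; [|unfold sum4; ring]. intro i.
  apply (is_jet2_ext_loc (fun t => coord j v + t * coord j (basis i))); [|apply is_jet2_affine].
  apply filter_forall. intro t. unfold line. rewrite coord_plus, coord_scal. reflexivity.
Qed.

Lemma is_grad_lap_plus (f f' : R4 -> R) (v : R4) (g g' : nat -> R) (l l' : R) :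
  is_grad_lap f v g l -> is_grad_lap f' v g' l' ->
  is_grad_lap (fun w => f w + f' w) v (fun i => g i + g' i) (l + l').
Proof.
  intros [d [Hd ->]] [d' [Hd' ->]]. exists (fun i => d i + d' i). split; [|unfold sum4; ring].
  intro i. exact (is_jet2_plus _ _ _ _ _ _ _ (Hd i) (Hd' i)).
Qed.

Lemma is_grad_lap_mult (f f' : R4 -> R) (v : R4) (g g' : nat -> R) (l l' : R) :
  is_grad_lap f v g l -> is_grad_lap f' v g' l' ->
  is_grad_lap (fun w => f w * f' w) v (fun i => g i * f' v + f v * g' i)
    (l * f' v + 2 * sum4 (fun i => g i * g' i) + f v * l').
Proof.
  intros [d [Hd ->]] [d' [Hd' ->]].
  exists (fun i => d i * f' v + 2 * (g i * g' i) + f v * d' i). split; [|unfold sum4; ring].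
  intro i. pose proof (is_jet2_mult _ _ _ _ _ _ _ (Hd i) (Hd' i)) as J.
  rewrite !line_0 in J. exact J.
Qed.

Lemma line_dot_self (v : R4) (i : nat) (t : R) :
  line (fun w => dot w w) v i t = dot v v + 2 * coord i v * t + t * t.
Proof.
  unfold line. rewrite dot_plus_self, dot_scal_self, dot_scal_r, dot_basis_self, dot_basis_r. ring.
Qed.

Lemma is_jet2_line_dot_self (v : R4) (i : nat) :
  is_jet2 (line (fun w => dot w w) v i) 0 (2 * coord i v) 2.
Proof.
  apply (is_jet2_ext_loc (fun t => dot v v + 2 * coord i v * t + t * t)).
  - apply filter_forall. intro t. symmetry. apply line_dot_self.
  - exists (fun t => 2 * coord i v + 2 * t).
    split; [|split; [ring|auto_derive; [exact I|ring]]].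
    apply filter_forall. intro t. auto_derive; [exact I|ring].
Qed.

Lemma is_grad_lap_radial (f : R -> R) (v : R4) (p q : R) :
  is_jet2 f (dot v v) p q ->
  is_grad_lap (fun w => f (dot w w)) v (fun i => 2 * coord i v * p) (4 * dot v v * q + 8 * p).
Proof.
  intro J. exists (fun i => 2 * p + 2 * coord i v * (2 * coord i v) * q).
  split; [|unfold dot, sum4; ring]. intro i.
  apply (is_jet2_comp f (line (fun w => dot w w) v i)); [|apply is_jet2_line_dot_self].
  rewrite line_0. exact J.
Qed.

Lemma is_lap_unique (f : R4 -> R) (v : R4) (l l' : R) : is_lap f v l -> is_lap f v l' -> l = l'.
Proof.
  intros [g [d [Hd ->]]] [g' [d' [Hd' ->]]].
  assert (E : forall i, d i = d' i) by (intro i; exact (is_jet2_unique _ _ _ _ _ _ (Hd i) (Hd' i))).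
  unfold sum4. rewrite !E. reflexivity.
Qed.

Lemma is_lap_ext_loc (f h : R4 -> R) (v : R4) (l : R) :
  locally v (fun w => f w = h w) -> is_lap f v l -> is_lap h v l.
Proof. intros E [g Hg]. exists g. exact (is_grad_lap_ext_loc _ _ _ _ _ E Hg). Qed.

Lemma is_lap_plus (f h : R4 -> R) (v : R4) (l m : R) :
  is_lap f v l -> is_lap h v m -> is_lap (fun w => f w + h w) v (l + m).
Proof. intros [g Hg] [g' Hg']. eexists. apply is_grad_lap_plus; eassumption. Qed.

Lemma is_lap_scal (c : R) (f : R4 -> R) (v : R4) (l : R) :
  is_lap f v l -> is_lap (fun w => c * f w) v (c * l).
Proof.
  intros [g Hg]. eexists.
  pose proof (is_grad_lap_mult _ _ _ _ _ _ _ (is_grad_lap_const c v) Hg) as H.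
  replace (c * l) with (0 * f v + 2 * sum4 (fun i => 0 * g i) + c * l) by (unfold sum4; ring).
  exact H.
Qed.

Lemma is_lap_dot_self (v : R4) : is_lap (fun w => dot w w) v 8.
Proof.
  eexists. replace 8 with (4 * dot v v * 0 + 8 * 1) by ring.
  apply (is_grad_lap_radial (fun s => s)).
  apply (is_jet2_ext_loc (fun t => 0 + t * 1)); [|apply is_jet2_affine].
  apply filter_forall. intro t. ring.
Qed.

Lemma is_lap_coord_sqr (j : nat) (v : R4) : is_lap (fun w => coord j w * coord j w) v 2.
Proof.
  pose proof (is_grad_lap_coord j v) as H. eexists.
  replace 2 with (0 * coord j v + 2 * sum4 (fun i => coord j (basis i) * coord j (basis i))
    + coord j v * 0) by (unfold sum4; index_cases j; simpl; ring).
  apply is_grad_lap_mult; exact H.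
Qed.

(* Covers translations, homotheties and reflections in coordinate hyperplanes. *)
Lemma is_lap_comp (A : R4 -> R4) (c : nat -> R) (s : R) (f : R4 -> R) (v : R4) (l : R) :
  (forall i t, A (v ⊕ t ⊙ basis i) = A v ⊕ (t * c i) ⊙ basis i) ->
  (forall i, c i * c i = s) ->
  is_lap f (A v) l -> is_lap (fun w => f (A w)) v (s * l).
Proof.
  intros HA Hc [g [d [Hd ->]]]. exists (fun i => c i * g i), (fun i => s * d i).
  split; [|unfold sum4; ring]. intro i.
  apply (is_jet2_ext_loc (fun t => line f (A v) i (0 + t * c i))).
  - apply filter_forall. intro t. unfold line. rewrite HA, Rplus_0_l. reflexivity.
  - replace (s * d i) with (0 * g i + c i * c i * d i) by (rewrite Hc; ring).
    apply (is_jet2_comp (line f (A v) i) (fun t => 0 + t * c i)); [|apply is_jet2_affine].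
    replace (0 + 0 * c i) with 0 by ring. apply Hd.
Qed.

Lemma is_lap_local_max (f : R4 -> R) (v : R4) (l : R) :
  is_lap f v l -> locally v (fun w => f w <= f v) -> l <= 0.
Proof.
  intros [g [d [Hd ->]]] Hmax.
  assert (Hneg : forall i, d i <= 0).
  { intro i. apply (is_jet2_local_max _ _ _ _ (Hd i)). rewrite line_0.
    exact (locally_axis i v (fun w => f w <= f v) Hmax). }
  pose proof (Hneg 0%nat). pose proof (Hneg 1%nat).
  pose proof (Hneg 2%nat). pose proof (Hneg 3%nat).
  unfold sum4. lra.
Qed.

Lemma harmonic_at_const (c : R) (v : R4) : harmonic_at (fun _ => c) v.
Proof. split; [eexists; apply is_grad_lap_const|apply continuous_const]. Qed.

Lemma harmonic_at_coord (i : nat) (v : R4) : harmonic_at (coord i) v.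
Proof. split; [eexists; apply is_grad_lap_coord|apply continuous_coord]. Qed.

Lemma harmonic_at_plus (f h : R4 -> R) (v : R4) :
  harmonic_at f v -> harmonic_at h v -> harmonic_at (fun w => f w + h w) v.
Proof.
  intros [Lf Cf] [Lh Ch]. split; [|apply continuous_Rplus; assumption].
  replace 0 with (0 + 0) by ring. apply is_lap_plus; assumption.
Qed.

Lemma harmonic_at_scal (c : R) (f : R4 -> R) (v : R4) :
  harmonic_at f v -> harmonic_at (fun w => c * f w) v.
Proof.
  intros [Lf Cf]. split; [|apply continuous_Rmult; [apply continuous_const|exact Cf]].
  replace 0 with (c * 0) by ring. apply is_lap_scal, Lf.
Qed.

Lemma harmonic_at_minus (f h : R4 -> R) (v : R4) :
  harmonic_at f v -> harmonic_at h v -> harmonic_at (fun w => f w - h w) v.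
Proof.
  intros Hf Hh. replace (fun w => f w - h w) with (fun w => f w + -1 * h w)
    by (apply functional_extensionality; intro; ring).
  apply harmonic_at_plus, harmonic_at_scal; assumption.
Qed.

Lemma harmonic_at_translate (f : R4 -> R) (u v : R4) :
  harmonic_at f (v ⊕ u) -> harmonic_at (fun w => f (w ⊕ u)) v.
Proof.
  intros [Lf Cf]. split; [|apply continuous_translate, Cf].
  replace 0 with (1 * 0) by ring.
  apply (is_lap_comp (fun w => plus w u) (fun _ => 1)); [| |exact Lf]; [|intro; ring].
  intros i t. coords. ring.
Qed.

(** * The maximum principle *)

Lemma maximum_principle (f : R4 -> R) (dom : R4 -> Prop) (r : R) :
  (forall v, dom v -> norm v <= r) ->
  (forall v, (forall e, 0 < e -> locally v (fun w => dom w -> f w <= e)) \/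
     locally v dom /\ harmonic_at f v) ->
  forall v, dom v -> f v <= 0.
Proof.
  intros Hr Hf u Hu. apply Rnot_lt_le. intro Hpos.
  set (eta := f u / (2 * (r * r + 1))).
  assert (Heta : 0 < eta) by (apply Rdiv_lt_0_compat; nra).
  set (g := fun v => f v + eta * dot v v).
  assert (Hg : forall v, dom v -> g v <= f v + f u / 2).
  { intros v Hv. pose proof (Hr v Hv). pose proof (norm_ge_0 v). pose proof (norm_sqr v).
    assert (eta * (2 * (r * r + 1)) = f u) by (unfold eta; field; nra).
    assert (dot v v <= r * r) by nra. unfold g. nra. }
  assert (Hgu : f u <= g u) by (unfold g; pose proof (dot_self_nonneg u); nra).
  destruct (exists_sup_limit_point g dom r Hr) as [v Hsup].
  destruct (Hf v) as [Hbdry|[Hdom [Hlap Hcont]]].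
  - assert (g u <= f u / 4 + f u / 2); [|lra]. apply Hsup; [|exact Hu].
    assert (He : 0 < f u / 4) by lra. generalize (Hbdry _ He). apply filter_imp.
    intros w Hw Hd. specialize (Hw Hd). specialize (Hg w Hd). lra.
  - assert (Hgc : continuous g v).
    { apply continuous_Rplus; [exact Hcont|].
      apply continuous_Rmult; [apply continuous_const|apply continuous_dot_self]. }
    assert (Hmax : forall w, dom w -> g w <= g v).
    { intros w Hw. apply Rnot_lt_le. intro Hlt.
      assert (Hmid : g v < (g v + g w) / 2) by lra.
      assert (g w <= (g v + g w) / 2); [|lra]. apply Hsup; [|exact Hw].
      generalize (locally_lt g v _ Hgc Hmid). apply filter_imp. intros; lra. }
    assert (0 + eta * 8 <= 0); [|lra]. apply (is_lap_local_max g v).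
    + apply is_lap_plus, is_lap_scal, is_lap_dot_self. exact Hlap.
    + revert Hdom. apply filter_imp, Hmax.
Qed.

(** * Differences of bounded harmonic functions *)

Definition reflect (i : nat) (v : R4) : R4 := v ⊖ (2 * coord i v) ⊙ basis i.

Lemma norm_reflect (i : nat) (v : R4) : norm (reflect i v) = norm v.
Proof.
  rewrite !norm_sqrt. f_equal.
  replace (reflect i v) with (v ⊕ (-2 * coord i v) ⊙ basis i)
    by (unfold reflect; coords; ring).
  rewrite dot_plus_self, dot_scal_self, dot_scal_r, dot_basis_self, dot_basis_r. ring.
Qed.

Lemma continuous_reflect (i : nat) (v : R4) : continuous (reflect i) v.
Proof.
  apply (continuous_minus (fun w : R4 => w) (fun w => scal (2 * coord i w) (basis i)));
    [apply continuous_id|].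
  apply (continuous_scal (fun w => 2 * coord i w) (fun _ => basis i)); [|apply continuous_const].
  apply continuous_Rmult; [apply continuous_const|apply continuous_coord].
Qed.

Lemma harmonic_at_reflect (f : R4 -> R) (i : nat) (v : R4) :
  harmonic_at f (reflect i v) -> harmonic_at (fun w => f (reflect i w)) v.
Proof.
  intros [Lf Cf]. split; [|exact (continuous_comp _ _ _ (continuous_reflect i v) Cf)].
  replace 0 with (1 * 0) by ring.
  apply (is_lap_comp (reflect i) (fun j => 1 - 2 * coord i (basis j))); [| |exact Lf].
  - intros j t. unfold reflect. coords. index_cases i; index_cases j; index_cases i0; simpl; ring.
  - intro j. index_cases i; index_cases j; simpl; ring.
Qed.

Definition barrier (i : nat) (rho : R) (v : R4) : R :=
  / (rho * rho) * (dot v v - 4 * (coord i v * coord i v)) + 4 / rho * coord i v.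

Lemma harmonic_at_barrier (i : nat) (rho : R) (v : R4) : harmonic_at (barrier i rho) v.
Proof.
  apply harmonic_at_plus; apply harmonic_at_scal; [|apply harmonic_at_coord].
  split.
  - replace 0 with (8 + -4 * 2) by ring.
    replace (fun w => dot w w - 4 * (coord i w * coord i w))
      with (fun w => dot w w + -4 * (coord i w * coord i w))
      by (apply functional_extensionality; intro; ring).
    apply is_lap_plus, is_lap_scal, is_lap_coord_sqr. apply is_lap_dot_self.
  - apply continuous_Rminus; [apply continuous_dot_self|].
    apply continuous_Rmult; [apply continuous_const|].
    apply continuous_Rmult; apply continuous_coord.
Qed.

Lemma barrier_plane (i : nat) (rho : R) (v : R4) : coord i v = 0 -> 0 <= barrier i rho v.
Proof.
  intro E. unfold barrier. rewrite E, !Rmult_0_r, Rminus_0_r, Rplus_0_r.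
  apply Rmult_le_pos; [|apply dot_self_nonneg].
  destruct (Req_dec rho 0) as [->|Hrho]; [rewrite Rmult_0_l, Rinv_0; apply Rle_refl|].
  left. apply Rinv_0_lt_compat. nra.
Qed.

Lemma barrier_sphere (i : nat) (rho : R) (v : R4) :
  0 < rho -> norm v = rho -> 0 <= coord i v -> 1 <= barrier i rho v.
Proof.
  intros Hrho Hv Hi. pose proof (coord_le_norm i v) as Hle. rewrite Rabs_pos_eq in Hle by exact Hi.
  set (t := coord i v / rho).
  assert (0 <= t) by (apply Rmult_le_pos; [exact Hi|left; apply Rinv_0_lt_compat, Hrho]).
  assert (t <= 1) by (apply Rle_div_l; lra).
  replace (barrier i rho v) with (1 + 4 * (t * (1 - t))) by
    (unfold barrier, t; rewrite <- norm_sqr, Hv; field; lra).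
  nra.
Qed.

Lemma barrier_axis (i : nat) (rho h : R) :
  0 < rho -> 0 <= h -> barrier i rho (h ⊙ basis i) <= 4 * h / rho.
Proof.
  intros Hrho Hh. unfold barrier.
  rewrite dot_scal_self, dot_basis_self, coord_scal, coord_basis_same.
  assert (0 <= / (rho * rho) * (3 * (h * h))).
  { apply Rmult_le_pos; [left; apply Rinv_0_lt_compat; nra|nra]. }
  unfold Rdiv in *. nra.
Qed.

(* The odd part of [u] in the [i]-th direction vanishes on the plane [coord i v = 0], so on the
   half ball it is dominated by [2 M] times the barrier. *)
Lemma odd_part_le_barrier (u : R4 -> R) (i : nat) (rho M : R) :
  0 < rho -> (forall v, norm v < rho -> harmonic_at u v /\ Rabs (u v) <= M) ->
  forall v, norm v < rho -> 0 < coord i v ->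
    u v - u (reflect i v) - 2 * M * barrier i rho v <= 0.
Proof.
  intros Hrho Hu v Hv Hi.
  assert (HM : 0 <= M) by (eapply Rle_trans; [apply Rabs_pos|apply (Hu v Hv)]).
  set (f := fun v => u v - u (reflect i v) - 2 * M * barrier i rho v).
  assert (Hf : forall v, norm v < rho -> harmonic_at f v).
  { intros w Hw. apply harmonic_at_minus; [|apply harmonic_at_scal, harmonic_at_barrier].
    apply harmonic_at_minus; [apply Hu, Hw|].
    apply harmonic_at_reflect, Hu. rewrite norm_reflect. exact Hw. }
  apply (maximum_principle f (fun w => norm w < rho /\ 0 < coord i w) rho);
    [intros w [Hw _]; lra| |split; assumption].
  clear v Hv Hi. intro v. destruct (Rlt_or_le (coord i v) 0) as [Hi|Hi].
  { left. intros e _. generalize (locally_lt (coord i) v 0 (continuous_coord i v) Hi).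
    apply filter_imp. intros; lra. }
  destruct (Rtotal_order (norm v) rho) as [Hv|[Hv|Hv]].
  - destruct Hi as [Hi|Hi].
    + right. split; [|apply Hf, Hv]. apply filter_and.
      * apply locally_lt; [apply continuous_norm|exact Hv].
      * apply locally_gt; [apply continuous_coord|exact Hi].
    + left. intros e He.
      assert (Hfv : f v < e).
      { unfold f. replace (reflect i v) with v by (unfold reflect; rewrite <- Hi; coords; ring).
        pose proof (barrier_plane i rho v (eq_sym Hi)). nra. }
      generalize (locally_lt f v e (proj2 (Hf v Hv)) Hfv). apply filter_imp. intros; lra.
  - left. intros e He. pose proof (barrier_sphere i rho v Hrho Hv Hi) as Hb.
    assert (Hlt : 2 * M - e < 2 * M * barrier i rho v) by nra.
    assert (Hcont : continuous (fun w => 2 * M * barrier i rho w) v)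
      by (apply continuous_Rmult; [apply continuous_const|apply harmonic_at_barrier]).
    generalize (locally_gt _ v _ Hcont Hlt). apply filter_imp. intros w Hw [Hwr _]. unfold f.
    assert (Hrw : norm (reflect i w) < rho) by (rewrite norm_reflect; exact Hwr).
    pose proof (proj1 (Rabs_le_between _ _) (proj2 (Hu w Hwr))).
    pose proof (proj1 (Rabs_le_between _ _) (proj2 (Hu _ Hrw))). lra.
  - left. intros e _. generalize (locally_gt norm v rho (continuous_norm v) Hv).
    apply filter_imp. intros; lra.
Qed.

Lemma harmonic_symmetric_difference (u : R4 -> R) (i : nat) (rho M h : R) :
  (forall v, norm v < rho -> harmonic_at u v /\ Rabs (u v) <= M) -> Rabs h < rho ->
  Rabs (u (h ⊙ basis i) - u ((- h) ⊙ basis i)) <= 8 * M * Rabs h / rho.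
Proof.
  assert (upper : forall u h, (forall v, norm v < rho -> harmonic_at u v /\ Rabs (u v) <= M) ->
    0 < h < rho -> u (h ⊙ basis i) - u ((- h) ⊙ basis i) <= 8 * M * h / rho).
  { clear. intros u h Hu Hh. set (v := h ⊙ basis i).
    assert (Hv : norm v < rho) by (unfold v; rewrite norm_scal_basis, Rabs_pos_eq; lra).
    assert (Hi : 0 < coord i v) by (unfold v; rewrite coord_scal, coord_basis_same; lra).
    assert (Hrho : 0 < rho) by lra.
    assert (HM : 0 <= M) by (eapply Rle_trans; [apply Rabs_pos|apply (Hu v Hv)]).
    pose proof (odd_part_le_barrier u i rho M Hrho Hu v Hv Hi) as Hodd.
    pose proof (barrier_axis i rho h Hrho (Rlt_le _ _ (proj1 Hh))) as Hb. fold v in Hb.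
    replace ((- h) ⊙ basis i) with (reflect i v)
      by (unfold reflect, v; rewrite coord_scal, coord_basis_same; coords; ring).
    assert (2 * M * barrier i rho v <= 2 * M * (4 * h / rho)) by (apply Rmult_le_compat_l; lra).
    unfold Rdiv in *. lra. }
  assert (positive : forall h, (forall v, norm v < rho -> harmonic_at u v /\ Rabs (u v) <= M) ->
    0 < h < rho -> Rabs (u (h ⊙ basis i) - u ((- h) ⊙ basis i)) <= 8 * M * h / rho).
  { clear h. intros h Hu Hh. apply Rabs_le_between. split; [|apply upper; assumption].
    assert (Hopp : forall v, norm v < rho -> harmonic_at (fun v => -1 * u v) v /\
      Rabs (-1 * u v) <= M).
    { intros v Hv. split; [apply harmonic_at_scal, Hu, Hv|].
      replace (-1 * u v) with (- u v) by ring. rewrite Rabs_Ropp. apply Hu, Hv. }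
    pose proof (upper _ h Hopp Hh). lra. }
  intros Hu Hh. destruct (Rtotal_order h 0) as [Hneg|[->|Hpos]].
  - rewrite Rabs_minus_sym. pattern h at 2. rewrite <- (Ropp_involutive h).
    rewrite (Rabs_left h) in * by exact Hneg. apply positive; [exact Hu|lra].
  - rewrite Ropp_0, Rminus_diag, !Rabs_R0. unfold Rdiv. lra.
  - rewrite (Rabs_pos_eq h) in * by lra. apply positive; [exact Hu|lra].
Qed.

Definition diff {X : Type} (shift : X -> X) (f : X -> R) : X -> R := fun v => f (shift v) - f v.

Definition translate (h v : R4) : R4 := v ⊕ h.

Lemma harmonic_diff_le (f : R4 -> R) (i : nat) (t : R) (v : R4) (rho M : R) :
  Rabs t < rho ->
  (forall w : R4, norm (w ⊖ v) < 2 * rho -> harmonic_at f w /\ Rabs (f w) <= M) ->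
  Rabs (diff (translate (t ⊙ basis i)) f v) <= 4 * M * Rabs t / rho.
Proof.
  intros Ht Hf. set (c := v ⊕ (t / 2) ⊙ basis i).
  assert (Hhalf : Rabs (t / 2) = Rabs t / 2)
    by (unfold Rdiv; rewrite Rabs_mult, (Rabs_pos_eq (/ 2)); lra).
  pose proof (Rabs_pos t) as Ht0.
  assert (Hu : forall w, norm w < rho ->
    harmonic_at (fun w => f (w ⊕ c)) w /\ Rabs (f (w ⊕ c)) <= M).
  { intros w Hw.
    assert (Hwc : norm (w ⊕ c ⊖ v) < 2 * rho).
    { replace (w ⊕ c ⊖ v) with (w ⊕ (t / 2) ⊙ basis i) by (unfold c; coords; ring).
      eapply Rle_lt_trans; [apply norm_triangle|]. rewrite norm_scal_basis, Hhalf. lra. }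
    split; [apply harmonic_at_translate|]; apply Hf, Hwc. }
  pose proof (harmonic_symmetric_difference _ i rho M (t / 2) Hu) as H. cbv beta in H.
  assert (Eright : (t / 2) ⊙ basis i ⊕ c = v ⊕ t ⊙ basis i)
    by (unfold c; coords; field).
  assert (Eleft : (- (t / 2)) ⊙ basis i ⊕ c = v) by (unfold c; coords; field).
  rewrite Eright, Eleft in H. unfold diff.
  eapply Rle_trans; [apply H; lra|]. rewrite Hhalf. right. field. lra.
Qed.

(** * Harmonic functions with finitely many singularities *)

(* The growth condition says that [f] is O(|v|^(n-1)) at infinity, in a form that makes sense for
   [n = 0]. *)
Record tame (n : nat) (s : list R4) (f : R4 -> R) : Prop := {
  tame_harmonic : forall v, ~ In v s -> harmonic_at f v;
  tame_bounded : forall v, exists b, locally v (fun w => Rabs (f w) <= b);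
  tame_growth : exists c r, 0 <= c /\ 0 < r /\
    forall v, r <= norm v -> Rabs (f v) * norm v <= c * norm v ^ n
}.

Lemma exists_norm_bound (s : list R4) : exists b, 0 <= b /\ forall p, In p s -> norm p <= b.
Proof.
  destruct (exists_max_In (fun p : R4 => norm p) origin s) as [p Hp].
  exists (norm p). split; [apply norm_ge_0|]. intros q Hq. apply Hp. right. exact Hq.
Qed.

Lemma tame_diff_growth (n : nat) (s : list R4) (f : R4 -> R) (i : nat) (t : R) :
  tame (S n) s f -> exists c r, 0 <= c /\ 0 < r /\
    forall v, r <= norm v -> Rabs (diff (translate (t ⊙ basis i)) f v) * norm v <= c * norm v ^ n.
Proof.
  intros [Hharm _ [c [r [Hc [Hr Hg]]]]]. destruct (exists_norm_bound s) as [b [Hb Hs]].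
  pose proof (Rabs_pos t) as Ht.
  exists (16 * Rabs t * (c * (3 / 2) ^ n)), (2 * r + 2 * b + 4 * Rabs t + 1).
  split; [|split; [lra|]].
  { apply Rmult_le_pos; [lra|]. apply Rmult_le_pos; [exact Hc|apply pow_le; lra]. }
  intros v Hv. set (m := norm v) in *.
  assert (Hnear : forall w : R4, norm (w ⊖ v) < 2 * (m / 4) ->
    harmonic_at f w /\ Rabs (f w) <= c * (3 / 2 * m) ^ n).
  { intros w Hw. assert (Hinv : Rabs (norm w - m) <= norm (w ⊖ v)) by apply norm_triangle_inv.
    apply Rabs_le_between in Hinv. split.
    - apply Hharm. intro Hin. specialize (Hs w Hin). lra.
    - assert (Hgw : Rabs (f w) <= c * norm w ^ n).
      { apply Rmult_le_reg_r with (norm w); [lra|].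
        eapply Rle_trans; [apply Hg; lra|]. simpl. right. ring. }
      eapply Rle_trans; [exact Hgw|]. apply Rmult_le_compat_l; [exact Hc|]. apply pow_incr. lra. }
  pose proof (harmonic_diff_le f i t v (m / 4) _ ltac:(lra) Hnear) as H.
  eapply Rle_trans; [apply Rmult_le_compat_r; [lra|exact H]|].
  right. rewrite Rpow_mult_distr. field. lra.
Qed.

Lemma tame_diff (n : nat) (s : list R4) (f : R4 -> R) (i : nat) (t : R) :
  tame (S n) s f ->
  tame n (s ++ map (fun p => p ⊖ t ⊙ basis i) s) (diff (translate (t ⊙ basis i)) f).
Proof.
  intro T. split; [| |exact (tame_diff_growth n s f i t T)]; destruct T as [Hharm Hb _].
  - intros v Hv. apply harmonic_at_minus.
    + apply harmonic_at_translate, Hharm. intro Hin. apply Hv, in_or_app. right.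
      apply in_map_iff. eexists. split; [|exact Hin]. coords. ring.
    + apply Hharm. intro Hin. apply Hv, in_or_app. left. exact Hin.
  - intro v. destruct (Hb v) as [b Hloc]. destruct (Hb (v ⊕ t ⊙ basis i)) as [b' Hloc'].
    exists (b' + b). generalize (filter_and _ _ (locally_translate _ _ _ Hloc') Hloc).
    apply filter_imp. intros w [H1 H2]. unfold diff, translate, Rminus.
    eapply Rle_trans; [apply Rabs_triang|]. rewrite Rabs_Ropp. lra.
Qed.

Lemma tame_opp (n : nat) (s : list R4) (f : R4 -> R) :
  tame n s f -> tame n s (fun v => -1 * f v).
Proof.
  assert (E : forall v, Rabs (-1 * f v) = Rabs (f v)).
  { intro v. replace (-1 * f v) with (- f v) by ring. apply Rabs_Ropp. }
  intros [Hharm Hb Hg]. split.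
  - intros v Hv. apply harmonic_at_scal, Hharm, Hv.
  - intro v. destruct (Hb v) as [b Hloc]. exists b. revert Hloc. apply filter_imp.
    intro w. rewrite E. trivial.
  - destruct Hg as [c [r Hg]]. exists c, r. repeat split; try apply Hg.
    intros v Hv. rewrite E. apply Hg, Hv.
Qed.

(* The Newtonian kernel of dimension 4. *)
Definition pole (v : R4) : R := / dot v v.

Lemma pole_nonneg (v : R4) : 0 <= pole v.
Proof.
  unfold pole. destruct (dot_self_nonneg v) as [H|H].
  - left. apply Rinv_0_lt_compat, H.
  - rewrite <- H, Rinv_0. apply Rle_refl.
Qed.

Lemma harmonic_at_pole (v : R4) : v <> origin -> harmonic_at pole v.
Proof.
  intro Hv. apply dot_self_gt_0 in Hv. split.
  - eexists. unfold pole.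
    replace 0 with (4 * dot v v * (2 / dot v v ^ 3) + 8 * (- 1 / dot v v ^ 2)) by (field; lra).
    apply (is_grad_lap_radial Rinv). exists (fun s => - 1 / s ^ 2). split; [|split; [reflexivity|]].
    + generalize (locally_gt (fun s : R => s) _ _ (continuous_id _) Hv). apply filter_imp.
      intros s Hs. auto_derive; [lra|field; lra].
    + auto_derive; [nra|field; lra].
  - apply (continuous_comp (fun w => dot w w) Rinv); [apply continuous_dot_self|].
    apply (is_derive_continuous Rinv _ (- 1 / dot v v ^ 2)). auto_derive; [lra|field; lra].
Qed.

Lemma locally_pole_ge (p : R4) (b : R) : locally p (fun w => w <> p -> b <= pole (w ⊖ p)).
Proof.
  set (c := Rmax b 1).
  assert (Hc : b <= c /\ 0 < c)
    by (pose proof (Rmax_l b 1); pose proof (Rmax_r b 1); unfold c; lra).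
  assert (Hpos : 0 < sqrt (/ c)) by (apply sqrt_lt_R0, Rinv_0_lt_compat, Hc).
  apply locally_R4_iff. exists (sqrt (/ c)). split; [exact Hpos|]. intros w Hw Hne.
  assert (Hdot : 0 < dot (w ⊖ p) (w ⊖ p)).
  { apply dot_self_gt_0. intro E. apply Hne, vminus_eq_origin, E. }
  assert (Hlt : dot (w ⊖ p) (w ⊖ p) < / c).
  { rewrite <- norm_sqr, <- (sqrt_sqrt (/ c)) by (left; apply Rinv_0_lt_compat, Hc).
    pose proof (norm_ge_0 (w ⊖ p)). nra. }
  apply Rle_trans with c; [apply Hc|]. unfold pole. rewrite <- (Rinv_inv c).
  left. apply Rinv_lt_contravar; [|exact Hlt].
  apply Rmult_lt_0_compat; [exact Hdot|apply Rinv_0_lt_compat, Hc].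
Qed.

Definition sum_poles (s : list R4) (v : R4) : R :=
  fold_right (fun p a => pole (v ⊖ p) + a) 0 s.

Lemma sum_poles_nonneg (s : list R4) (v : R4) : 0 <= sum_poles s v.
Proof.
  induction s as [|p s IH]; simpl; [lra|]. pose proof (pole_nonneg (v ⊖ p)). lra.
Qed.

Lemma pole_le_sum_poles (s : list R4) (p v : R4) : In p s -> pole (v ⊖ p) <= sum_poles s v.
Proof.
  induction s as [|q s IH]; intros []; simpl.
  - subst. pose proof (sum_poles_nonneg s v). lra.
  - pose proof (pole_nonneg (v ⊖ q)). specialize (IH H). lra.
Qed.

Lemma harmonic_at_sum_poles (s : list R4) (v : R4) : ~ In v s -> harmonic_at (sum_poles s) v.
Proof.
  induction s as [|p s IH]; intro Hv.
  - apply harmonic_at_const.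
  - apply (harmonic_at_plus (fun w => pole (w ⊖ p)) (sum_poles s)).
    + apply (harmonic_at_translate pole), harmonic_at_pole. intro E. apply Hv. left.
      symmetry. apply vminus_eq_origin, E.
    + apply IH. intro Hin. apply Hv. right. exact Hin.
Qed.

Lemma locally_punctured_not_In (s : list R4) (v : R4) :
  locally v (fun w => w <> v -> ~ In w s).
Proof.
  induction s as [|p s IH]; [apply filter_forall; intros w _ []|].
  destruct (classic (v = p)) as [->|Hp];
    [revert IH|generalize (filter_and _ _ (locally_neq p v Hp) IH)]; apply filter_imp.
  - intros w Hw Hne [E|Hin]; [exact (Hne (eq_sym E))|exact (Hw Hne Hin)].
  - intros w [Hwp Hw] Hne [E|Hin]; [exact (Hwp (eq_sym E))|exact (Hw Hne Hin)].
Qed.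

Lemma locally_not_In (s : list R4) (v : R4) : ~ In v s -> locally v (fun w => ~ In w s).
Proof.
  intro Hv. generalize (locally_punctured_not_In s v). apply filter_imp. intros w Hw.
  destruct (classic (w = v)) as [->|Hne]; [exact Hv|exact (Hw Hne)].
Qed.

Lemma tame_0_small (s : list R4) (f : R4 -> R) (e : R) :
  tame 0 s f -> 0 < e -> exists r, forall v, r <= norm v -> Rabs (f v) <= e.
Proof.
  intros [_ _ [c [r [Hc [Hr Hg]]]]] He. exists (r + c / e). intros v Hv.
  assert (0 <= c / e) by (apply Rmult_le_pos; [exact Hc|left; apply Rinv_0_lt_compat, He]).
  specialize (Hg v ltac:(lra)). simpl in Hg. apply Rmult_le_reg_r with (norm v); [lra|].
  assert (c <= e * norm v); [|lra]. apply Rle_trans with (e * (c / e)); [right; field; lra|].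
  apply Rmult_le_compat_l; lra.
Qed.

Lemma tame_0_le_poles (s : list R4) (f : R4 -> R) (e : R) (u : R4) :
  tame 0 s f -> 0 < e -> ~ In u s -> f u <= e * (1 + sum_poles s u).
Proof.
  intros T He Hu. destruct (tame_0_small s f e T He) as [r Hr]. destruct T as [Hharm Hb _].
  set (g := fun v => f v - e * (1 + sum_poles s v)).
  assert (Hg : forall v, ~ In v s -> harmonic_at g v).
  { intros v Hv. apply harmonic_at_minus; [apply Hharm, Hv|].
    apply harmonic_at_scal, harmonic_at_plus; [apply harmonic_at_const|].
    apply harmonic_at_sum_poles, Hv. }
  set (R := Rmax r (norm u) + 1).
  assert (g u <= 0); [|unfold g in *; lra].
  apply (maximum_principle g (fun v => norm v < R /\ ~ In v s) R); [intros v [Hv _]; lra| |].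
  2: { split; [|exact Hu]. unfold R. pose proof (Rmax_r r (norm u)). lra. }
  intro v. destruct (classic (In v s)) as [Hin|Hout].
  - left. intros e' He'. destruct (Hb v) as [b Hloc].
    generalize (filter_and _ _ (locally_pole_ge v (b / e)) Hloc). apply filter_imp.
    intros w [Hpole Hw] [_ Hws]. apply Rabs_le_between in Hw. unfold g.
    assert (Hne : w <> v) by (intros ->; exact (Hws Hin)).
    pose proof (Rle_trans _ _ _ (Hpole Hne) (pole_le_sum_poles s v w Hin)) as Hle.
    apply (Rmult_le_compat_l e) in Hle; [|lra].
    replace (e * (b / e)) with b in Hle by (field; lra). lra.
  - destruct (Rlt_or_le (norm v) R) as [Hv|Hv].
    + right. split; [|apply Hg, Hout]. apply filter_and; [|apply locally_not_In, Hout].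
      apply locally_lt; [apply continuous_norm|exact Hv].
    + left. intros e' He'.
      assert (Hgv : g v < e').
      { assert (Hfar : r <= norm v) by (unfold R in Hv; pose proof (Rmax_l r (norm u)); lra).
        specialize (Hr v Hfar). apply Rabs_le_between in Hr.
        pose proof (sum_poles_nonneg s v). unfold g. nra. }
      generalize (locally_lt g v e' (proj2 (Hg v Hout)) Hgv). apply filter_imp. intros; lra.
Qed.

Lemma tame_0_nonpos (s : list R4) (f : R4 -> R) (u : R4) : tame 0 s f -> ~ In u s -> f u <= 0.
Proof.
  intros T Hu. apply Rnot_lt_le. intro Hpos.
  pose proof (sum_poles_nonneg s u) as Hs. set (e := f u / (2 * (1 + sum_poles s u))).
  assert (He : 0 < e) by (apply Rdiv_lt_0_compat; lra).
  pose proof (tame_0_le_poles s f e u T He Hu) as H.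
  replace (e * (1 + sum_poles s u)) with (f u / 2) in H by (unfold e; field; lra). lra.
Qed.

Lemma tame_0_zero (s : list R4) (f : R4 -> R) (u : R4) : tame 0 s f -> ~ In u s -> f u = 0.
Proof.
  intros T Hu. apply Rle_antisym; [exact (tame_0_nonpos s f u T Hu)|].
  pose proof (tame_0_nonpos s _ u (tame_opp _ _ _ T) Hu) as H. lra.
Qed.

Lemma zero_of_zero_off_list (s : list R4) (f : R4 -> R) (v : R4) :
  continuous f v -> (forall w, ~ In w s -> f w = 0) -> f v = 0.
Proof.
  intros Hc Hz. destruct (Req_dec (f v) 0) as [|Hne]; [assumption|exfalso].
  assert (Hnear : locally v (fun w => Rabs (f w - f v) < Rabs (f v))).
  { apply (Hc (fun y => Rabs (y - f v) < Rabs (f v))). apply locally_R_iff.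
    exists (Rabs (f v)). split; [apply Rabs_pos_lt, Hne|trivial]. }
  pose proof (locally_axis 0 v _ (filter_and _ _ Hnear (locally_punctured_not_In s v))) as H.
  apply locally_R_iff in H. destruct H as [d [Hd H]].
  destruct (H (d / 2)) as [Hclose Hout]; [rewrite Rminus_0_r, Rabs_pos_eq; lra|].
  rewrite Hz, Rminus_0_l, Rabs_Ropp in Hclose; [lra|]. apply Hout.
  intro E. apply (f_equal (coord 0)) in E. rewrite coord_plus, coord_scal in E. simpl in E. lra.
Qed.

(** * Functions with vanishing iterated differences *)

Lemma RInt_additive (g : R -> R) (t : R) :
  (forall s t, g (s + t) = g s + g t) -> (forall a b, ex_RInt g a b) ->
  RInt g t (t + 1) = RInt g 0 1 + g t.
Proof.
  intros Hadd Hint. pose proof (RInt_comp_lin g 1 t 0 1 (Hint _ _)) as E.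
  replace (1 * 0 + t) with t in E by ring. replace (1 * 1 + t) with (t + 1) in E by ring.
  rewrite <- E. apply is_RInt_unique. apply (is_RInt_ext (fun s => g s + g t)).
  - intros s _. change (g s + g t = 1 * g (1 * s + t)). rewrite !Rmult_1_l. symmetry. apply Hadd.
  - apply (is_RInt_plus (V := R_NormedModule) g (fun _ => g t)).
    + apply (RInt_correct (V := R_CompleteNormedModule)), Hint.
    + pose proof (is_RInt_const (V := R_NormedModule) 0 1 (g t)) as Econst.
      change (is_RInt (fun _ => g t) 0 1 ((1 - 0) * g t)) in Econst.
      rewrite Rminus_0_r, Rmult_1_l in Econst. exact Econst.
Qed.

(* Integrating [g (s + t) = g s + g t] over [0 <= s <= 1] expresses [g] by its primitive. *)
Lemma additive_continuous_is_derive (g : R -> R) (t : R) :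
  (forall s t, g (s + t) = g s + g t) -> (forall t, continuous g t) -> is_derive g t (g 1).
Proof.
  intros Hadd Hc.
  assert (Hint : forall a b, ex_RInt g a b).
  { intros a b. apply (ex_RInt_continuous (V := R_CompleteNormedModule)). intros; apply Hc. }
  assert (HG : forall t, is_derive (RInt g 0) t (g t)).
  { intro s. apply (is_derive_RInt g (RInt g 0) 0); [|apply Hc].
    apply filter_forall. intro b. apply (RInt_correct (V := R_CompleteNormedModule)), Hint. }
  apply (is_derive_ext (fun t => RInt g 0 (t + 1) - RInt g 0 t - RInt g 0 1)).
  - intro s. pose proof (RInt_Chasles g 0 s (s + 1) (Hint _ _) (Hint _ _)) as E.
    change (RInt g 0 s + RInt g s (s + 1) = RInt g 0 (s + 1)) in E.
    rewrite (RInt_additive g s Hadd Hint) in E. lra.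
  - replace (g 1) with (1 * g (t + 1) - g t - 0) by (rewrite Hadd; ring).
    apply (is_derive_minus (fun t => RInt g 0 (t + 1) - RInt g 0 t) (fun _ => RInt g 0 1));
      [|apply (is_derive_const (RInt g 0 1))].
    apply (is_derive_minus (fun t => RInt g 0 (t + 1)) (RInt g 0)); [|apply HG].
    apply (is_derive_comp (RInt g 0) (fun t => t + 1)); [apply HG|auto_derive; [exact I|ring]].
Qed.

Lemma additive_continuous_linear (g : R -> R) (t : R) :
  (forall s t, g (s + t) = g s + g t) -> (forall t, continuous g t) -> g t = t * g 1.
Proof.
  intros Hadd Hc.
  assert (Hconst : forall a b, a < b -> g a - a * g 1 = g b - b * g 1).
  { intros a b Hab. apply (eq_is_derive (fun t => g t - t * g 1)); [|exact Hab].
    intros s _. change (is_derive (fun t => g t - t * g 1) s 0).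
    replace 0 with (g 1 - g 1) by ring. apply (is_derive_minus g (fun t => t * g 1)).
    - apply additive_continuous_is_derive; assumption.
    - auto_derive; [exact I|ring]. }
  pose proof (Hadd 0 0) as H0. rewrite Rplus_0_r in H0.
  destruct (Rtotal_order t 0) as [Ht|[->|Ht]]; [|lra|]; pose proof (Hconst _ _ Ht); lra.
Qed.

Fixpoint differences_vanish (n : nat) (f : R4 -> R) : Prop :=
  match n with
  | 0%nat => forall v, f v = 0
  | S m => forall i t, differences_vanish m (diff (translate (t ⊙ basis i)) f)
  end.

Lemma continuous_diff_translate (h : R4) (f : R4 -> R) :
  (forall v, continuous f v) -> forall v, continuous (diff (translate h) f) v.
Proof. intros Hf v. apply continuous_Rminus; [apply continuous_translate|]; apply Hf. Qed.

Lemma tame_differences_vanish (n : nat) : forall s f,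
  (forall v, continuous f v) -> tame n s f -> differences_vanish n f.
Proof.
  induction n as [|n IH]; intros s f Hf T.
  - intro v. apply (zero_of_zero_off_list s); [apply Hf|]. intros w. exact (tame_0_zero s f w T).
  - intros i t. eapply IH; [apply continuous_diff_translate, Hf|apply tame_diff, T].
Qed.

Lemma differences_vanish_plus (n : nat) : forall f g,
  differences_vanish n f -> differences_vanish n g -> differences_vanish n (fun v => f v + g v).
Proof.
  induction n as [|n IH]; intros f g Hf Hg.
  - intro v. rewrite (Hf v), (Hg v). ring.
  - intros i t. replace (diff (translate (t ⊙ basis i)) (fun v => f v + g v)) with
      (fun v => diff (translate (t ⊙ basis i)) f v + diff (translate (t ⊙ basis i)) g v)
      by (apply functional_extensionality; intro; unfold diff; ring).
    apply IH; [apply Hf|apply Hg].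
Qed.

Lemma differences_vanish_translate (n : nat) (u : R4) : forall f,
  differences_vanish n f -> differences_vanish n (fun v => f (v ⊕ u)).
Proof.
  induction n as [|n IH]; intros f Hf; [intro; apply Hf|].
  intros i t. replace (diff (translate (t ⊙ basis i)) (fun v => f (v ⊕ u)))
    with (fun v => diff (translate (t ⊙ basis i)) f (v ⊕ u)); [apply IH, Hf|].
  apply functional_extensionality. intro v. unfold diff, translate.
  replace (v ⊕ u ⊕ t ⊙ basis i) with (v ⊕ t ⊙ basis i ⊕ u) by (coords; ring). reflexivity.
Qed.

Lemma diff_translate_plus (g h : R4) (f : R4 -> R) (v : R4) :
  diff (translate (g ⊕ h)) f v = diff (translate g) f (v ⊕ h) + diff (translate h) f v.
Proof.
  unfold diff, translate. replace (v ⊕ (g ⊕ h)) with (v ⊕ h ⊕ g) by (coords; ring). ring.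
Qed.

Lemma R4_basis_expansion (v : R4) :
  v = coord 0 v ⊙ basis 0 ⊕ coord 1 v ⊙ basis 1 ⊕ coord 2 v ⊙ basis 2 ⊕ coord 3 v ⊙ basis 3.
Proof. symmetry. coords. destruct v as [[[? ?] ?] ?]; index_cases i; simpl; ring. Qed.

Lemma differences_vanish_diff (n : nat) (f : R4 -> R) (h : R4) :
  differences_vanish (S n) f -> differences_vanish n (diff (translate h) f).
Proof.
  intro Hf.
  assert (Hplus : forall g h, differences_vanish n (diff (translate g) f) ->
    differences_vanish n (diff (translate h) f) ->
    differences_vanish n (diff (translate (g ⊕ h)) f)).
  { clear h. intros g h Hg Hh.
    replace (diff (translate (g ⊕ h)) f)
      with (fun v => diff (translate g) f (v ⊕ h) + diff (translate h) f v)
      by (apply functional_extensionality; intro; symmetry; apply diff_translate_plus).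
    apply differences_vanish_plus; [|exact Hh].
    exact (differences_vanish_translate n h (diff (translate g) f) Hg). }
  rewrite (R4_basis_expansion h).
  apply Hplus; [apply Hplus; [apply Hplus|]|]; apply Hf.
Qed.

Lemma differences_vanish_iter (m : nat) : forall n x f,
  differences_vanish (m + n) f -> differences_vanish n (Nat.iter m (diff (translate x)) f).
Proof.
  induction m as [|m IH]; intros n x f Hf; [exact Hf|].
  apply differences_vanish_diff, IH. rewrite Nat.add_succ_r. exact Hf.
Qed.

Lemma continuous_iter_diff (m : nat) (x : R4) (f : R4 -> R) :
  (forall v, continuous f v) -> forall v, continuous (Nat.iter m (diff (translate x)) f) v.
Proof. intro Hf. induction m as [|m IH]; [exact Hf|apply continuous_diff_translate, IH]. Qed.

Lemma diff_iter_diff_comm (m : nat) (h x : R4) (f : R4 -> R) :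
  diff (translate h) (Nat.iter m (diff (translate x)) f)
  = Nat.iter m (diff (translate x)) (diff (translate h) f).
Proof.
  induction m as [|m IH]; [reflexivity|]. rewrite !Nat.iter_succ, <- IH.
  apply functional_extensionality. intro v. unfold diff, translate.
  replace (v ⊕ h ⊕ x) with (v ⊕ x ⊕ h) by (coords; ring). ring.
Qed.

Lemma differences_vanish_2_affine (f : R4 -> R) (v : R4) :
  (forall w, continuous f w) -> differences_vanish 2 f ->
  diff (translate v) f origin = sum4 (fun i => coord i v * diff (translate (basis i)) f origin).
Proof.
  intros Hc Hf. set (slope := fun h => diff (translate h) f origin).
  assert (Hslope : forall h w, diff (translate h) f w = slope h).
  { intros h w.
    pose proof (differences_vanish_diff 0 _ w (differences_vanish_diff 1 f h Hf) origin) as E.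
    change (diff (translate h) f (origin ⊕ w) - slope h = 0) in E.
    replace (origin ⊕ w) with w in E by (coords; ring). lra. }
  assert (Hplus : forall g h, slope (g ⊕ h) = slope g + slope h).
  { intros g h. unfold slope at 1. rewrite diff_translate_plus, !Hslope. reflexivity. }
  assert (Haxis : forall i t, slope (t ⊙ basis i) = t * slope (basis i)).
  { intros i t.
    rewrite (additive_continuous_linear (fun t => slope (t ⊙ basis i))).
    - f_equal. f_equal. coords. ring.
    - intros s s'. rewrite <- Hplus. f_equal. coords. ring.
    - intro s. apply continuous_Rminus; [|apply continuous_const].
      apply (continuous_comp (fun t => origin ⊕ t ⊙ basis i) f); [|apply Hc].
      apply continuous_vplus; [apply continuous_const|].
      apply continuous_vscal; [apply continuous_id|apply continuous_const]. }
  change (slope v = sum4 (fun i => coord i v * slope (basis i))).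
  rewrite (R4_basis_expansion v) at 1. rewrite !Hplus, !Haxis. reflexivity.
Qed.

Definition unit_shift (s : R) : R := s + 1.

Lemma iter_diff_unit_shift_succ (n : nat) (g : R -> R) (s : R) :
  Nat.iter (S n) (diff unit_shift) g s
  = Nat.iter n (diff unit_shift) g (s + 1) - Nat.iter n (diff unit_shift) g s.
Proof. reflexivity. Qed.

Lemma iter_diff_mult_id (n : nat) (g : R -> R) (s : R) :
  Nat.iter (S n) (diff unit_shift) (fun s => s * g s) s
  = s * Nat.iter (S n) (diff unit_shift) g s + INR (S n) * Nat.iter n (diff unit_shift) g (s + 1).
Proof.
  revert s. induction n as [|n IH]; intro s.
  - simpl. unfold diff, unit_shift. ring.
  - rewrite iter_diff_unit_shift_succ, !IH, (S_INR (S n)).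
    rewrite (iter_diff_unit_shift_succ (S n)), (iter_diff_unit_shift_succ n g (s + 1)). ring.
Qed.

Lemma iter_diff_pow (k : nat) (s : R) :
  Nat.iter k (diff unit_shift) (fun s => s ^ k) s = INR (fact k).
Proof.
  revert s. induction k as [|k IH]; intro s; [reflexivity|].
  change (fun s : R => s ^ S k) with (fun s : R => s * s ^ k).
  rewrite iter_diff_mult_id, iter_diff_unit_shift_succ, !IH, fact_simpl, mult_INR. ring.
Qed.

Lemma iter_diff_homogeneous (k : nat) (f : R4 -> R) (x : R4) :
  (forall s v, 0 <= s -> f (s ⊙ v) = s ^ k * f v) ->
  Nat.iter k (diff (translate x)) f origin = INR (fact k) * f x.
Proof.
  intro Hf.
  assert (Hray : forall n s, 0 <= s -> Nat.iter n (diff (translate x)) f (s ⊙ x)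
    = Nat.iter n (diff unit_shift) (fun s => s ^ k) s * f x).
  { induction n as [|n IH]; intros s Hs; [apply Hf, Hs|].
    rewrite iter_diff_unit_shift_succ.
    change (Nat.iter n (diff (translate x)) f (s ⊙ x ⊕ x) - Nat.iter n (diff (translate x)) f (s ⊙ x)
      = (Nat.iter n (diff unit_shift) (fun s => s ^ k) (s + 1)
         - Nat.iter n (diff unit_shift) (fun s => s ^ k) s) * f x).
    replace (s ⊙ x ⊕ x) with ((s + 1) ⊙ x) by (coords; ring). rewrite !IH by lra. ring. }
  rewrite <- (iter_diff_pow k 0), <- Hray by lra. f_equal. coords. ring.
Qed.

(** * Functions of four real variables *)

Definition uncurry4 {T : Type} (F : R -> R -> R -> R -> T) (v : R4) : T :=
  F (coord 0 v) (coord 1 v) (coord 2 v) (coord 3 v).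

Definition curry4 {T : Type} (F : R4 -> T) (x y z w : R) : T := F (x, y, z, w).

Lemma uncurry4_curry4 {T : Type} (F : R4 -> T) : uncurry4 (curry4 F) = F.
Proof. apply functional_extensionality. intros [[[x y] z] w]. reflexivity. Qed.

Lemma curry4_uncurry4 {T : Type} (F : R -> R -> R -> R -> T) : curry4 (uncurry4 F) = F.
Proof. reflexivity. Qed.

Lemma fn4_ext {T : Type} (F G : R -> R -> R -> R -> T) :
  (forall v, uncurry4 F v = uncurry4 G v) -> F = G.
Proof.
  intro E. rewrite <- (curry4_uncurry4 F), <- (curry4_uncurry4 G).
  unfold curry4. repeat (apply functional_extensionality; intro). apply E.
Qed.

Lemma is_derive_shift_iff (f : R -> R) (x l : R) :
  is_derive (fun t => f (x + t)) 0 l <-> ex_derive f x /\ Derive f x = l.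
Proof.
  split.
  - intro D.
    assert (Df : is_derive f x l).
    { apply (is_derive_ext (fun t => f (x + (t - x)))); [intro t; f_equal; ring|].
      replace l with (1 * l) by ring. apply (is_derive_comp (fun t => f (x + t)) (fun t => t - x)).
      - rewrite Rminus_diag. exact D.
      - auto_derive; [exact I|ring]. }
    split; [exists l; exact Df|apply is_derive_unique, Df].
  - intros [Df <-]. replace (Derive f x) with (1 * Derive f x) by ring.
    apply (is_derive_comp f (fun t => x + t)).
    + rewrite Rplus_0_r. apply Derive_correct, Df.
    + auto_derive; [exact I|ring].
Qed.

Lemma is_derive_line_iff (g : fn4R) (v : R4) (i : nat) (l : R) :
  is_derive (line (uncurry4 g) v i) 0 l <-> uncurry4 (exd i g) v /\ uncurry4 (pd i g) v = l.
Proof.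
  assert (Hslice : forall s : R -> R, (forall t, line (uncurry4 g) v i t = s (coord i v + t)) ->
    is_derive (line (uncurry4 g) v i) 0 l <-> ex_derive s (coord i v) /\ Derive s (coord i v) = l).
  { intros s Hs. rewrite <- is_derive_shift_iff.
    split; apply is_derive_ext; intro t; rewrite Hs; reflexivity. }
  index_cases i; [apply (Hslice (fun t => g t (coord 1 v) (coord 2 v) (coord 3 v)))
    |apply (Hslice (fun t => g (coord 0 v) t (coord 2 v) (coord 3 v)))
    |apply (Hslice (fun t => g (coord 0 v) (coord 1 v) t (coord 3 v)))
    |apply (Hslice (fun t => g (coord 0 v) (coord 1 v) (coord 2 v) t))];
    intro t; unfold line, uncurry4; rewrite !coord_plus, !coord_scal; simpl (coord _ (basis _));
    rewrite ?Rmult_0_r, ?Rmult_1_r, ?Rplus_0_r; reflexivity.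
Qed.

Open Scope C_scope.

(** * Homogeneous polynomials *)

Definition Csum (f : nat -> C) (n : nat) : C := sum_n f n.

Lemma Csum_0 (f : nat -> C) : Csum f 0 = f 0%nat.
Proof. exact (sum_O f). Qed.

Lemma Csum_S (f : nat -> C) (n : nat) : Csum f (S n) = Csum f n + f (S n).
Proof. exact (sum_Sn f n). Qed.

Lemma Csum_head (f : nat -> C) (n : nat) : Csum f (S n) = f 0%nat + Csum (fun k => f (S k)) n.
Proof.
  induction n as [|n IH].
  - rewrite Csum_S, !Csum_0. reflexivity.
  - rewrite Csum_S, IH, (Csum_S (fun k => f (S k))). ring.
Qed.

Lemma Csum_ext (f g : nat -> C) (n : nat) :
  (forall k, (k <= n)%nat -> f k = g k) -> Csum f n = Csum g n.
Proof. exact (sum_n_ext_loc f g n). Qed.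

Lemma Csum_plus (f g : nat -> C) (n : nat) : Csum (fun k => f k + g k) n = Csum f n + Csum g n.
Proof. exact (sum_n_plus f g n). Qed.

Lemma Csum_mult_l (c : C) (f : nat -> C) (n : nat) : Csum (fun k => c * f k) n = c * Csum f n.
Proof. exact (sum_n_mult_l (K := C_Ring) c f n). Qed.

Lemma Csum_single (f : nat -> C) (n k : nat) :
  (k <= n)%nat -> (forall i, (i <= n)%nat -> i <> k -> f i = 0) -> Csum f n = f k.
Proof.
  intros Hk Hf. induction n as [|n IH].
  - rewrite Csum_0. f_equal. lia.
  - rewrite Csum_S. destruct (Nat.eq_dec k (S n)) as [->|Hne].
    + rewrite (Csum_ext f (fun i => 0 * f i) n), Csum_mult_l; [ring|].
      intros i Hi. rewrite (Hf i) by lia. ring.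
    + rewrite IH, (Hf (S n)) by (intros; try apply Hf; lia). ring.
Qed.

(* [h e] is the coefficient of the monomial with exponents [e]. *)
Definition coef := list nat -> C.

(* The value at [z] of the part of degree [m] of the polynomial with coefficients [h]. *)
Fixpoint heval (m : nat) (h : coef) (z : list C) : C :=
  match z with
  | [] => match m with 0%nat => h [] | S _ => 0 end
  | u :: z' => Csum (fun a => u ^ a * heval (m - a) (fun e => h (a :: e)) z') m
  end.

Lemma heval_ext (z : list C) : forall (m : nat) (h h' : coef),
  (forall e, length e = length z -> list_sum e = m -> h e = h' e) -> heval m h z = heval m h' z.
Proof.
  induction z as [|u z IH]; intros m h h' E; simpl.
  - destruct m; [apply E; reflexivity|reflexivity].
  - apply Csum_ext. intros a Ha. f_equal. apply IH. intros e Hlen Hsum.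
    apply E; simpl; lia.
Qed.

Lemma heval_plus (z : list C) : forall (m : nat) (h h' : coef),
  heval m (fun e => h e + h' e) z = heval m h z + heval m h' z.
Proof.
  induction z as [|u z IH]; intros m h h'; simpl.
  - destruct m; [reflexivity|ring].
  - rewrite <- Csum_plus. apply Csum_ext. intros a _. rewrite IH. ring.
Qed.

Lemma heval_scal (c : C) (z : list C) : forall (m : nat) (h : coef),
  heval m (fun e => c * h e) z = c * heval m h z.
Proof.
  induction z as [|u z IH]; intros m h; simpl.
  - destruct m; [reflexivity|ring].
  - rewrite <- Csum_mult_l. apply Csum_ext. intros a _. rewrite IH. ring.
Qed.

Lemma heval_zero (m : nat) (z : list C) : heval m (fun _ => 0) z = 0.
Proof.
  transitivity (0 * heval m (fun _ => 0) z); [|ring].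
  rewrite <- heval_scal. apply heval_ext. intros; ring.
Qed.

Lemma heval_0 (z : list C) : forall h : coef, heval 0 h z = h (repeat 0%nat (length z)).
Proof.
  induction z as [|u z IH]; intro h; simpl; [reflexivity|]. rewrite Csum_0, IH. simpl. ring.
Qed.

Lemma heval_homogeneous (c : C) (z : list C) : forall (m : nat) (h : coef),
  heval m h (map (Cmult c) z) = c ^ m * heval m h z.
Proof.
  induction z as [|u z IH]; intros m h; simpl.
  - destruct m; simpl; ring.
  - rewrite <- Csum_mult_l. apply Csum_ext. intros a Ha.
    rewrite IH, Cpow_mult_l. replace m with (a + (m - a))%nat at 3 by lia.
    rewrite Cpow_add_r. ring.
Qed.

Fixpoint mono (u : list C) (e : list nat) : C :=
  match u, e with
  | x :: u', a :: e' => x ^ a * mono u' e'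
  | _, _ => 1
  end.

Lemma heval_single (z : list C) : forall (e0 : list nat) (h : coef),
  length e0 = length z ->
  (forall e, length e = length z -> list_sum e = list_sum e0 -> e <> e0 -> h e = 0) ->
  heval (list_sum e0) h z = h e0 * mono z e0.
Proof.
  induction z as [|u z IH]; intros [|a0 e0] h Hlen Hh; try discriminate Hlen;
    cbn [heval mono list_sum fold_right].
  - ring.
  - change (fold_right Nat.add 0%nat e0) with (list_sum e0). injection Hlen as Hlen.
    rewrite (Csum_single _ (a0 + list_sum e0) a0).
    + rewrite Nat.add_comm, Nat.add_sub, IH; [ring|exact Hlen|].
      intros e He Hsum Hne. apply Hh; simpl; [congruence|lia|congruence].
    + lia.
    + intros a Hle Ha. rewrite (heval_ext z _ _ (fun _ => 0)), heval_zero; [ring|].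
      intros e He Hsum. apply Hh; simpl; [congruence|lia|congruence].
Qed.

Lemma heval_rescale (u z : list C) : forall (m : nat) (h : coef), length u = length z ->
  heval m h (map (fun xy => fst xy * snd xy) (combine u z)) = heval m (fun e => mono u e * h e) z.
Proof.
  revert z. induction u as [|x u IH]; intros [|y z] m h Hlen; try discriminate Hlen; simpl.
  - destruct m; ring.
  - injection Hlen as Hlen. apply Csum_ext. intros a _.
    rewrite IH, Cpow_mult_l by exact Hlen.
    rewrite (heval_ext z _ (fun e => x ^ a * mono u e * h (a :: e))
      (fun e => x ^ a * (mono u e * h (a :: e)))) by (intros; ring).
    rewrite heval_scal. ring.
Qed.

(* Coefficients of the derivative in the direction [d]. *)
Fixpoint dirderiv (d : list C) (h : coef) (e : list nat) : C :=
  match d, e with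
  | x :: d', a :: e' =>
      x * RtoC (INR (S a)) * h (S a :: e') + dirderiv d' (fun e'' => h (a :: e'')) e'
  | _, _ => 0
  end.

(* Coefficients of the product with the linear form of coefficients [c]. *)
Fixpoint mulform (c : list C) (h : coef) (e : list nat) : C :=
  match c, e with
  | x :: c', a :: e' =>
      match a with 0%nat => 0 | S b => x * h (b :: e') end
      + mulform c' (fun e'' => h (a :: e'')) e'
  | _, _ => 0
  end.

Fixpoint linform (c z : list C) : C :=
  match c, z with
  | x :: c', u :: z' => x * u + linform c' z'
  | _, _ => 0
  end.

Lemma mulform_0 (c : list C) : forall (h : coef) (n : nat), mulform c h (repeat 0%nat n) = 0.
Proof.
  induction c as [|x c IH]; intros h [|n]; simpl; try reflexivity. rewrite IH. ring.
Qed.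

Lemma heval_mulform (c : list C) : forall (z : list C) (m : nat) (h : coef),
  heval (S m) (mulform c h) z = linform c z * heval m h z.
Proof.
  induction c as [|x c IH]; intros z m h.
  { change (mulform [] h) with (fun _ : list nat => RtoC 0). rewrite heval_zero. simpl. ring. }
  destruct z as [|u z]; [simpl; ring|]. cbn [heval mulform linform].
  rewrite (Csum_ext _ (fun a =>
    u ^ a * heval (S m - a) (fun e => match a with 0%nat => RtoC 0 | S b => x * h (b :: e) end) z
    + u ^ a * heval (S m - a) (mulform c (fun e => h (a :: e))) z))
    by (intros a _; rewrite heval_plus; ring).
  rewrite Csum_plus, Csum_head, (Csum_S (fun a => u ^ a * heval (S m - a) (mulform c _) z)).
  rewrite heval_zero, Nat.sub_diag, (heval_0 z (mulform _ _)), mulform_0.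
  set (F := fun a => u ^ a * heval (m - a) (fun e => h (a :: e)) z).
  assert (Ehead : Csum (fun a => u ^ S a * heval (S m - S a) (fun e => x * h (a :: e)) z) m
    = x * u * Csum F m).
  { rewrite <- Csum_mult_l. apply Csum_ext. intros a _. unfold F.
    rewrite Nat.sub_succ, heval_scal, Cpow_S. ring. }
  assert (Etail : Csum (fun a => u ^ a * heval (S m - a) (mulform c (fun e => h (a :: e))) z) m
    = linform c z * Csum F m).
  { rewrite <- Csum_mult_l. apply Csum_ext. intros a Ha. unfold F.
    rewrite Nat.sub_succ_l, IH by exact Ha. ring. }
  rewrite Ehead, Etail. ring.
Qed.

Definition is_derive_C (f : R -> C) (t : R) (l : C) : Prop :=
  is_derive (fun s => Re (f s)) t (Re l) /\ is_derive (fun s => Im (f s)) t (Im l).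

Lemma is_derive_C_const (c : C) (t : R) : is_derive_C (fun _ => c) t 0.
Proof. split; [apply (is_derive_const (Re c))|apply (is_derive_const (Im c))]. Qed.

Lemma is_derive_C_plus (f g : R -> C) (t : R) (a b : C) :
  is_derive_C f t a -> is_derive_C g t b -> is_derive_C (fun s => f s + g s) t (a + b).
Proof.
  intros [F1 F2] [G1 G2]. split.
  - apply (is_derive_plus (fun s => Re (f s)) (fun s => Re (g s))); assumption.
  - apply (is_derive_plus (fun s => Im (f s)) (fun s => Im (g s))); assumption.
Qed.

Lemma is_derive_C_mult (f g : R -> C) (t : R) (a b : C) :
  is_derive_C f t a -> is_derive_C g t b ->
  is_derive_C (fun s => f s * g s) t (a * g t + f t * b).
Proof.
  intros [F1 F2] [G1 G2]. split.
  - replace (Re (a * g t + f t * b)) with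
      ((Re a * Re (g t) + Re (f t) * Re b) - (Im a * Im (g t) + Im (f t) * Im b))%R
      by (unfold Re, Im; simpl; ring).
    apply (is_derive_minus (fun s => Re (f s) * Re (g s))%R (fun s => Im (f s) * Im (g s))%R);
      apply is_derive_Rmult; assumption.
  - replace (Im (a * g t + f t * b)) with
      ((Re a * Im (g t) + Re (f t) * Im b) + (Im a * Re (g t) + Im (f t) * Re b))%R
      by (unfold Re, Im; simpl; ring).
    apply (is_derive_plus (fun s => Re (f s) * Im (g s))%R (fun s => Im (f s) * Re (g s))%R);
      apply is_derive_Rmult; assumption.
Qed.

Lemma is_derive_C_pow (f : R -> C) (t : R) (a : C) (n : nat) :
  is_derive_C f t a -> is_derive_C (fun s => f s ^ S n) t (RtoC (INR (S n)) * f t ^ n * a).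
Proof.
  intro Hf. induction n as [|n IH].
  - replace (RtoC (INR 1) * f t ^ 0 * a) with (a * f t ^ 0 + f t * 0) by (simpl; ring).
    apply (is_derive_C_mult f (fun _ => 1)); [exact Hf|apply is_derive_C_const].
  - replace (RtoC (INR (S (S n))) * f t ^ S n * a)
      with (a * f t ^ S n + f t * (RtoC (INR (S n)) * f t ^ n * a))
      by (rewrite (S_INR (S n)), RtoC_plus, Cpow_S; ring).
    exact (is_derive_C_mult f (fun s => f s ^ S n) t _ _ Hf IH).
Qed.

Lemma is_derive_C_sum (f : nat -> R -> C) (t : R) (l : nat -> C) (n : nat) :
  (forall k, (k <= n)%nat -> is_derive_C (f k) t (l k)) ->
  is_derive_C (fun s => Csum (fun k => f k s) n) t (Csum l n).
Proof.
  induction n as [|n IH]; intro Hf.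
  - rewrite Csum_0. replace (fun s => Csum (fun k => f k s) 0) with (f 0%nat); [apply Hf; lia|].
    apply functional_extensionality. intro s. rewrite Csum_0. reflexivity.
  - rewrite Csum_S. replace (fun s => Csum (fun k => f k s) (S n))
      with (fun s => Csum (fun k => f k s) n + f (S n) s).
    + apply is_derive_C_plus; [apply IH; intros; apply Hf; lia|apply Hf; lia].
    + apply functional_extensionality. intro s. rewrite Csum_S. reflexivity.
Qed.

Lemma is_derive_C_heval_0 (zs : list (R -> C)) (h : coef) (t : R) :
  is_derive_C (fun s => heval 0 h (map (fun z => z s) zs)) t 0.
Proof.
  replace (fun s => heval 0 h (map (fun z => z s) zs))
    with (fun _ : R => h (repeat 0%nat (length zs))); [apply is_derive_C_const|].
  apply functional_extensionality. intro s. rewrite heval_0, length_map. reflexivity.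
Qed.

(* The first family of terms comes from differentiating [u ^ a], the second from the inner
   polynomials; the latter has no term of index [S m], that inner polynomial being constant. *)
Lemma heval_dirderiv_cons (x u : C) (d z : list C) (m : nat) (h : coef) :
  heval m (dirderiv (x :: d) h) (u :: z) =
  Csum (fun a => match a with 0%nat => RtoC 0 | S b => RtoC (INR (S b)) * u ^ b * x end
                 * heval (S m - a) (fun e => h (a :: e)) z
               + u ^ a * match (S m - a)%nat with
                   | 0%nat => RtoC 0
                   | S n => heval n (dirderiv d (fun e => h (a :: e))) z
                 end) (S m).
Proof.
  rewrite Csum_plus, Csum_head, (Csum_S (fun a => u ^ a * _)), Nat.sub_diag, !Cmult_0_l, Cmult_0_r.
  rewrite Cplus_0_l, Cplus_0_r, <- Csum_plus. apply Csum_ext. intros a Ha.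
  rewrite Nat.sub_succ, (Nat.sub_succ_l a m) by exact Ha. cbn [dirderiv].
  rewrite heval_plus, heval_scal. ring.
Qed.

Lemma is_derive_C_heval (zs : list (R -> C)) (d : list C) (t : R) :
  Forall2 (fun z x => is_derive_C z t x) zs d -> forall (m : nat) (h : coef),
  is_derive_C (fun s => heval (S m) h (map (fun z => z s) zs)) t
    (heval m (dirderiv d h) (map (fun z => z t) zs)).
Proof.
  induction 1 as [|z x zs d Hz Hzs IH]; intros m h.
  - change (dirderiv [] h) with (fun _ : list nat => RtoC 0). rewrite heval_zero.
    apply (is_derive_C_const 0).
  - cbn [map]. rewrite heval_dirderiv_cons.
    apply (is_derive_C_sum (fun a s => z s ^ a * heval (S m - a) (fun e => h (a :: e))
      (map (fun z => z s) zs))). intros a _.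
    apply (is_derive_C_mult (fun s => z s ^ a) (fun s => heval _ _ (map (fun z => z s) zs))).
    + destruct a as [|a]; [apply (is_derive_C_const 1)|apply is_derive_C_pow, Hz].
    + destruct (S m - a)%nat as [|n]; [apply is_derive_C_heval_0|apply IH].
Qed.

(** * Polynomials in alpha, beta and their conjugates *)

Definition alpha (v : R4) : C := (coord 0 v, coord 1 v).
Definition beta (v : R4) : C := (coord 2 v, coord 3 v).

Definition zcoords (v : R4) : list C := [alpha v; beta v; Cconj (alpha v); Cconj (beta v)].

Definition poly (m : nat) (h : coef) (v : R4) : C := heval m h (zcoords v).

Lemma poly_ext (m : nat) (h h' : coef) (v : R4) :
  (forall A B C D, (A + B + C + D = m)%nat -> h [A; B; C; D] = h' [A; B; C; D]) ->
  poly m h v = poly m h' v.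
Proof.
  intro E. apply heval_ext. intros [|A [|B [|C [|D [|]]]]] Hlen Hsum; try discriminate Hlen.
  apply E. simpl in Hsum. lia.
Qed.

Lemma zcoords_basis (i : nat) : zcoords (basis i) =
  match i with
  | 0%nat => map RtoC [1; 0; 1; 0]%R
  | 1%nat => [Ci; RtoC 0; - Ci; RtoC 0]
  | 2%nat => map RtoC [0; 1; 0; 1]%R
  | _ => [RtoC 0; Ci; RtoC 0; - Ci]
  end.
Proof.
  index_cases i; unfold zcoords, alpha, beta, Cconj, Ci, Copp, RtoC; simpl; rewrite ?Ropp_0;
    reflexivity.
Qed.

Lemma is_derive_C_affine (c d : C) (t : R) : is_derive_C (fun s => c + RtoC s * d) t d.
Proof. split; simpl; auto_derive; trivial; unfold Re, Im; ring. Qed.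

Lemma is_derive_C_line_poly (m : nat) (h : coef) (v : R4) (i : nat) :
  is_derive_C (fun t => poly (S m) h (v ⊕ t ⊙ basis i)) 0
    (poly m (dirderiv (zcoords (basis i)) h) v).
Proof.
  set (w := basis i).
  set (zs := [fun t => alpha v + RtoC t * alpha w; fun t => beta v + RtoC t * beta w;
    fun t => Cconj (alpha v) + RtoC t * Cconj (alpha w);
    fun t => Cconj (beta v) + RtoC t * Cconj (beta w)]).
  assert (Ezs : forall t, zcoords (v ⊕ t ⊙ w) = map (fun z => z t) zs).
  { intro t. unfold zcoords, alpha, beta, zs. rewrite !coord_plus, !coord_scal. simpl.
    repeat f_equal; apply injective_projections; simpl; ring. }
  unfold poly. replace (zcoords v) with (map (fun z => z 0%R) zs).
  - replace (fun t => heval (S m) h (zcoords (v ⊕ t ⊙ w)))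
      with (fun t => heval (S m) h (map (fun z => z t) zs))
      by (apply functional_extensionality; intro; rewrite Ezs; reflexivity).
    apply is_derive_C_heval.
    repeat (apply Forall2_cons; [apply is_derive_C_affine|]). apply Forall2_nil.
  - rewrite <- Ezs. f_equal. coords. ring.
Qed.

Lemma is_derive_C_line_poly_0 (h : coef) (v : R4) (i : nat) :
  is_derive_C (fun t => poly 0 h (v ⊕ t ⊙ basis i)) 0 0.
Proof.
  replace (fun t => poly 0 h (v ⊕ t ⊙ basis i)) with (fun _ : R => h [0; 0; 0; 0]%nat);
    [apply is_derive_C_const|].
  apply functional_extensionality. intro t. symmetry. apply (heval_0 (zcoords _)).
Qed.

Lemma is_derive_C_unique (f : R -> C) (t : R) (a b : C) :
  is_derive_C f t a -> is_derive_C f t b -> a = b.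
Proof.
  intros [A1 A2] [B1 B2]. apply is_derive_unique in A1, A2, B1, B2.
  apply injective_projections; unfold Re, Im in *; congruence.
Qed.

Lemma Ci_sqr : Ci * Ci = -(1).
Proof. unfold Ci. apply injective_projections; simpl; ring. Qed.

(* The [i]-th unit vector among the coordinates alpha, beta, conj(alpha), conj(beta). *)
Definition unit_form (i : nat) : list C :=
  match i with
  | 0%nat => map RtoC [1; 0; 0; 0]%R
  | 1%nat => map RtoC [0; 1; 0; 0]%R
  | 2%nat => map RtoC [0; 0; 1; 0]%R
  | _ => map RtoC [0; 0; 0; 1]%R
  end.

Definition wirtinger (i : nat) (h : coef) : coef := dirderiv (unit_form i) h.

Lemma wirtinger_entry (j : nat) (h : coef) (A B C D : nat) : (j < 4)%nat ->
  wirtinger j h [A; B; C; D] = RtoC (INR (S (nth j [A; B; C; D] 0%nat))) * h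
    match j with
    | 0%nat => [S A; B; C; D] | 1%nat => [A; S B; C; D]
    | 2%nat => [A; B; S C; D] | _ => [A; B; C; S D]
    end.
Proof.
  intro Hj. unfold wirtinger.
  destruct j as [|[|[|[|j]]]]; [| | | |lia]; cbn [unit_form map dirderiv nth]; ring.
Qed.

Definition realderiv (i : nat) (h : coef) : coef := dirderiv (zcoords (basis i)) h.

Lemma RtoC_half : RtoC (1 / 2) = 1 / 2.
Proof. apply injective_projections; simpl; field. Qed.

Lemma wirtinger_realderiv (j : nat) (h : coef) (A B C D : nat) : (j < 2)%nat ->
  wirtinger j h [A; B; C; D] =
    RtoC (1 / 2) * (realderiv (2 * j) h [A; B; C; D] - Ci * realderiv (2 * j + 1) h [A; B; C; D]) /\
  wirtinger (j + 2) h [A; B; C; D] =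
    RtoC (1 / 2) * (realderiv (2 * j) h [A; B; C; D] + Ci * realderiv (2 * j + 1) h [A; B; C; D]).
Proof.
  intro Hj. pose proof Ci_sqr as ECi. unfold wirtinger, realderiv.
  rewrite RtoC_half, !zcoords_basis.
  destruct j as [|[|j]]; [| |lia]; cbn [dirderiv map unit_form Nat.mul Nat.add];
    split; field [ECi].
Qed.

Lemma poly_plus (m : nat) (h h' : coef) (v : R4) :
  poly m (fun e => h e + h' e) v = poly m h v + poly m h' v.
Proof. apply heval_plus. Qed.

Lemma poly_scal (c : C) (m : nat) (h : coef) (v : R4) :
  poly m (fun e => c * h e) v = c * poly m h v.
Proof. apply heval_scal. Qed.

Lemma poly_minus (m : nat) (h h' : coef) (v : R4) :
  poly m (fun e => h e - h' e) v = poly m h v - poly m h' v.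
Proof.
  replace (poly m h v - poly m h' v) with (poly m h v + -(1) * poly m h' v) by ring.
  rewrite <- poly_scal, <- poly_plus. apply poly_ext. intros; ring.
Qed.

Lemma poly_wirtinger (m j : nat) (h : coef) (v : R4) : (j < 2)%nat ->
  poly m (wirtinger j h) v =
    RtoC (1 / 2) * (poly m (realderiv (2 * j) h) v - Ci * poly m (realderiv (2 * j + 1) h) v) /\
  poly m (wirtinger (j + 2) h) v =
    RtoC (1 / 2) * (poly m (realderiv (2 * j) h) v + Ci * poly m (realderiv (2 * j + 1) h) v).
Proof.
  intro Hj. rewrite <- (poly_scal Ci), <- poly_minus, <- poly_plus, <- !poly_scal.
  split; apply poly_ext; intros; apply wirtinger_realderiv, Hj.
Qed.

Lemma poly_0 (h : coef) (v : R4) : poly 0 h v = h [0; 0; 0; 0]%nat.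
Proof. exact (heval_0 (zcoords v) h). Qed.

Lemma poly_homogeneous (m : nat) (h : coef) (t : R) (v : R4) :
  poly m h (t ⊙ v) = RtoC (t ^ m) * poly m h v.
Proof.
  rewrite RtoC_pow. unfold poly. rewrite <- heval_homogeneous. f_equal.
  unfold zcoords, alpha, beta. rewrite !coord_scal. simpl.
  repeat f_equal; apply injective_projections; simpl; ring.
Qed.

Lemma poly_unit_form (m i : nat) (h : coef) (v : R4) : (i < 4)%nat ->
  poly (S m) (mulform (unit_form i) h) v = nth i (zcoords v) 0 * poly m h v.
Proof.
  intro Hi. unfold poly. rewrite heval_mulform. f_equal.
  destruct i as [|[|[|[|i]]]]; [| | | |lia]; cbn [unit_form map zcoords linform nth]; ring.
Qed.

Lemma RtoC_INR_S_neq_0 (n : nat) : RtoC (INR (S n)) <> 0.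
Proof. intro E. apply RtoC_inj in E. apply (not_0_INR (S n)); [discriminate|exact E]. Qed.

Lemma poly_independent (m : nat) : forall h : coef, (forall v, poly m h v = 0) ->
  forall A B C D, (A + B + C + D = m)%nat -> h [A; B; C; D] = 0.
Proof.
  induction m as [|m IH]; intros h Hz A B C D Hm.
  - replace [A; B; C; D] with [0; 0; 0; 0]%nat by (repeat f_equal; lia).
    rewrite <- (poly_0 h origin). apply Hz.
  - assert (Hreal : forall i v, poly m (realderiv i h) v = 0).
    { intros i v. apply (is_derive_C_unique _ _ _ _ (is_derive_C_line_poly m h v i)).
      replace (fun t => poly (S m) h (v ⊕ t ⊙ basis i)) with (fun _ : R => RtoC 0);
        [apply is_derive_C_const|].
      apply functional_extensionality. intro t. symmetry. apply Hz. }
    assert (Hw : forall j v, (j < 2)%nat ->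
      poly m (wirtinger j h) v = 0 /\ poly m (wirtinger (j + 2) h) v = 0).
    { intros j v Hj. destruct (poly_wirtinger m j h v Hj) as [-> ->]. rewrite !Hreal. split; ring. }
    assert (Hdiv : forall n c, RtoC (INR (S n)) * c = 0 -> c = 0).
    { intros n c E. replace c with (/ RtoC (INR (S n)) * (RtoC (INR (S n)) * c));
        [rewrite E; ring|]. field. apply RtoC_INR_S_neq_0. }
    destruct A as [|A]; [destruct B as [|B]; [destruct C as [|C]; [destruct D as [|D]; [lia|]|]|]|].
    + apply (Hdiv D). transitivity (wirtinger 3 h [0; 0; 0; D]%nat);
        [rewrite wirtinger_entry by lia; reflexivity|apply IH; [|lia]].
      intro v. apply (Hw 1%nat v). lia.
    + apply (Hdiv C). transitivity (wirtinger 2 h [0; 0; C; D]%nat);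
        [rewrite wirtinger_entry by lia; reflexivity|apply IH; [|lia]].
      intro v. apply (Hw 0%nat v). lia.
    + apply (Hdiv B). transitivity (wirtinger 1 h [0; B; C; D]%nat);
        [rewrite wirtinger_entry by lia; reflexivity|apply IH; [|lia]].
      intro v. apply (Hw 1%nat v). lia.
    + apply (Hdiv A). transitivity (wirtinger 0 h [A; B; C; D]);
        [rewrite wirtinger_entry by lia; reflexivity|apply IH; [|lia]].
      intro v. apply (Hw 0%nat v). lia.
Qed.

Lemma poly_sphere_independent (m : nat) (h : coef) :
  (forall v, dot v v = 1%R -> poly m h v = 0) ->
  forall A B C D, (A + B + C + D = m)%nat -> h [A; B; C; D] = 0.
Proof.
  intro Hz. apply poly_independent. intro v.
  assert (Hdir : exists t w, v = t ⊙ w /\ dot w w = 1%R).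
  { destruct (classic (v = origin)) as [->|Hv].
    - exists 0%R, (basis 0). split; [coords; ring|apply dot_basis_self].
    - exists (norm v), (normalize v).
      split; [symmetry; apply norm_scal_normalize, Hv|apply dot_normalize, Hv]. }
  destruct Hdir as [t [w [-> Hw]]]. rewrite poly_homogeneous, Hz by exact Hw. ring.
Qed.

Lemma pdC_curry4 (F G : R4 -> C) (i : nat) :
  (forall v, is_derive_C (fun t => F (v ⊕ t ⊙ basis i)) 0 (G v)) -> pdC i (curry4 F) = curry4 G.
Proof.
  intro D. apply fn4_ext. intro v. rewrite uncurry4_curry4. destruct (D v) as [D1 D2].
  apply injective_projections.
  - apply (is_derive_line_iff (ReF (curry4 F)) v i). exact D1.
  - apply (is_derive_line_iff (ImF (curry4 F)) v i). exact D2.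
Qed.

Lemma pdC_poly (m i : nat) (h : coef) :
  pdC i (curry4 (poly (S m) h)) = curry4 (poly m (realderiv i h)).
Proof. apply pdC_curry4. intro v. apply is_derive_C_line_poly. Qed.

Lemma pdC_poly_0 (i : nat) (h : coef) : pdC i (curry4 (poly 0 h)) = fun _ _ _ _ => 0.
Proof. apply (pdC_curry4 (poly 0 h) (fun _ => 0)). intro v. apply is_derive_C_line_poly_0. Qed.

Lemma d_alpha_poly (m : nat) (h : coef) :
  d_alpha (curry4 (poly (S m) h)) = curry4 (poly m (wirtinger 0 h)).
Proof.
  apply fn4_ext. intro v. unfold d_alpha. rewrite !pdC_poly.
  symmetry. apply (poly_wirtinger m 0 h v). lia.
Qed.

Lemma d_beta_poly (m : nat) (h : coef) :
  d_beta (curry4 (poly (S m) h)) = curry4 (poly m (wirtinger 1 h)).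
Proof.
  apply fn4_ext. intro v. unfold d_beta. rewrite !pdC_poly.
  symmetry. apply (poly_wirtinger m 1 h v). lia.
Qed.

(** * Siblings of monomials *)

Definition twist_coef (h : coef) : coef := fun e =>
  mulform (unit_form 2) (wirtinger 1 h) e - mulform (unit_form 3) (wirtinger 0 h) e.

Lemma twist_minus_poly (m : nat) (h : coef) :
  twist_minus (curry4 (poly m h)) = curry4 (poly m (twist_coef h)).
Proof.
  apply fn4_ext. intro v. unfold twist_minus, twist_coef, uncurry4, curry4 at 3.
  rewrite poly_minus. destruct m as [|m].
  - unfold d_alpha, d_beta. rewrite !pdC_poly_0, !poly_0.
    rewrite !(mulform_0 _ _ 4 : mulform _ _ [0; 0; 0; 0]%nat = 0). ring.
  - rewrite d_alpha_poly, d_beta_poly, !poly_unit_form by lia. unfold curry4, zcoords, alpha, beta.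
    cbn [nth coord]. ring.
Qed.

(* The coefficient of alpha^A beta^B conj(alpha)^C conj(beta)^D in the [(C + D)]-th sibling of
   alpha^(A + D) beta^(B + C). *)
Definition sibling_entry (A B C D : nat) : R :=
  ((-1) ^ D * INR (fact (A + D)) * INR (fact (B + C)) * INR (fact (C + D))
   / (INR (fact A) * INR (fact B) * INR (fact C) * INR (fact D)))%R.

Lemma sibling_entry_neq_0 (A B C D : nat) : RtoC (sibling_entry A B C D) <> 0.
Proof.
  intro E. apply RtoC_inj in E. revert E. unfold sibling_entry, Rdiv.
  repeat (apply Rmult_integral_contrapositive_currified || apply Rinv_neq_0_compat
    || apply INR_fact_neq_0). apply pow_nonzero. lra.
Qed.

Lemma sibling_entry_SB (A B C D : nat) :
  (INR (S (C + D)) * (INR (S B) * sibling_entry A (S B) C D)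
   = INR (S C) * sibling_entry A B (S C) D)%R.
Proof.
  unfold sibling_entry. rewrite Nat.add_succ_r. rewrite !Nat.add_succ_l.
  rewrite (fact_simpl B), (fact_simpl C), (fact_simpl (C + D)), !mult_INR.
  pose proof (INR_fact_neq_0 A). pose proof (INR_fact_neq_0 B). pose proof (INR_fact_neq_0 C).
  pose proof (INR_fact_neq_0 D). pose proof (not_0_INR (S B) (Nat.neq_succ_0 B)).
  pose proof (not_0_INR (S C) (Nat.neq_succ_0 C)). field. tauto.
Qed.

Lemma sibling_entry_SA (A B C D : nat) :
  (INR (S (C + D)) * (INR (S A) * sibling_entry (S A) B C D)
   = - (INR (S D) * sibling_entry A B C (S D)))%R.
Proof.
  unfold sibling_entry. rewrite !Nat.add_succ_r, !Nat.add_succ_l.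
  rewrite (fact_simpl A), (fact_simpl D), (fact_simpl (C + D)), !mult_INR.
  pose proof (INR_fact_neq_0 A). pose proof (INR_fact_neq_0 B). pose proof (INR_fact_neq_0 C).
  pose proof (INR_fact_neq_0 D). pose proof (not_0_INR (S A) (Nat.neq_succ_0 A)).
  pose proof (not_0_INR (S D) (Nat.neq_succ_0 D)). simpl pow. field. tauto.
Qed.

Lemma sibling_entry_twist (A B C D : nat) : (0 < C + D)%nat ->
  (match C with 0%nat => 0 | S C' => INR (S B) * sibling_entry A (S B) C' D end
   - match D with 0%nat => 0 | S D' => INR (S A) * sibling_entry (S A) B C D' end
   = sibling_entry A B C D)%R.
Proof.
  intro Hpos. set (s := match C with 0%nat => _ | _ => _ end).
  set (t := match D with 0%nat => _ | _ => _ end).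
  assert (Es : (INR (C + D) * s = INR C * sibling_entry A B C D)%R).
  { unfold s. destruct C as [|C]; [simpl INR at 2; ring|apply sibling_entry_SB]. }
  assert (Et : (INR (C + D) * t = - (INR D * sibling_entry A B C D))%R).
  { unfold t. destruct D as [|D]; [simpl INR at 2; ring|].
    rewrite Nat.add_succ_r. apply sibling_entry_SA. }
  apply (Rmult_eq_reg_l (INR (C + D))); [|apply not_0_INR; lia].
  rewrite Rmult_minus_distr_l, Es, Et, plus_INR. ring.
Qed.

(* A two-term recurrence propagates harmonicity along each line [(A + D, C + D) = const]; the
   harmonic coefficients are thus the multiples, line by line, of [sibling_entry]. *)
Definition line_coef (c : nat * nat -> C) : coef := fun e =>
  match e with
  | [A; B; C; D] => c (A + D, C + D)%nat * RtoC (sibling_entry A B C D)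
  | _ => 0
  end.

Lemma line_coef_ext (c c' : nat * nat -> C) (A B C D : nat) :
  c (A + D, C + D)%nat = c' (A + D, C + D)%nat ->
  line_coef c [A; B; C; D] = line_coef c' [A; B; C; D].
Proof. intro E. unfold line_coef. rewrite E. reflexivity. Qed.

Lemma twist_line_coef (c : nat * nat -> C) (A B C D : nat) :
  twist_coef (line_coef c) [A; B; C; D] =
  line_coef (fun aj => match snd aj with 0%nat => 0 | S j => c (fst aj, j) end) [A; B; C; D].
Proof.
  assert (E2 : forall h, mulform (unit_form 2) h [A; B; C; D]
    = match C with 0%nat => 0 | S C' => h [A; B; C'; D] end)
    by (intro h; destruct A, B, C, D; cbn [unit_form map mulform]; ring).
  assert (E3 : forall h, mulform (unit_form 3) h [A; B; C; D]
    = match D with 0%nat => 0 | S D' => h [A; B; C; D'] end)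
    by (intro h; destruct A, B, C, D; cbn [unit_form map mulform]; ring).
  unfold twist_coef. rewrite E2, E3. unfold line_coef at 3. cbn [fst snd].
  destruct (C + D)%nat as [|j] eqn:Ej.
  - replace C with 0%nat by lia. replace D with 0%nat by lia. ring.
  - assert (EC : match C with 0%nat => RtoC 0 | S C' => wirtinger 1 (line_coef c) [A; B; C'; D] end
      = c (A + D, j)%nat * RtoC match C with
          0%nat => 0%R | S C' => (INR (S B) * sibling_entry A (S B) C' D)%R end).
    { destruct C as [|C]; [ring|]. rewrite wirtinger_entry by lia. cbn [nth line_coef].
      replace (C + D)%nat with j by lia. rewrite RtoC_mult. ring. }
    assert (ED : match D with 0%nat => RtoC 0 | S D' => wirtinger 0 (line_coef c) [A; B; C; D'] end
      = c (A + D, j)%nat * RtoC match D with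
          0%nat => 0%R | S D' => (INR (S A) * sibling_entry (S A) B C D')%R end).
    { destruct D as [|D]; [ring|]. rewrite wirtinger_entry by lia. cbn [nth line_coef].
      replace (C + D)%nat with j by lia. replace (S A + D)%nat with (A + S D)%nat by lia.
      rewrite RtoC_mult. ring. }
    rewrite EC, ED, <- (sibling_entry_twist A B C D), RtoC_minus by lia. ring.
Qed.

Definition lap_coef (h : coef) : coef := fun e =>
  wirtinger 0 (wirtinger 2 h) e + wirtinger 1 (wirtinger 3 h) e.

Lemma lap_coef_entry (h : coef) (A B C D : nat) :
  lap_coef h [A; B; C; D] =
  RtoC (INR (S A)) * RtoC (INR (S C)) * h [S A; B; S C; D]
  + RtoC (INR (S B)) * RtoC (INR (S D)) * h [A; S B; C; S D].
Proof. unfold lap_coef. rewrite !wirtinger_entry by lia. cbn [nth]. ring. Qed.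

Definition harmonic_coef (m : nat) (h : coef) : Prop :=
  forall A B C D, (A + B + C + D + 2 = m)%nat -> lap_coef h [A; B; C; D] = 0.

Lemma lap_line_coef (c : nat * nat -> C) (A B C D : nat) : lap_coef (line_coef c) [A; B; C; D] = 0.
Proof.
  rewrite lap_coef_entry. cbn [line_coef].
  replace (A + S D)%nat with (S A + D)%nat by lia. replace (C + S D)%nat with (S C + D)%nat by lia.
  pose proof (sibling_entry_SB (S A) B C D) as EB. pose proof (sibling_entry_SA A (S B) C D) as EA.
  assert (E : (INR (S A) * INR (S C) * sibling_entry (S A) B (S C) D
    + INR (S B) * INR (S D) * sibling_entry A (S B) C (S D) = 0)%R).
  { rewrite (Rmult_assoc (INR (S A))), <- EB, (Rmult_assoc (INR (S B))).
    replace (INR (S D) * sibling_entry A (S B) C (S D))%R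
      with (- (INR (S (C + D)) * (INR (S A) * sibling_entry (S A) (S B) C D)))%R
      by (rewrite EA; ring).
    ring. }
  transitivity (c (S A + D, S C + D)%nat *
    RtoC (INR (S A) * INR (S C) * sibling_entry (S A) B (S C) D
    + INR (S B) * INR (S D) * sibling_entry A (S B) C (S D))).
  - rewrite RtoC_plus, !RtoC_mult. ring.
  - rewrite E. ring.
Qed.

Lemma harmonic_coef_zero (m : nat) (h : coef) :
  harmonic_coef m h ->
  (forall A B C D, (A + B + C + D = m)%nat -> A = 0%nat \/ C = 0%nat -> h [A; B; C; D] = 0) ->
  forall A B C D, (A + B + C + D = m)%nat -> h [A; B; C; D] = 0.
Proof.
  intros Hlap Hbdry A. induction A as [|A IH]; intros B C D Hm; [apply Hbdry; auto|].
  destruct C as [|C]; [apply Hbdry; auto|].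
  specialize (Hlap A B C D ltac:(lia)). rewrite lap_coef_entry, (IH (S B)) in Hlap by lia.
  pose proof (RtoC_INR_S_neq_0 A). pose proof (RtoC_INR_S_neq_0 C).
  transitivity (/ (RtoC (INR (S A)) * RtoC (INR (S C)))
    * (RtoC (INR (S A)) * RtoC (INR (S C)) * h [S A; B; S C; D]
       + RtoC (INR (S B)) * RtoC (INR (S D)) * 0)).
  - field. tauto.
  - rewrite Hlap. ring.
Qed.

Lemma harmonic_line_coef (m : nat) (h : coef) :
  harmonic_coef m h ->
  exists c, forall A B C D, (A + B + C + D = m)%nat -> h [A; B; C; D] = line_coef c [A; B; C; D].
Proof.
  intro Hlap.
  (* Each line is normalized at its entry with [A = 0] or [C = 0], where [D = min a j]. *)
  set (c := fun aj : nat * nat => let (a, j) := aj in let D := Nat.min a j in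
    let A := (a - D)%nat in let C := (j - D)%nat in let B := (m - A - C - D)%nat in
    h [A; B; C; D] / RtoC (sibling_entry A B C D)).
  exists c. intros A B C D Hm.
  assert (Hdiff : h [A; B; C; D] - line_coef c [A; B; C; D] = 0).
  { apply (harmonic_coef_zero m (fun e => h e - line_coef c e)); [| |exact Hm]; clear A B C D Hm.
    - intros A B C D Hm. specialize (Hlap A B C D Hm). pose proof (lap_line_coef c A B C D) as Hc.
      rewrite lap_coef_entry in *. transitivity (RtoC 0 - RtoC 0); [|ring].
      rewrite <- Hlap at 1. rewrite <- Hc. ring.
    - intros A B C D Hm H0. cbn [line_coef]. unfold c.
      replace (Nat.min (A + D) (C + D)) with D by lia.
      replace (A + D - D)%nat with A by lia. replace (C + D - D)%nat with C by lia.
      replace (m - A - C - D)%nat with B by lia.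
      field. apply sibling_entry_neq_0. }
  transitivity (h [A; B; C; D] - line_coef c [A; B; C; D] + line_coef c [A; B; C; D]); [ring|].
  rewrite Hdiff. ring.
Qed.

Definition nat_pair_dec (x y : nat * nat) : {x = y} + {x <> y}.
Proof. decide equality; apply Nat.eq_dec. Defined.

Definition restrict (l : list (nat * nat)) (c : nat * nat -> C) (x : nat * nat) : C :=
  if in_dec nat_pair_dec x l then c x else 0.

Lemma restrict_in (l : list (nat * nat)) (c : nat * nat -> C) (x : nat * nat) :
  In x l -> restrict l c x = c x.
Proof. intro H. unfold restrict. destruct in_dec; [reflexivity|contradiction]. Qed.

Lemma restrict_not_in (l : list (nat * nat)) (c : nat * nat -> C) (x : nat * nat) :
  ~ In x l -> restrict l c x = 0.
Proof. intro H. unfold restrict. destruct in_dec; [contradiction|reflexivity]. Qed.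

Definition sibling_coef (aj : nat * nat) : coef := line_coef (restrict [aj] (fun _ => 1)).

Lemma monomial_poly (a b : nat) : monomial a b = curry4 (poly (a + b) (sibling_coef (a, 0%nat))).
Proof.
  apply fn4_ext. intro v. rewrite uncurry4_curry4.
  replace (a + b)%nat with (list_sum [a; b; 0; 0]%nat) by (simpl; lia).
  unfold poly. rewrite heval_single.
  - unfold sibling_coef. cbn [line_coef zcoords mono]. rewrite restrict_in by (left; f_equal; lia).
    replace (sibling_entry a b 0 0) with 1%R.
    + unfold uncurry4, monomial. change cpow with Cpow. unfold alpha, beta. cbn [Cpow]. ring.
    + unfold sibling_entry. rewrite !Nat.add_0_r. simpl.
      pose proof (INR_fact_neq_0 a). pose proof (INR_fact_neq_0 b). field. tauto.
  - reflexivity.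
  - intros [|A [|B [|C [|D [|]]]]] Hlen Hsum Hne; try discriminate Hlen. cbn in Hsum.
    unfold sibling_coef. cbn [line_coef]. rewrite restrict_not_in; [ring|].
    intros [E|[]]. injection E as EA EC. apply Hne. repeat f_equal; lia.
Qed.

Lemma sibling_poly (a b j : nat) :
  sibling j (monomial a b) = curry4 (poly (a + b) (sibling_coef (a, j))).
Proof.
  induction j as [|j IH]; [apply monomial_poly|].
  change (sibling (S j) (monomial a b)) with (twist_minus (sibling j (monomial a b))).
  rewrite IH, twist_minus_poly. apply fn4_ext. intro v. rewrite !uncurry4_curry4.
  apply poly_ext. intros A B C D _. unfold sibling_coef. rewrite twist_line_coef.
  apply line_coef_ext. cbn [fst snd]. destruct (C + D)%nat as [|j'].
  - rewrite restrict_not_in; [reflexivity|]. intros [E|[]]. discriminate E.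
  - unfold restrict. destruct (in_dec _ _ _) as [[E|[]]|N], (in_dec _ _ _) as [[E'|[]]|N'];
      try reflexivity; exfalso; [apply N'|apply N]; left; congruence.
Qed.

Lemma basis_fn_poly (k a j : nat) : (a <= k)%nat ->
  basis_fn k (a, j) = curry4 (poly k (sibling_coef (a, j))).
Proof.
  intro Ha. unfold basis_fn. cbn [fst snd]. rewrite sibling_poly.
  replace (a + (k - a))%nat with k by lia. reflexivity.
Qed.

Lemma lincomb_poly (k : nat) (l : list (nat * nat)) (c : nat * nat -> C) :
  NoDup l -> (forall x, In x l -> (fst x <= k)%nat) ->
  lincomb k l c = curry4 (poly k (line_coef (restrict l c))).
Proof.
  intros Hl Hk. apply fn4_ext. intro v. rewrite uncurry4_curry4.
  induction Hl as [|[a j] l Hnotin Hl IH].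
  - transitivity (poly k (fun _ => 0) v); [symmetry; apply heval_zero|].
    apply poly_ext. intros. cbn [line_coef]. rewrite restrict_not_in by (intros []). ring.
  - change (c (a, j) * uncurry4 (basis_fn k (a, j)) v + uncurry4 (lincomb k l c) v
      = poly k (line_coef (restrict ((a, j) :: l) c)) v).
    rewrite IH by (intros; apply Hk; right; assumption).
    rewrite basis_fn_poly by (apply (Hk (a, j)); left; reflexivity).
    rewrite uncurry4_curry4, <- poly_scal, <- poly_plus. apply poly_ext. intros A B C D _.
    unfold sibling_coef. cbn [line_coef]. set (x := (A + D, C + D)%nat).
    replace (restrict ((a, j) :: l) c x)
      with (c (a, j) * restrict [(a, j)] (fun _ => 1) x + restrict l c x); [ring|].
    destruct (nat_pair_dec (a, j) x) as [<-|Hx].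
    + rewrite (restrict_not_in l), !restrict_in by (exact Hnotin || left; reflexivity). ring.
    + rewrite (restrict_not_in [(a, j)]) by (intros [E|[]]; contradiction).
      unfold restrict. destruct (in_dec _ _ l) as [Hin|Hout].
      * destruct in_dec as [|N]; [ring|contradiction N; right; exact Hin].
      * destruct in_dec as [[E|Hin]|]; [contradiction|contradiction|ring].
Qed.

Close Scope C_scope.

(** * Homogeneous harmonic functions are polynomials *)

Definition hpoly (m : nat) (f : R4 -> R) : Prop := exists h, forall v, RtoC (f v) = poly m h v.

Lemma hpoly_const (c : R) : hpoly 0 (fun _ => c).
Proof. exists (fun _ => RtoC c). intro v. symmetry. apply poly_0. Qed.

Lemma hpoly_plus (m : nat) (f g : R4 -> R) :
  hpoly m f -> hpoly m g -> hpoly m (fun v => f v + g v).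
Proof.
  intros [h Hf] [h' Hg]. eexists. intro v. rewrite RtoC_plus, Hf, Hg. symmetry. apply poly_plus.
Qed.

Lemma hpoly_scal (m : nat) (c : R) (f : R4 -> R) : hpoly m f -> hpoly m (fun v => c * f v).
Proof.
  intros [h Hf]. eexists. intro v. rewrite RtoC_mult, Hf. symmetry. apply poly_scal.
Qed.

Lemma hpoly_coord_mult (m i : nat) (f : R4 -> R) :
  hpoly m f -> hpoly (S m) (fun v => coord i v * f v).
Proof.
  intros [h Hf]. exists (mulform (map (fun u => RtoC (1 / 2) * Cconj u)%C (zcoords (basis i))) h).
  intro v. unfold poly. rewrite heval_mulform, RtoC_mult, Hf. f_equal.
  rewrite zcoords_basis. symmetry. destruct v as [[[x y] z] w].
  index_cases i; apply injective_projections; simpl; field.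
Qed.

Lemma differences_vanish_hpoly (m : nat) : forall f,
  (forall v, continuous f v) -> differences_vanish (S m) f ->
  hpoly m (fun x => Nat.iter m (diff (translate x)) f origin).
Proof.
  induction m as [|m IH]; intros f Hc Hf; [exact (hpoly_const (f origin))|].
  assert (Hi : forall i, hpoly (S m)
    (fun x => coord i x * Nat.iter m (diff (translate x)) (diff (translate (basis i)) f) origin)).
  { intro i. apply hpoly_coord_mult, IH; [apply continuous_diff_translate, Hc|].
    apply differences_vanish_diff, Hf. }
  replace (fun x => Nat.iter (S m) (diff (translate x)) f origin) with (fun x => sum4 (fun i =>
    coord i x * Nat.iter m (diff (translate x)) (diff (translate (basis i)) f) origin)).
  - repeat apply (hpoly_plus (S m)); apply Hi.
  - apply functional_extensionality. intro x. rewrite Nat.iter_succ.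
    rewrite differences_vanish_2_affine.
    + unfold sum4. rewrite !diff_iter_diff_comm. reflexivity.
    + apply continuous_iter_diff, Hc.
    + apply differences_vanish_iter. rewrite Nat.add_comm. exact Hf.
Qed.

Lemma tame_homogeneous_hpoly (k : nat) (s : list R4) (f : R4 -> R) :
  (forall v, continuous f v) -> tame (S k) s f ->
  (forall t v, 0 <= t -> f (t ⊙ v) = t ^ k * f v) -> hpoly k f.
Proof.
  intros Hc T Hf.
  replace f with (fun x => / INR (fact k) * Nat.iter k (diff (translate x)) f origin).
  - apply hpoly_scal, differences_vanish_hpoly; [exact Hc|].
    exact (tame_differences_vanish (S k) s f Hc T).
  - apply functional_extensionality. intro x. rewrite (iter_diff_homogeneous k) by exact Hf.
    field. apply INR_fact_neq_0.
Qed.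

(** * Differentiation along rays *)

Lemma is_derive_line_shift (f : R4 -> R) (v : R4) (i : nat) (t l : R) :
  is_derive (line f (v ⊕ t ⊙ basis i) i) 0 l -> is_derive (line f v i) t l.
Proof.
  intro D. apply (is_derive_ext (fun s => line f (v ⊕ t ⊙ basis i) i (s - t))).
  - intro s. unfold line. f_equal. coords. ring.
  - replace l with (1 * l) by ring.
    apply (is_derive_comp (line f (v ⊕ t ⊙ basis i) i) (fun s => s - t)).
    + rewrite Rminus_diag. exact D.
    + auto_derive; [exact I|ring].
Qed.

Lemma is_jet2_line (f g : R4 -> R) (v : R4) (i : nat) (b : R) :
  locally v (fun w => is_derive (line f w i) 0 (g w)) -> is_derive (line g v i) 0 b ->
  is_jet2 (line f v i) 0 (g v) b.
Proof.
  intros Hf Hg. exists (line g v i). split; [|split; [apply line_0|exact Hg]].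
  generalize (locally_axis i v _ Hf). apply filter_imp. intros t D.
  apply is_derive_line_shift, D.
Qed.

Lemma mean_value_line (f g : R4 -> R) (v : R4) (i : nat) (a : R) :
  (forall s, Rabs s <= Rabs a ->
    is_derive (line f (v ⊕ s ⊙ basis i) i) 0 (g (v ⊕ s ⊙ basis i))) ->
  exists s, Rabs s <= Rabs a /\ f (v ⊕ a ⊙ basis i) - f v = a * g (v ⊕ s ⊙ basis i).
Proof.
  intro D.
  assert (Hin : forall s, Rmin 0 a <= s <= Rmax 0 a -> Rabs s <= Rabs a).
  { intros s. unfold Rmin, Rmax. destruct Rle_dec; intro Hs.
    - rewrite !Rabs_pos_eq; lra.
    - rewrite !Rabs_left1; lra. }
  destruct (MVT_gen (line f v i) 0 a (line g v i)) as [s [Hs E]].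
  - intros s Hs. apply is_derive_line_shift, D, Hin. lra.
  - intros s Hs. apply derivable_continuous_pt. exists (line g v i s).
    apply is_derive_Reals, is_derive_line_shift, D, Hin, Hs.
  - exists s. split; [apply Hin, Hs|]. rewrite line_0, Rminus_0_r, Rmult_comm in E. exact E.
Qed.

Lemma is_derive_moving_increment (f g : R4 -> R) (i : nat) (w : R -> R4) (a : R) :
  locally (w 0) (fun y => is_derive (line f y i) 0 (g y)) -> continuous g (w 0) ->
  continuous w 0 -> is_derive (fun t => f (w t ⊕ (t * a) ⊙ basis i) - f (w t)) 0 (a * g (w 0)).
Proof.
  intros D Hg Hw. apply is_derive_Reals. intros e He. pose proof (Rabs_pos a) as Ha.
  assert (He' : 0 < e / (Rabs a + 1)) by (apply Rdiv_lt_0_compat; lra).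
  assert (Hnear : locally (w 0) (fun y => Rabs (g y - g (w 0)) < e / (Rabs a + 1))).
  { apply (Hg (fun y => Rabs (y - g (w 0)) < e / (Rabs a + 1))). apply locally_R_iff. eauto. }
  destruct (proj1 (locally_R4_iff _ _) (filter_and _ _ D Hnear)) as [d [Hd Hball]].
  assert (Hwd : locally 0 (fun t => norm (w t ⊖ w 0) < d / 2)).
  { apply (Hw (fun y => norm (y ⊖ w 0) < d / 2)). apply locally_R4_iff. exists (d / 2).
    split; [lra|trivial]. }
  apply locally_R_iff in Hwd. destruct Hwd as [d' [Hd' Hwd]].
  assert (Hdelta : 0 < Rmin d' (d / (2 * (Rabs a + 1)))).
  { apply Rmin_glb_lt; [exact Hd'|apply Rdiv_lt_0_compat; lra]. }
  exists (mkposreal _ Hdelta). intros t Ht Htd. simpl in Htd.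
  assert (Hwt : norm (w t ⊖ w 0) < d / 2).
  { apply Hwd. rewrite Rminus_0_r. eapply Rlt_le_trans; [exact Htd|apply Rmin_l]. }
  assert (Hta : Rabs (t * a) < d / 2).
  { rewrite Rabs_mult. pose proof (Rmin_r d' (d / (2 * (Rabs a + 1)))).
    assert (Rabs t * (Rabs a + 1) < d / 2); [|pose proof (Rabs_pos t); nra].
    replace (d / 2) with (d / (2 * (Rabs a + 1)) * (Rabs a + 1)) by (field; lra).
    apply Rmult_lt_compat_r; lra. }
  assert (Hin : forall s, Rabs s <= Rabs (t * a) -> norm (w t ⊕ s ⊙ basis i ⊖ w 0) < d).
  { intros s Hs.
    replace (w t ⊕ s ⊙ basis i ⊖ w 0) with ((w t ⊖ w 0) ⊕ s ⊙ basis i) by (coords; ring).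
    eapply Rle_lt_trans; [apply norm_triangle|]. rewrite norm_scal_basis. lra. }
  destruct (mean_value_line f g (w t) i (t * a)) as [s [Hs E]];
    [intros s Hs; apply Hball, Hin, Hs|].
  rewrite Rplus_0_l, E, Rmult_0_l. replace (w 0 ⊕ 0 ⊙ basis i) with (w 0) by (coords; ring).
  replace (_ / t - _) with (a * (g (w t ⊕ s ⊙ basis i) - g (w 0))) by (field; exact Ht).
  rewrite Rabs_mult. destruct (Hball _ (Hin s Hs)) as [_ Hgs].
  apply Rle_lt_trans with (Rabs a * (e / (Rabs a + 1))); [apply Rmult_le_compat_l; lra|].
  apply Rlt_le_trans with ((Rabs a + 1) * (e / (Rabs a + 1))); [apply Rmult_lt_compat_r; lra|].
  right. field. lra.
Qed.

(* [f (v + t h)] is reached from [f v] by four moves parallel to the axes. *)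
Lemma is_derive_ray (f : R4 -> R) (g : nat -> R4 -> R) (v h : R4) :
  (forall i, locally v (fun y => is_derive (line f y i) 0 (g i y))) ->
  (forall i, continuous (g i) v) ->
  is_derive (fun t => f (v ⊕ t ⊙ h)) 0 (sum4 (fun i => coord i h * g i v)).
Proof.
  intros D Hg.
  set (w0 := fun _ : R => v). set (w1 := fun t => w0 t ⊕ (t * coord 0 h) ⊙ basis 0).
  set (w2 := fun t => w1 t ⊕ (t * coord 1 h) ⊙ basis 1).
  set (w3 := fun t => w2 t ⊕ (t * coord 2 h) ⊙ basis 2).
  assert (Hmove : forall (w : R -> R4) i, w 0 = v -> continuous w 0 ->
    is_derive (fun t => f (w t ⊕ (t * coord i h) ⊙ basis i) - f (w t)) 0 (coord i h * g i v)).
  { intros w i E Hw. rewrite <- E.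
    apply is_derive_moving_increment; [rewrite E; apply D|rewrite E; apply Hg|exact Hw]. }
  assert (Hstep : forall (w : R -> R4) i, w 0 = v -> continuous w 0 ->
    w 0 ⊕ (0 * coord i h) ⊙ basis i = v /\
    continuous (fun t => w t ⊕ (t * coord i h) ⊙ basis i) 0).
  { intros w i E Hw. split; [rewrite E; coords; ring|]. apply continuous_vplus; [exact Hw|].
    apply continuous_vscal; [|apply continuous_const].
    apply continuous_Rmult; [apply continuous_id|apply continuous_const]. }
  destruct (Hstep w0 0%nat eq_refl (continuous_const v 0)) as [E1 C1].
  destruct (Hstep w1 1%nat E1 C1) as [E2 C2]. destruct (Hstep w2 2%nat E2 C2) as [E3 C3].
  pose proof (Hmove w0 0%nat eq_refl (continuous_const v 0)) as D0.
  pose proof (Hmove w1 1%nat E1 C1) as D1. pose proof (Hmove w2 2%nat E2 C2) as D2.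
  pose proof (Hmove w3 3%nat E3 C3) as D3.
  assert (Etel : forall t, f v + ((f (w1 t) - f (w0 t)) + (f (w2 t) - f (w1 t))
    + (f (w3 t) - f (w2 t)) + (f (w3 t ⊕ (t * coord 3 h) ⊙ basis 3) - f (w3 t))) = f (v ⊕ t ⊙ h)).
  { intro t. replace (v ⊕ t ⊙ h) with (w3 t ⊕ (t * coord 3 h) ⊙ basis 3); [unfold w0; ring|].
    unfold w3, w2, w1, w0. rewrite (R4_basis_expansion h) at 5. coords. ring. }
  apply (is_derive_ext _ _ _ _ Etel).
  replace (sum4 _) with (0 + sum4 (fun i => coord i h * g i v)) by ring.
  apply (is_derive_plus (fun _ => f v)); [apply (is_derive_const (f v))|].
  repeat apply (is_derive_plus (V := R_NormedModule)); assumption.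
Qed.

Definition homogeneous0 (f : R4 -> R) : Prop := forall t v, 0 < t -> f (t ⊙ v) = f v.

Lemma euler_homogeneous0 (f : R4 -> R) (g : nat -> R4 -> R) (v : R4) :
  homogeneous0 f -> (forall i, locally v (fun y => is_derive (line f y i) 0 (g i y))) ->
  (forall i, continuous (g i) v) -> sum4 (fun i => coord i v * g i v) = 0.
Proof.
  intros Hf D Hg. apply is_derive_ray with (h := v) in D; [|exact Hg].
  apply is_derive_unique in D. rewrite <- D. transitivity (Derive (fun _ => f v) 0);
    [|apply Derive_const]. apply Derive_ext_loc, locally_R_iff. exists 1.
  split; [lra|]. intros t Ht. apply Rabs_def2 in Ht. rewrite <- (Hf (1 + t) v) by lra.
  f_equal. coords. ring.
Qed.

(** * Homogeneous extensions of eigenfunctions *)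

Lemma nonzero4_iff (v : R4) : uncurry4 nonzero4 v <-> v <> origin.
Proof.
  unfold uncurry4, nonzero4. split; intros H E; apply H.
  - rewrite E. repeat split.
  - destruct E as [E0 [E1 [E2 E3]]]. apply R4_ext. intro i. rewrite coord_origin.
    destruct v as [[[? ?] ?] ?]; index_cases i; assumption.
Qed.

Lemma cont4_iff (g : fn4R) (v : R4) : uncurry4 (cont4 g) v <-> continuous (uncurry4 g) v.
Proof.
  assert (E : uncurry4 g = fun p : R * R * R * R => let '(a, b, c, d) := p in g a b c d)
    by (apply functional_extensionality; intros [[[a b] c] d]; reflexivity).
  rewrite E. destruct v as [[[x y] z] w]. reflexivity.
Qed.

Lemma C2_off0_continuous (g : fn4R) (v : R4) :
  C2_off0 g -> v <> origin -> continuous (uncurry4 g) v.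
Proof.
  intros H Hv. apply nonzero4_iff in Hv. exact (proj1 (cont4_iff g v) (proj1 (H _ _ _ _ Hv))).
Qed.

Lemma C2_off0_pd (g : fn4R) (v : R4) (i : nat) : C2_off0 g -> v <> origin ->
  is_derive (line (uncurry4 g) v i) 0 (uncurry4 (pd i g) v) /\
  continuous (uncurry4 (pd i g)) v /\
  is_derive (line (uncurry4 (pd i g)) v i) 0 (uncurry4 (pd i (pd i g)) v).
Proof.
  intros H Hv. apply nonzero4_iff in Hv. destruct (H _ _ _ _ Hv) as [_ [H1 H2]].
  assert (Hi : forall j, (j < 4)%nat -> uncurry4 (exd j g) v /\ uncurry4 (cont4 (pd j g)) v
    /\ uncurry4 (exd j (pd j g)) v).
  { intros j Hj. destruct (H1 j Hj) as [He Hc]. exact (conj He (conj Hc (proj1 (H2 j j Hj Hj)))). }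
  rewrite !is_derive_line_iff, <- cont4_iff.
  enough (uncurry4 (exd i g) v /\ uncurry4 (cont4 (pd i g)) v /\ uncurry4 (exd i (pd i g)) v)
    by tauto.
  index_cases i; [apply (Hi 0%nat)|apply (Hi 1%nat)|apply (Hi 2%nat)|apply (Hi 3%nat)]; lia.
Qed.

Lemma C2_off0_grad_lap (g : fn4R) (v : R4) : C2_off0 g -> v <> origin ->
  is_grad_lap (uncurry4 g) v (fun i => uncurry4 (pd i g) v) (uncurry4 (lap4 g) v).
Proof.
  intros H Hv. exists (fun i => uncurry4 (pd i (pd i g)) v). split; [|reflexivity].
  intro i. apply is_jet2_line; [|apply (C2_off0_pd g v i H Hv)].
  generalize (locally_neq origin v Hv). apply filter_imp. intros w Hw.
  apply (C2_off0_pd g w i H Hw).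
Qed.

Lemma is_jet2_sqrt_pow (k : nat) (s : R) : 0 < s ->
  is_jet2 (fun s => sqrt s ^ k) s (INR k / 2 * (sqrt s ^ k / s))
    (INR k / 2 * (INR k / 2 - 1) * (sqrt s ^ k / s ^ 2)).
Proof.
  assert (D : forall s, 0 < s ->
    is_derive (fun s => sqrt s ^ k) s (INR k / 2 * (sqrt s ^ k / s))).
  { clear s. intros s Hs. pose proof (sqrt_lt_R0 _ Hs) as Hr.
    auto_derive; [exact Hs|]. destruct k as [|k]; [simpl; field; lra|].
    rewrite <- (sqrt_sqrt s) at 4 by lra. change (pred (S k)) with k. simpl pow. field. lra. }
  intro Hs. exists (fun s => INR k / 2 * (sqrt s ^ k / s)). split; [|split; [reflexivity|]].
  - generalize (locally_gt (fun s : R => s) _ _ (continuous_id _) Hs). apply filter_imp, D.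
  - replace (INR k / 2 * (INR k / 2 - 1) * (sqrt s ^ k / s ^ 2)) with
      (INR k / 2 * (INR k / 2 * (sqrt s ^ k / s) * / s + sqrt s ^ k * (- / s ^ 2))) by (field; lra).
    apply (is_derive_scal (fun s => sqrt s ^ k * / s)).
    apply (is_derive_Rmult (fun s => sqrt s ^ k) Rinv); [apply D, Hs|].
    auto_derive; [lra|field; lra].
Qed.

Lemma is_grad_lap_norm_pow (k : nat) (v : R4) : v <> origin ->
  is_grad_lap (fun w => norm w ^ k) v (fun i => INR k * (norm v ^ k / dot v v) * coord i v)
    (INR (k * (k + 2)) * (norm v ^ k / dot v v)).
Proof.
  intro Hv. pose proof (dot_self_gt_0 v Hv) as Hd.
  replace (fun w : R4 => norm w ^ k) with (fun w : R4 => sqrt (dot w w) ^ k)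
    by (apply functional_extensionality; intro; rewrite norm_sqrt; reflexivity).
  rewrite norm_sqrt. set (p := sqrt (dot v v) ^ k / dot v v).
  pose proof (is_grad_lap_radial _ v _ _ (is_jet2_sqrt_pow k (dot v v) Hd)) as H. fold p in H.
  replace (fun i => INR k * p * coord i v) with (fun i => 2 * coord i v * (INR k / 2 * p))
    by (apply functional_extensionality; intro; field).
  replace (INR (k * (k + 2)) * p) with (4 * dot v v
    * (INR k / 2 * (INR k / 2 - 1) * (sqrt (dot v v) ^ k / dot v v ^ 2)) + 8 * (INR k / 2 * p));
    [exact H|].
  rewrite mult_INR, plus_INR. simpl (INR 2). unfold p. field. lra.
Qed.

(* By Euler's relation the gradient of a function of degree 0 is orthogonal to that of a radial
   function, so the mixed term of the product rule vanishes. *)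
Lemma is_lap_norm_pow_mult (k : nat) (u : fn4R) (v : R4) :
  C2_off0 u -> homogeneous0 (uncurry4 u) -> v <> origin ->
  is_lap (fun w => norm w ^ k * uncurry4 u w) v
    (norm v ^ k * (uncurry4 (lap4 u) v + INR (k * (k + 2)) / dot v v * uncurry4 u v)).
Proof.
  intros Hu Hh Hv. pose proof (dot_self_gt_0 v Hv) as Hd.
  assert (Euler : sum4 (fun i => coord i v * uncurry4 (pd i u) v) = 0).
  { apply (euler_homogeneous0 (uncurry4 u) (fun i => uncurry4 (pd i u)) v Hh).
    - intro i. generalize (locally_neq origin v Hv). apply filter_imp. intros w Hw.
      apply (C2_off0_pd u w i Hu Hw).
    - intro i. apply (C2_off0_pd u v i Hu Hv). }
  set (p := norm v ^ k / dot v v).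
  pose proof (is_grad_lap_mult _ _ _ _ _ _ _ (is_grad_lap_norm_pow k v Hv)
    (C2_off0_grad_lap u v Hu Hv)) as H.
  replace (sum4 (fun i => _ * uncurry4 (pd i u) v)) with
    (INR k * p * sum4 (fun i => coord i v * uncurry4 (pd i u) v)) in H by (unfold sum4, p; ring).
  rewrite Euler in H. eexists.
  replace (norm v ^ k * _) with (INR (k * (k + 2)) * p * uncurry4 u v + 2 * (INR k * p * 0)
    + norm v ^ k * uncurry4 (lap4 u) v); [exact H|]. unfold p. field. lra.
Qed.

Lemma homogeneous0_bounded (f : R4 -> R) :
  homogeneous0 f -> (forall v, v <> origin -> continuous f v) ->
  exists b, 0 <= b /\ forall v, v <> origin -> Rabs (f v) <= b.
Proof.
  intros Hf Hc.
  destruct (exists_sup_limit_point (fun v => Rabs (f v)) (fun v => norm v = 1) 1) as [p Hp].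
  { intros v Hv. lra. }
  set (b := Rabs (f p) + 1).
  assert (Hb : 0 <= b) by (pose proof (Rabs_pos (f p)); unfold b; lra).
  exists b. split; [exact Hb|]. intros v Hv. pose proof (norm_gt_0 v Hv) as Hn.
  rewrite <- (Hf (/ norm v) v) by (apply Rinv_0_lt_compat, Hn). fold (normalize v).
  apply (Hp b); [|rewrite norm_sqrt, dot_normalize, sqrt_1 by exact Hv; reflexivity].
  destruct (classic (p = origin)) as [->|Hp0].
  - assert (Hlt : norm origin < 1) by (rewrite norm_sqrt, dot_origin, sqrt_0; lra).
    generalize (locally_lt norm origin 1 (continuous_norm _) Hlt). apply filter_imp. intros; lra.
  - assert (Habs : continuous (fun w => Rabs (f w)) p)
      by (apply (continuous_comp f Rabs); [apply Hc, Hp0|apply continuous_Rabs]).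
    assert (Hlt : Rabs (f p) < b) by (unfold b; lra).
    generalize (locally_lt _ p b Habs Hlt). apply filter_imp. intros; lra.
Qed.

Section Eigenfunction.

Variables (k : nat) (u : fn4R).
Hypothesis Hu : C2_off0 u.
Hypothesis Hhom : homogeneous0 (uncurry4 u).
Hypothesis Heig :
  forall v, dot v v = 1 -> uncurry4 (lap4 u) v = - INR (k * (k + 2)) * uncurry4 u v.

Definition solid_extension (v : R4) : R := norm v ^ k * uncurry4 u v.

Lemma solid_extension_homogeneous (t : R) (v : R4) :
  0 < t -> solid_extension (t ⊙ v) = t ^ k * solid_extension v.
Proof.
  intro Ht. unfold solid_extension. rewrite Hhom by exact Ht.
  rewrite norm_scal_R4, (Rabs_pos_eq t), Rpow_mult_distr by lra. ring.
Qed.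

Lemma solid_extension_lap (v : R4) : v <> origin -> is_lap solid_extension v 0.
Proof.
  intro Hv. pose proof (norm_gt_0 v Hv) as Hn. pose proof (dot_normalize v Hv) as Hw.
  set (w := normalize v) in *.
  assert (Lw : is_lap solid_extension w 0).
  { pose proof (is_lap_norm_pow_mult k u w Hu Hhom (dot_1_neq_origin w Hw)) as L.
    rewrite Heig, Hw in L by exact Hw.
    replace 0 with (norm w ^ k * (- INR (k * (k + 2)) * uncurry4 u w
      + INR (k * (k + 2)) / 1 * uncurry4 u w)) by field.
    exact L. }
  apply (is_lap_ext_loc (fun y => norm v ^ k * solid_extension (/ norm v ⊙ y))).
  - apply filter_forall. intro y.
    rewrite solid_extension_homogeneous by (apply Rinv_0_lt_compat, Hn).
    rewrite <- Rmult_assoc, <- Rpow_mult_distr, Rinv_r, pow1 by lra. ring.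
  - replace 0 with (norm v ^ k * (/ norm v * / norm v * 0)) by ring.
    apply is_lap_scal, (is_lap_comp (vscal (/ norm v)) (fun _ => / norm v));
      [|reflexivity|exact Lw].
    intros i t. coords. ring.
Qed.

Lemma solid_extension_harmonic (v : R4) : v <> origin -> harmonic_at solid_extension v.
Proof.
  intro Hv. split; [apply solid_extension_lap, Hv|].
  apply continuous_Rmult; [apply continuous_norm_pow|apply C2_off0_continuous; assumption].
Qed.

Lemma solid_extension_le : exists b, 0 <= b /\
  forall v, Rabs (solid_extension v) <= b * norm v ^ k.
Proof.
  destruct (homogeneous0_bounded _ Hhom) as [b [Hb Hle]];
    [intros v Hv; apply C2_off0_continuous; assumption|].
  set (c := Rmax b (Rabs (uncurry4 u origin))).
  exists c. split; [eapply Rle_trans; [exact Hb|apply Rmax_l]|]. intro v.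
  unfold solid_extension. rewrite Rabs_mult, Rmult_comm, (Rabs_pos_eq (norm v ^ k))
    by (apply pow_le, norm_ge_0).
  apply Rmult_le_compat_r; [apply pow_le, norm_ge_0|].
  destruct (classic (v = origin)) as [->|Hv]; [apply Rmax_r|].
  eapply Rle_trans; [apply Hle, Hv|apply Rmax_l].
Qed.

Lemma solid_extension_tame : tame (S k) [origin] solid_extension.
Proof.
  destruct solid_extension_le as [b [Hb Hle]]. split.
  - intros v Hv. apply solid_extension_harmonic. intros ->. apply Hv. left. reflexivity.
  - intro v. exists (b * (norm v ^ k + 1)).
    assert (Hlt : norm v ^ k < norm v ^ k + 1) by lra.
    generalize (locally_lt _ v _ (continuous_norm_pow k v) Hlt). apply filter_imp. intros w Hw.
    eapply Rle_trans; [apply Hle|]. apply Rmult_le_compat_l; lra.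
  - exists b, 1. split; [exact Hb|]. split; [lra|]. intros v Hv.
    rewrite <- tech_pow_Rmult, (Rmult_comm (norm v)), <- Rmult_assoc.
    apply Rmult_le_compat_r; [lra|apply Hle].
Qed.

Lemma solid_extension_continuous : k <> 0%nat -> forall v, continuous solid_extension v.
Proof.
  intros Hk v. destruct (classic (v = origin)) as [->|Hv]; [|apply solid_extension_harmonic, Hv].
  destruct solid_extension_le as [b [Hb Hle]].
  assert (E0 : norm origin ^ k = 0) by (rewrite norm_sqrt, dot_origin, sqrt_0; apply pow_i; lia).
  assert (EH : solid_extension origin = 0) by (unfold solid_extension; rewrite E0; ring).
  intros P [e HP]. pose proof (cond_pos e) as He.
  assert (Hlt : (b + 1) * norm origin ^ k < e) by (rewrite E0; lra).
  assert (Hc : continuous (fun w : R4 => (b + 1) * norm w ^ k) origin)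
    by (apply continuous_Rmult; [apply continuous_const|apply continuous_norm_pow]).
  change (locally origin (fun w => P (solid_extension w))).
  generalize (locally_lt _ _ _ Hc Hlt). apply filter_imp. intros w Hw. apply HP.
  change (Rabs (solid_extension w - solid_extension origin) < e). rewrite EH, Rminus_0_r.
  specialize (Hle w). pose proof (pow_le (norm w) k (norm_ge_0 w)). nra.
Qed.

(* Bounded first differences decay at infinity, so they vanish off their singularities; moving
   coordinate by coordinate then joins any point to [basis 0] while avoiding the origin. *)
Lemma degree_0_constant (v : R4) :
  k = 0%nat -> v <> origin -> uncurry4 u v = uncurry4 u (basis 0).
Proof.
  intros Hk Hv.
  assert (Hmove : forall w i t, w <> origin -> w ⊕ t ⊙ basis i <> origin ->
    uncurry4 u (w ⊕ t ⊙ basis i) = uncurry4 u w).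
  { intros w i t Hw Hwt.
    assert (T : tame 1 [origin] (uncurry4 u)).
    { pose proof solid_extension_tame as T. rewrite Hk in T.
      replace (uncurry4 u) with solid_extension; [exact T|].
      apply functional_extensionality. intro y. unfold solid_extension. rewrite Hk. simpl. ring. }
    apply Rminus_diag_uniq. apply (tame_0_zero _ _ w (tame_diff _ _ _ i t T)).
    simpl. intros [E|[E|[]]]; [exact (Hw (eq_sym E))|]. apply Hwt. rewrite <- E. coords. ring. }
  assert (Hne : forall w, coord 0 w = 1 -> w <> origin)
    by (intros w E ->; rewrite coord_origin in E; lra).
  set (w1 := v ⊕ (1 - coord 0 v) ⊙ basis 0). set (w2 := w1 ⊕ (- coord 1 v) ⊙ basis 1).
  set (w3 := w2 ⊕ (- coord 2 v) ⊙ basis 2).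
  replace (basis 0) with (w3 ⊕ (- coord 3 v) ⊙ basis 3).
  - unfold w3, w2, w1. rewrite !Hmove; [reflexivity|..]; try exact Hv; apply Hne;
      rewrite ?coord_plus, ?coord_scal, ?coord_plus, ?coord_scal; simpl (coord _ (basis _)); ring.
  - unfold w3, w2, w1. coords. destruct v as [[[? ?] ?] ?]; index_cases i; simpl; ring.
Qed.

Lemma eigenfunction_hpoly : exists f, hpoly k f /\ forall v, dot v v = 1 -> uncurry4 u v = f v.
Proof.
  destruct (Nat.eq_dec k 0) as [Hk|Hk].
  - exists (fun _ => uncurry4 u (basis 0)). split; [rewrite Hk; apply hpoly_const|].
    intros v Hv. apply (degree_0_constant v Hk), dot_1_neq_origin, Hv.
  - exists solid_extension. split.
    + apply (tame_homogeneous_hpoly k [origin]).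
      * apply solid_extension_continuous, Hk.
      * apply solid_extension_tame.
      * intros t v [Ht|<-]; [apply solid_extension_homogeneous, Ht|].
        replace (0 ⊙ v) with (0 ⊙ basis 0) by (coords; ring). unfold solid_extension.
        rewrite norm_scal_basis, Rabs_R0, pow_i by lia. ring.
    + intros v Hv. unfold solid_extension. rewrite norm_sqrt, Hv, sqrt_1, pow1. ring.
Qed.

End Eigenfunction.

(** * Restrictions of polynomials to the sphere *)

(* A class of functions on R^4 minus the origin that is closed under partial derivatives. *)
Inductive elementary : (R4 -> R) -> Prop :=
| elementary_const c : elementary (fun _ => c)
| elementary_coord i : elementary (coord i)
| elementary_inv_norm : elementary (fun v => / norm v)
| elementary_plus f g : elementary f -> elementary g -> elementary (fun v => f v + g v)
| elementary_mult f g : elementary f -> elementary g -> elementary (fun v => f v * g v).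

Lemma is_derive_line_inv_norm (v : R4) (i : nat) : v <> origin ->
  is_derive (line (fun w => / norm w) v i) 0 (-1 * coord i v * (/ norm v * (/ norm v * / norm v))).
Proof.
  intro Hv. pose proof (norm_gt_0 v Hv) as Hn. pose proof (dot_self_gt_0 v Hv) as Hd.
  assert (E : forall t,
    / sqrt (dot v v + 2 * coord i v * t + t * t) = line (fun w => / norm w) v i t).
  { intro t. rewrite <- line_dot_self. unfold line. rewrite norm_sqrt. reflexivity. }
  apply (is_derive_ext _ _ _ _ E).
  assert (E0 : dot v v + 2 * coord i v * 0 + 0 * 0 = dot v v) by ring.
  auto_derive; rewrite ?E0, <- ?norm_sqrt.
  - repeat split; lra.
  - rewrite norm_sqrt in *. field. lra.
Qed.

Lemma elementary_continuous (f : R4 -> R) (v : R4) :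
  elementary f -> v <> origin -> continuous f v.
Proof.
  intros Hf Hv. induction Hf as [c|i| |f g _ IHf _ IHg|f g _ IHf _ IHg].
  - apply continuous_const.
  - apply continuous_coord.
  - apply (continuous_comp (fun w : R4 => norm w) Rinv); [apply continuous_norm|].
    apply (is_derive_continuous Rinv _ (- 1 / norm v ^ 2)). pose proof (norm_gt_0 v Hv).
    auto_derive; [lra|field; lra].
  - apply continuous_Rplus; assumption.
  - apply continuous_Rmult; assumption.
Qed.

Lemma elementary_derive (f : R4 -> R) (i : nat) : elementary f ->
  exists f', elementary f' /\ forall v, v <> origin -> is_derive (line f v i) 0 (f' v).
Proof.
  induction 1 as [c|j| |f g Hf [f' [Ef Df]] Hg [g' [Eg Dg]]|f g Hf [f' [Ef Df]] Hg [g' [Eg Dg]]].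
  - exists (fun _ => 0). split; [constructor|]. intros v _. apply (is_derive_const c).
  - exists (fun _ => coord j (basis i)). split; [constructor|]. intros v _.
    apply (is_derive_ext (fun t => coord j v + t * coord j (basis i))).
    + intro t. unfold line. rewrite coord_plus, coord_scal. reflexivity.
    + auto_derive; [exact I|ring].
  - eexists. split; [|intro v; apply is_derive_line_inv_norm]. repeat constructor.
  - exists (fun v => f' v + g' v). split; [constructor; assumption|]. intros v Hv.
    exact (is_derive_plus (line f v i) (line g v i) 0 _ _ (Df v Hv) (Dg v Hv)).
  - exists (fun v => f' v * g v + f v * g' v). split; [repeat constructor; assumption|].
    intros v Hv. rewrite <- (line_0 f v i), <- (line_0 g v i).
    apply (is_derive_Rmult (line f v i) (line g v i)); [exact (Df v Hv)|exact (Dg v Hv)].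
Qed.

Definition agrees_off0 (g : fn4R) (f : R4 -> R) : Prop :=
  forall v, v <> origin -> uncurry4 g v = f v.

Lemma agrees_off0_cont4 (g : fn4R) (f : R4 -> R) (v : R4) :
  agrees_off0 g f -> elementary f -> v <> origin -> uncurry4 (cont4 g) v.
Proof.
  intros E Hf Hv. apply (proj2 (cont4_iff g v)). apply (continuous_ext_loc _ f).
  - generalize (locally_neq origin v Hv). apply filter_imp. intros w Hw. symmetry. apply E, Hw.
  - apply elementary_continuous; assumption.
Qed.

Lemma agrees_off0_pd (g : fn4R) (f : R4 -> R) (i : nat) : agrees_off0 g f -> elementary f ->
  (forall v, v <> origin -> uncurry4 (exd i g) v) /\
  exists f', elementary f' /\ agrees_off0 (pd i g) f'.
Proof.
  intros E Hf. destruct (elementary_derive f i Hf) as [f' [Hf' D]].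
  assert (H : forall v, v <> origin -> uncurry4 (exd i g) v /\ uncurry4 (pd i g) v = f' v).
  { intros v Hv. apply is_derive_line_iff.
    apply (is_derive_ext_loc (line f v i)); [|exact (D v Hv)].
    generalize (locally_axis i v _ (locally_neq origin v Hv)). apply filter_imp.
    intros t Ht. symmetry. apply E, Ht. }
  split; [intros v Hv; apply H, Hv|]. exists f'. split; [exact Hf'|]. intros v Hv. apply H, Hv.
Qed.

Lemma agrees_off0_C2 (g : fn4R) (f : R4 -> R) : agrees_off0 g f -> elementary f -> C2_off0 g.
Proof.
  intros E Hf x y z w Hv. apply (nonzero4_iff (x, y, z, w)) in Hv.
  split; [exact (agrees_off0_cont4 g f (x, y, z, w) E Hf Hv)|]. split.
  - intros i _. destruct (agrees_off0_pd g f i E Hf) as [He [f' [Hf' E']]].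
    split; [apply (He (x, y, z, w) Hv)|exact (agrees_off0_cont4 _ f' (x, y, z, w) E' Hf' Hv)].
  - intros i j _ _. destruct (agrees_off0_pd g f i E Hf) as [_ [f' [Hf' E']]].
    destruct (agrees_off0_pd _ f' j E' Hf') as [He [f'' [Hf'' E'']]].
    split; [apply (He (x, y, z, w) Hv)|exact (agrees_off0_cont4 _ f'' (x, y, z, w) E'' Hf'' Hv)].
Qed.

Lemma elementary_ext (f g : R4 -> R) : (forall v, f v = g v) -> elementary f -> elementary g.
Proof. intro E. replace g with f; [trivial|]. apply functional_extensionality, E. Qed.

Definition elementaryC (F : R4 -> C) : Prop :=
  elementary (fun v => Re (F v)) /\ elementary (fun v => Im (F v)).

Lemma elementaryC_const (c : C) : elementaryC (fun _ => c).
Proof. split; constructor. Qed.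

Lemma elementaryC_plus (F G : R4 -> C) :
  elementaryC F -> elementaryC G -> elementaryC (fun v => F v + G v)%C.
Proof. intros [F1 F2] [G1 G2]. split; simpl; constructor; assumption. Qed.

Lemma elementaryC_mult (F G : R4 -> C) :
  elementaryC F -> elementaryC G -> elementaryC (fun v => F v * G v)%C.
Proof.
  intros [F1 F2] [G1 G2]. split.
  - apply (elementary_ext (fun v => Re (F v) * Re (G v) + -1 * (Im (F v) * Im (G v)))).
    + intro v. unfold Re, Im. simpl. ring.
    + repeat constructor; assumption.
  - apply (elementary_ext (fun v => Re (F v) * Im (G v) + Im (F v) * Re (G v))); [reflexivity|].
    repeat constructor; assumption.
Qed.

Lemma elementaryC_pow (F : R4 -> C) (n : nat) : elementaryC F -> elementaryC (fun v => F v ^ n)%C.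
Proof.
  intro HF. induction n as [|n IH]; [exact (elementaryC_const 1)|].
  exact (elementaryC_mult F _ HF IH).
Qed.

Lemma elementaryC_sum (F : nat -> R4 -> C) (n : nat) :
  (forall a, elementaryC (F a)) -> elementaryC (fun v => Csum (fun a => F a v) n).
Proof.
  intro HF. induction n as [|n IH].
  - replace (fun v => Csum (fun a => F a v) 0) with (F 0%nat); [apply HF|].
    apply functional_extensionality. intro v. rewrite Csum_0. reflexivity.
  - replace (fun v => Csum (fun a => F a v) (S n))
      with (fun v => Csum (fun a => F a v) n + F (S n) v)%C.
    + apply elementaryC_plus; [exact IH|apply HF].
    + apply functional_extensionality. intro v. rewrite Csum_S. reflexivity.
Qed.

Lemma elementaryC_heval (zs : list (R4 -> C)) : List.Forall elementaryC zs ->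
  forall (m : nat) (h : coef),
  elementaryC (fun v => heval m h (map (fun z => z v) zs)).
Proof.
  induction 1 as [|z zs Hz _ IH]; intros m h; cbn [map heval];
    [exact (elementaryC_const _)|].
  apply (elementaryC_sum (fun a v => z v ^ a * heval (m - a) (fun e => h (a :: e)) _)%C).
  intro a. apply elementaryC_mult; [apply elementaryC_pow, Hz|apply IH].
Qed.

Lemma uncurry4_ext0 (F : fn4C) (v : R4) : uncurry4 (ext0 F) v = uncurry4 F (normalize v).
Proof.
  unfold uncurry4, ext0, normalize. rewrite !coord_scal, norm_sqrt. cbv zeta.
  f_equal; apply Rmult_comm.
Qed.

Lemma ext0_S3 (F : fn4C) (v : R4) : dot v v = 1 -> uncurry4 (ext0 F) v = uncurry4 F v.
Proof. intro Hv. rewrite uncurry4_ext0, normalize_sphere by exact Hv. reflexivity. Qed.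

Lemma ext0_homogeneous0 (F : fn4C) :
  homogeneous0 (uncurry4 (ReF (ext0 F))) /\ homogeneous0 (uncurry4 (ImF (ext0 F))).
Proof.
  assert (E : forall t v, 0 < t -> uncurry4 (ext0 F) (t ⊙ v) = uncurry4 (ext0 F) v).
  { intros t v Ht. rewrite !uncurry4_ext0, normalize_scal by exact Ht. reflexivity. }
  split; intros t v Ht; [apply (f_equal Re)|apply (f_equal Im)]; exact (E t v Ht).
Qed.

Lemma C2_S3_poly (m : nat) (h : coef) : C2_S3 (curry4 (poly m h)).
Proof.
  assert (H : elementaryC (fun v => poly m h (normalize v))).
  { assert (Hc : forall i, elementary (fun v => coord i (normalize v))).
    { intro i. apply (elementary_ext (fun v => / norm v * coord i v)).
      - intro v. symmetry. apply coord_scal.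
      - repeat constructor. }
    assert (Hn : forall i, elementary (fun v => - coord i (normalize v))).
    { intro i. apply (elementary_ext (fun v => -1 * coord i (normalize v))); [intro; ring|].
      constructor; [constructor|apply Hc]. }
    apply (elementaryC_heval [fun v => alpha (normalize v); fun v => beta (normalize v);
      fun v => Cconj (alpha (normalize v)); fun v => Cconj (beta (normalize v))]).
    repeat apply List.Forall_cons; [| | | |apply List.Forall_nil].
    - exact (conj (Hc 0%nat) (Hc 1%nat)).
    - exact (conj (Hc 2%nat) (Hc 3%nat)).
    - exact (conj (Hc 0%nat) (Hn 1%nat)).
    - exact (conj (Hc 2%nat) (Hn 3%nat)). }
  assert (E : forall v, uncurry4 (ext0 (curry4 (poly m h))) v = poly m h (normalize v))
    by (intro v; rewrite uncurry4_ext0, uncurry4_curry4; reflexivity).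
  destruct H as [H1 H2]. split.
  - exact (agrees_off0_C2 (ReF _) _ (fun v _ => f_equal Re (E v)) H1).
  - exact (agrees_off0_C2 (ImF _) _ (fun v _ => f_equal Im (E v)) H2).
Qed.

Definition is_lap_C (F : R4 -> C) (v : R4) (l : C) : Prop :=
  is_lap (fun w => Re (F w)) v (Re l) /\ is_lap (fun w => Im (F w)) v (Im l).

Lemma is_lap_C_of_second_derivatives (F : R4 -> C) (G : nat -> R4 -> C) (v : R4) (l : nat -> C) :
  (forall i w, is_derive_C (fun t => F (w ⊕ t ⊙ basis i)) 0 (G i w)) ->
  (forall i, is_derive_C (fun t => G i (v ⊕ t ⊙ basis i)) 0 (l i)) ->
  is_lap_C F v (l 0%nat + l 1%nat + l 2%nat + l 3%nat)%C.
Proof.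
  intros D1 D2. split.
  - exists (fun i => Re (G i v)), (fun i => Re (l i)). split; [|reflexivity].
    intro i. apply (is_jet2_line (fun w => Re (F w)) (fun w => Re (G i w))); [|apply D2].
    apply filter_forall. intro w. apply D1.
  - exists (fun i => Im (G i v)), (fun i => Im (l i)). split; [|reflexivity].
    intro i. apply (is_jet2_line (fun w => Im (F w)) (fun w => Im (G i w))); [|apply D2].
    apply filter_forall. intro w. apply D1.
Qed.

Lemma sum_realderiv_sqr (h : coef) (A B C D : nat) :
  (realderiv 0 (realderiv 0 h) [A; B; C; D] + realderiv 1 (realderiv 1 h) [A; B; C; D]
   + realderiv 2 (realderiv 2 h) [A; B; C; D] + realderiv 3 (realderiv 3 h) [A; B; C; D]
   = 4 * lap_coef h [A; B; C; D])%C.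
Proof.
  pose proof Ci_sqr as ECi. unfold realderiv. rewrite !zcoords_basis, lap_coef_entry.
  cbn [dirderiv map]. ring [ECi].
Qed.

Lemma is_lap_C_poly (m : nat) (h : coef) (v : R4) :
  is_lap_C (poly (S (S m)) h) v (4 * poly m (lap_coef h) v)%C.
Proof.
  replace (4 * poly m (lap_coef h) v)%C with
    (poly m (realderiv 0 (realderiv 0 h)) v + poly m (realderiv 1 (realderiv 1 h)) v
     + poly m (realderiv 2 (realderiv 2 h)) v + poly m (realderiv 3 (realderiv 3 h)) v)%C.
  - apply (is_lap_C_of_second_derivatives _ (fun i => poly (S m) (realderiv i h)) v
      (fun i => poly m (realderiv i (realderiv i h)) v)); intros; apply is_derive_C_line_poly.
  - rewrite <- !poly_plus, <- poly_scal. apply poly_ext. intros. apply sum_realderiv_sqr.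
Qed.

Lemma is_lap_C_poly_affine (m : nat) (h : coef) (v : R4) : (m < 2)%nat -> is_lap_C (poly m h) v 0.
Proof.
  intro Hm. replace (RtoC 0) with (0 + 0 + 0 + 0)%C by ring. destruct m as [|[|m]]; [| |lia].
  - apply (is_lap_C_of_second_derivatives _ (fun _ _ => RtoC 0) v (fun _ => RtoC 0)).
    + intros i w. apply is_derive_C_line_poly_0.
    + intro i. apply (is_derive_C_const 0).
  - apply (is_lap_C_of_second_derivatives _ (fun i => poly 0 (realderiv i h)) v (fun _ => RtoC 0)).
    + intros i w. apply is_derive_C_line_poly.
    + intro i. apply is_derive_C_line_poly_0.
Qed.

Definition is_poly_on_S3 (k : nat) (h : coef) (F : fn4C) : Prop :=
  forall v, dot v v = 1 -> uncurry4 F v = poly k h v.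

Lemma norm_pow_ext0 (k : nat) (h : coef) (F : fn4C) (v : R4) :
  is_poly_on_S3 k h F -> v <> origin ->
  (RtoC (norm v ^ k) * uncurry4 (ext0 F) v = poly k h v)%C.
Proof.
  intros HF Hv. rewrite uncurry4_ext0, (HF _ (dot_normalize v Hv)), <- poly_homogeneous.
  rewrite norm_scal_normalize by exact Hv. reflexivity.
Qed.

Lemma lapS3_of_poly (k : nat) (h : coef) (F : fn4C) (v : R4) (l : C) :
  C2_S3 F -> is_poly_on_S3 k h F -> dot v v = 1 ->
  is_lap_C (poly k h) v l ->
  (uncurry4 (lapS3 F) v = l - RtoC (INR (k * (k + 2))) * uncurry4 F v)%C.
Proof.
  intros [C1 C2] HF Hv [L1 L2]. destruct (ext0_homogeneous0 F) as [O1 O2].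
  pose proof (dot_1_neq_origin v Hv) as Hv0.
  assert (Hn : norm v = 1) by (rewrite norm_sqrt, Hv, sqrt_1; reflexivity).
  assert (Hpart : forall (part : C -> R) (u : fn4R), C2_off0 u -> homogeneous0 (uncurry4 u) ->
    (forall w, w <> origin -> norm w ^ k * uncurry4 u w = part (poly k h w)) ->
    forall x, is_lap (fun w => part (poly k h w)) v x ->
    uncurry4 (lap4 u) v = x - INR (k * (k + 2)) * uncurry4 u v).
  { intros part u Cu Ou Eu x Lx. pose proof (is_lap_norm_pow_mult k u v Cu Ou Hv0) as L.
    rewrite Hn, Hv, pow1 in L.
    rewrite (is_lap_unique _ _ _ _ Lx (is_lap_ext_loc _ (fun w => part (poly k h w)) _ _
      ltac:(generalize (locally_neq origin v Hv0); apply filter_imp; exact Eu) L)). field. }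
  rewrite <- (ext0_S3 F v Hv). apply injective_projections.
  - transitivity (uncurry4 (lap4 (ReF (ext0 F))) v); [reflexivity|].
    rewrite (Hpart Re (ReF (ext0 F)) C1 O1) with (x := Re l); [|intros w Hw|exact L1].
    + unfold uncurry4, ReF, Re. simpl. ring.
    + rewrite <- (norm_pow_ext0 k h F w HF Hw). unfold uncurry4, ReF, Re. simpl. ring.
  - transitivity (uncurry4 (lap4 (ImF (ext0 F))) v); [reflexivity|].
    rewrite (Hpart Im (ImF (ext0 F)) C2 O2) with (x := Im l); [|intros w Hw|exact L2].
    + unfold uncurry4, ImF, Im. simpl. ring.
    + rewrite <- (norm_pow_ext0 k h F w HF Hw). unfold uncurry4, ImF, Im. simpl. ring.
Qed.

Definition eigenfunction (k : nat) (F : fn4C) : Prop :=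
  forall v, dot v v = 1 ->
    uncurry4 (lapS3 F) v = (RtoC (- INR (k * (k + 2))) * uncurry4 F v)%C.

Lemma eigenfunction_poly_iff (k : nat) (h : coef) (F : fn4C) :
  C2_S3 F -> is_poly_on_S3 k h F -> eigenfunction k F <-> harmonic_coef k h.
Proof.
  intros HC HF.
  assert (Heq : forall v l, dot v v = 1 -> is_lap_C (poly k h) v l ->
    uncurry4 (lapS3 F) v = (RtoC (- INR (k * (k + 2))) * uncurry4 F v)%C <-> l = RtoC 0).
  { intros v l Hv L. rewrite (lapS3_of_poly k h F v l HC HF Hv L), RtoC_opp. split.
    - intro E. set (q := (RtoC (INR (k * (k + 2))) * uncurry4 F v)%C) in *.
      transitivity (l - q + q)%C; [ring|]. rewrite E. unfold q. ring.
    - intros ->. ring. }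
  destruct k as [|[|m]].
  - split; [intros _ A B C D Hm; lia|]. intros _ v Hv. apply (Heq v 0 Hv); [|reflexivity].
    apply is_lap_C_poly_affine. lia.
  - split; [intros _ A B C D Hm; lia|]. intros _ v Hv. apply (Heq v 0 Hv); [|reflexivity].
    apply is_lap_C_poly_affine. lia.
  - assert (Hpoly : forall v, dot v v = 1 -> uncurry4 (lapS3 F) v =
      (RtoC (- INR (S (S m) * (S (S m) + 2))) * uncurry4 F v)%C <-> poly m (lap_coef h) v = RtoC 0).
    { intros v Hv. rewrite (Heq v _ Hv (is_lap_C_poly m h v)). split.
      - intro E. transitivity (/ 4 * (4 * poly m (lap_coef h) v))%C; [field|rewrite E; ring].
      - intros ->. ring. }
    split.
    + intros E A B C D Hm. apply (poly_sphere_independent m); [|lia].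
      intros v Hv. apply Hpoly; [exact Hv|apply E, Hv].
    + intros E v Hv. apply Hpoly; [exact Hv|]. transitivity (poly m (fun _ => RtoC 0) v).
      * apply poly_ext. intros. apply E. lia.
      * apply heval_zero.
Qed.

Lemma eigenfunction_poly (k : nat) (F : fn4C) :
  C2_S3 F -> eigenfunction k F -> exists h, is_poly_on_S3 k h F.
Proof.
  intros [C1 C2] E. destruct (ext0_homogeneous0 F) as [O1 O2].
  destruct (eigenfunction_hpoly k (ReF (ext0 F)) C1 O1) as [f1 [[h1 H1] E1]].
  { intros v Hv. specialize (E v Hv). rewrite <- (ext0_S3 F v Hv) in E. apply (f_equal Re) in E.
    etransitivity; [exact E|]. unfold uncurry4, ReF, Re. simpl. ring. }
  destruct (eigenfunction_hpoly k (ImF (ext0 F)) C2 O2) as [f2 [[h2 H2] E2]].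
  { intros v Hv. specialize (E v Hv). rewrite <- (ext0_S3 F v Hv) in E. apply (f_equal Im) in E.
    etransitivity; [exact E|]. unfold uncurry4, ImF, Im. simpl. ring. }
  exists (fun e => (h1 e + Ci * h2 e)%C). intros v Hv.
  rewrite poly_plus, poly_scal, <- H1, <- H2, <- E1, <- E2, <- (ext0_S3 F v Hv) by exact Hv.
  unfold Ci. apply injective_projections; unfold uncurry4, ReF, ImF, Re, Im; simpl; ring.
Qed.

(** * The action of the cyclic group *)

Lemma zeta_pow_add (p : nat) (m n : Z) :
  zeta_pow p (m + n) = (zeta_pow p m * zeta_pow p n)%C.
Proof.
  unfold zeta_pow. rewrite plus_IZR.
  replace (2 * PI * (IZR m + IZR n) / INR p) with (2 * PI * IZR m / INR p + 2 * PI * IZR n / INR p)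
    by (unfold Rdiv; ring).
  rewrite cos_plus, sin_plus. apply injective_projections; simpl; ring.
Qed.

Lemma Cpow_zeta_pow (p : nat) (m : Z) (n : nat) :
  (zeta_pow p m ^ n)%C = zeta_pow p (m * Z.of_nat n).
Proof.
  induction n as [|n IH].
  - rewrite Z.mul_0_r. unfold zeta_pow. rewrite Rmult_0_r, Rdiv_0_l, cos_0, sin_0. reflexivity.
  - rewrite Cpow_S, IH, <- zeta_pow_add. f_equal. lia.
Qed.

Lemma Cconj_zeta_pow (p : nat) (m : Z) : Cconj (zeta_pow p m) = zeta_pow p (- m).
Proof.
  unfold zeta_pow, Cconj. simpl. rewrite opp_IZR.
  replace (2 * PI * - IZR m / INR p) with (- (2 * PI * IZR m / INR p)) by (unfold Rdiv; ring).
  rewrite cos_neg, sin_neg. reflexivity.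
Qed.

Lemma zeta_pow_eq_1 (p : nat) (m : Z) : (1 <= p)%nat ->
  zeta_pow p m = RtoC 1 <-> (Z.of_nat p | m)%Z.
Proof.
  intro Hp. assert (Hp0 : INR p <> 0) by (apply not_0_INR; lia). pose proof PI_RGT_0 as HPI.
  set (t := PI * IZR m / INR p).
  assert (Et : zeta_pow p m = (1 - 2 * (sin t * sin t), 2 * sin t * cos t)).
  { unfold zeta_pow. replace (2 * PI * IZR m / INR p) with (2 * t) by (unfold t, Rdiv; ring).
    rewrite cos_2a_sin, sin_2a. f_equal. ring. }
  assert (Hsin : zeta_pow p m = RtoC 1 <-> sin t = 0).
  { rewrite Et. split; intro H.
    - apply (f_equal fst) in H. simpl in H. nra.
    - rewrite H. apply injective_projections; simpl; ring. }
  rewrite Hsin. split.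
  - intro H. apply sin_eq_0_0 in H. destruct H as [q Hq]. exists q.
    apply eq_IZR. rewrite mult_IZR, <- INR_IZR_INZ. apply (Rmult_eq_reg_l PI); [|lra].
    replace (PI * IZR m) with (t * INR p) by (unfold t; field; exact Hp0). rewrite Hq. ring.
  - intros [q ->]. apply sin_eq_0_1. exists q. unfold t.
    rewrite mult_IZR, <- INR_IZR_INZ. field. exact Hp0.
Qed.

Definition rotate (p : nat) (m : Z) (v : R4) : R4 :=
  let a := (zeta_pow p (- m) * alpha v)%C in let b := (zeta_pow p m * beta v)%C in
  (fst a, snd a, fst b, snd b).

Lemma uncurry4_R_Zp (p : nat) (m : Z) (F : fn4C) (v : R4) :
  uncurry4 (R_Zp p m F) v = uncurry4 F (rotate p m v).
Proof. reflexivity. Qed.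

Lemma dot_rotate (p : nat) (m : Z) (v : R4) : dot (rotate p m v) (rotate p m v) = dot v v.
Proof.
  assert (E : forall n, let z := zeta_pow p n in fst z * fst z + snd z * snd z = 1).
  { intro n. simpl. pose proof (sin2_cos2 (2 * PI * IZR n / INR p)) as H. unfold Rsqr in H. lra. }
  pose proof (E (- m)%Z) as E1. pose proof (E m) as E2. cbv zeta in E1, E2.
  destruct (zeta_pow p (- m)) as [c s] eqn:Z1. destruct (zeta_pow p m) as [c' s'] eqn:Z2.
  unfold dot, sum4, rotate. rewrite Z1, Z2. simpl in *.
  transitivity ((c * c + s * s) * (coord 0 v * coord 0 v + coord 1 v * coord 1 v)
    + (c' * c' + s' * s') * (coord 2 v * coord 2 v + coord 3 v * coord 3 v)); [ring|].
  rewrite E1, E2. ring.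
Qed.

Definition weight (A B C D : nat) : Z := (Z.of_nat B + Z.of_nat C - Z.of_nat A - Z.of_nat D)%Z.

Definition rotate_coef (p : nat) (m : Z) (h : coef) : coef :=
  fun e => (mono [zeta_pow p (- m); zeta_pow p m; zeta_pow p m; zeta_pow p (- m)] e * h e)%C.

Lemma poly_rotate (p : nat) (m : Z) (k : nat) (h : coef) (v : R4) :
  poly k h (rotate p m v) = poly k (rotate_coef p m h) v.
Proof.
  unfold poly, rotate_coef. rewrite <- heval_rescale by reflexivity. f_equal.
  assert (Ea : alpha (rotate p m v) = (zeta_pow p (- m) * alpha v)%C) by reflexivity.
  assert (Eb : beta (rotate p m v) = (zeta_pow p m * beta v)%C) by reflexivity.
  unfold zcoords. rewrite Ea, Eb, !Cmult_conj, !Cconj_zeta_pow, Z.opp_involutive. reflexivity.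
Qed.

Lemma rotate_coef_entry (p : nat) (m : Z) (h : coef) (A B C D : nat) :
  rotate_coef p m h [A; B; C; D] = (zeta_pow p (m * weight A B C D) * h [A; B; C; D])%C.
Proof.
  unfold rotate_coef. cbn [mono]. rewrite Cmult_1_r, !Cpow_zeta_pow, <- !zeta_pow_add.
  do 2 f_equal. unfold weight. lia.
Qed.

Lemma good_a_iff (p k a : nat) : (1 <= p)%nat -> (a <= k)%nat ->
  good_a p k a = true <-> (Z.of_nat p | 2 * Z.of_nat a - Z.of_nat k)%Z.
Proof.
  intros Hp Ha. unfold good_a. rewrite Z.eqb_eq, Z.mod_divide by lia.
  replace (Z.of_nat a - Z.of_nat (k - a))%Z with (2 * Z.of_nat a - Z.of_nat k)%Z by lia.
  reflexivity.
Qed.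

Lemma good_a_weight (p A B C D : nat) : (1 <= p)%nat ->
  good_a p (A + B + C + D) (A + D) = true <-> (Z.of_nat p | weight A B C D)%Z.
Proof.
  intro Hp. rewrite good_a_iff by lia. rewrite <- Z.divide_opp_r. unfold weight.
  replace (- (2 * Z.of_nat (A + D) - Z.of_nat (A + B + C + D)))%Z
    with (Z.of_nat B + Z.of_nat C - Z.of_nat A - Z.of_nat D)%Z by lia. reflexivity.
Qed.

Definition good_support (p k : nat) (h : coef) : Prop :=
  forall A B C D, (A + B + C + D = k)%nat -> good_a p k (A + D) <> true -> h [A; B; C; D] = RtoC 0.

Lemma Zp_invariant_poly_iff (p k : nat) (h : coef) (F : fn4C) :
  (1 <= p)%nat -> is_poly_on_S3 k h F -> Zp_invariant p F <-> good_support p k h.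
Proof.
  intros Hp HF.
  assert (Erot : forall m v, dot v v = 1 -> uncurry4 (R_Zp p m F) v = poly k (rotate_coef p m h) v).
  { intros m v Hv. rewrite uncurry4_R_Zp, HF by (rewrite dot_rotate; exact Hv). apply poly_rotate. }
  split.
  - intros Hinv A B C D Hk Hg. apply NNPP. intro Hne. apply Hg.
    rewrite <- Hk. apply good_a_weight; [exact Hp|]. apply zeta_pow_eq_1; [exact Hp|].
    assert (E : (rotate_coef p 1 h [A; B; C; D] - h [A; B; C; D] = 0)%C).
    { apply (poly_sphere_independent k (fun e => rotate_coef p 1 h e - h e)%C); [|exact Hk].
      intros v Hv. rewrite poly_minus, <- Erot, <- HF by exact Hv.
      rewrite (Hinv 1%Z _ _ _ _ Hv : uncurry4 (R_Zp p 1 F) v = uncurry4 F v). ring. }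
    rewrite rotate_coef_entry, Z.mul_1_l in E. set (z := zeta_pow p _) in *.
    transitivity ((z * h [A; B; C; D] - h [A; B; C; D]) / h [A; B; C; D] + 1)%C;
      [field; exact Hne|].
    rewrite E. unfold Cdiv. ring.
  - intros Hsupp m x y z w Hv. change (dot (x, y, z, w) (x, y, z, w) = 1) in Hv.
    change (uncurry4 (R_Zp p m F) (x, y, z, w) = uncurry4 F (x, y, z, w)).
    rewrite Erot, HF by exact Hv. apply poly_ext. intros A B C D Hk. rewrite rotate_coef_entry.
    destruct (good_a p k (A + D)) eqn:Hg.
    + rewrite <- Hk in Hg. apply good_a_weight in Hg; [|exact Hp].
      rewrite (proj2 (zeta_pow_eq_1 p _ Hp)); [ring|]. apply Z.divide_mul_r, Hg.
    + rewrite (Hsupp A B C D Hk) by (rewrite Hg; discriminate). ring.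
Qed.

Lemma mode_poly_iff (p k : nat) (h : coef) (F : fn4C) :
  (1 <= p)%nat -> C2_S3 F -> is_poly_on_S3 k h F ->
  mode p k F <-> harmonic_coef k h /\ good_support p k h.
Proof.
  intros Hp HC HF.
  rewrite <- (eigenfunction_poly_iff k h F HC HF), <- (Zp_invariant_poly_iff p k h F Hp HF).
  split.
  - intros [_ [Hinv Heig]]. split; [|exact Hinv]. intros v Hv. apply Heig, Hv.
  - intros [Heig Hinv]. split; [exact HC|]. split; [exact Hinv|].
    intros x y z w Hv. exact (Heig (x, y, z, w) Hv).
Qed.

Lemma in_basis_idx (p k a j : nat) :
  In (a, j) (basis_idx p k) <-> (a <= k)%nat /\ good_a p k a = true /\ (j <= k)%nat.
Proof. unfold basis_idx. rewrite in_prod_iff, filter_In, !in_seq. intuition lia. Qed.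

Lemma NoDup_list_prod {A B : Type} (l : list A) (l' : list B) :
  NoDup l -> NoDup l' -> NoDup (list_prod l l').
Proof.
  intros Hl Hl'. induction Hl as [|x l Hx Hl IH]; simpl; [constructor|].
  apply NoDup_app; [|exact IH|].
  - apply NoDup_map_NoDup_ForallPairs; [|exact Hl']. intros a b _ _ E. congruence.
  - intros [a b] Ha Hb. apply in_map_iff in Ha. destruct Ha as [y [E _]]. injection E as <- _.
    apply in_prod_iff in Hb. tauto.
Qed.

Lemma NoDup_basis_idx (p k : nat) : NoDup (basis_idx p k).
Proof. apply NoDup_list_prod; [apply NoDup_filter|]; apply seq_NoDup. Qed.

Lemma lincomb_basis_idx (p k : nat) (c : nat * nat -> C) :
  lincomb k (basis_idx p k) c = curry4 (poly k (line_coef (restrict (basis_idx p k) c))).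
Proof.
  apply lincomb_poly; [apply NoDup_basis_idx|]. intros [a j] H. apply in_basis_idx in H. apply H.
Qed.

Lemma mode_basis_fn (p k : nat) (aj : nat * nat) : (1 <= p)%nat ->
  In aj (basis_idx p k) -> mode p k (basis_fn k aj).
Proof.
  destruct aj as [a j]. intros Hp Hin. apply in_basis_idx in Hin. destruct Hin as [Ha [Hg _]].
  rewrite basis_fn_poly by exact Ha.
  apply (mode_poly_iff p k (sibling_coef (a, j))); [exact Hp|apply C2_S3_poly| |].
  - intros v _. rewrite uncurry4_curry4. reflexivity.
  - split; [intros A B C D _; apply lap_line_coef|]. intros A B C D Hk Hbad. unfold sibling_coef.
    cbn [line_coef]. rewrite restrict_not_in; [ring|]. intros [E|[]]. injection E as Ea Ej.
    apply Hbad. rewrite <- Ea. exact Hg.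
Qed.

Lemma basis_independent (p k : nat) (c : nat * nat -> C) :
  (forall x y z w, onS3 x y z w -> lincomb k (basis_idx p k) c x y z w = RtoC 0) ->
  forall aj, In aj (basis_idx p k) -> c aj = RtoC 0.
Proof.
  intros Hz [a j] Hin. pose proof (proj1 (in_basis_idx p k a j) Hin) as [Ha [_ Hj]].
  (* A monomial on the line of the sibling [(a, j)]. *)
  set (D := Nat.min a j). set (A := (a - D)%nat). set (C := (j - D)%nat).
  set (B := (k - a - C)%nat).
  assert (E : line_coef (restrict (basis_idx p k) c) [A; B; C; D] = RtoC 0).
  { apply (poly_sphere_independent k); [|lia]. intros [[[x y] z] w] Hv.
    specialize (Hz x y z w Hv). rewrite lincomb_basis_idx in Hz. exact Hz. }
  cbn [line_coef] in E. replace (A + D, C + D)%nat with (a, j) in E by (f_equal; lia).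
  rewrite restrict_in in E by exact Hin. pose proof (sibling_entry_neq_0 A B C D) as Hne.
  transitivity (c (a, j) * RtoC (sibling_entry A B C D) / RtoC (sibling_entry A B C D))%C;
    [field; exact Hne|]. rewrite E. unfold Cdiv. ring.
Qed.

Lemma modes_span (p k : nat) (F : fn4C) : (1 <= p)%nat -> mode p k F ->
  exists c : nat * nat -> C, forall x y z w, onS3 x y z w ->
    F x y z w = lincomb k (basis_idx p k) c x y z w.
Proof.
  intros Hp HF. pose proof HF as [HC [_ Heig]].
  destruct (eigenfunction_poly k F HC (fun v => Heig _ _ _ _)) as [h E].
  apply (mode_poly_iff p k h F Hp HC E) in HF. destruct HF as [Hlap Hsupp].
  destruct (harmonic_line_coef k h Hlap) as [c Hc].
  exists c. intros x y z w Hv. rewrite lincomb_basis_idx.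
  transitivity (poly k h (x, y, z, w)); [exact (E (x, y, z, w) Hv)|]. unfold curry4.
  apply poly_ext. intros A B C D Hk.
  destruct (in_dec nat_pair_dec (A + D, C + D)%nat (basis_idx p k)) as [Hin|Hout].
  - rewrite Hc by exact Hk. apply line_coef_ext. symmetry. apply restrict_in, Hin.
  - cbn [line_coef]. rewrite restrict_not_in, Cmult_0_l by exact Hout. apply Hsupp; [exact Hk|].
    intro Hg. apply Hout, in_basis_idx. repeat split; [lia|exact Hg|lia].
Qed.

(** * The dimension *)

Lemma div_succ (x d : Z) : (0 < d)%Z ->
  ((x + 1) / d = x / d + (if ((x + 1) mod d =? 0)%Z then 1 else 0))%Z.
Proof.
  intro Hd. pose proof (Z.div_mod (x + 1) d). pose proof (Z.div_mod x d).
  pose proof (Z.mod_pos_bound x d Hd). pose proof (Z.mod_pos_bound (x + 1) d Hd).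
  destruct (Z.eqb_spec ((x + 1) mod d) 0); nia.
Qed.

Lemma count_residue_class (c d : Z) (n : nat) : (0 < d)%Z ->
  Z.of_nat (length (filter (fun a => (Z.of_nat a - c) mod d =? 0)%Z (seq 0 n)))
  = ((Z.of_nat n - 1 - c) / d - (-1 - c) / d)%Z.
Proof.
  intro Hd. induction n as [|n IH].
  - simpl. replace (0 - 1 - c)%Z with (-1 - c)%Z by lia. lia.
  - rewrite seq_S, filter_app, length_app, Nat2Z.inj_add, IH, Nat.add_0_l. cbn [filter].
    replace (Z.of_nat (S n) - 1 - c)%Z with (Z.of_nat n - 1 - c + 1)%Z by lia.
    rewrite (div_succ (Z.of_nat n - 1 - c) d Hd).
    replace (Z.of_nat n - 1 - c + 1)%Z with (Z.of_nat n - c)%Z by lia.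
    destruct ((Z.of_nat n - c) mod d =? 0)%Z; simpl length; lia.
Qed.

Lemma div_opp_pred (l d : Z) : (0 < d)%Z -> ((-1 - l) / d = - (l / d) - 1)%Z.
Proof.
  intro Hd. pose proof (Z.div_mod l d). pose proof (Z.div_mod (-1 - l) d).
  pose proof (Z.mod_pos_bound l d Hd). pose proof (Z.mod_pos_bound (-1 - l) d Hd). nia.
Qed.

Definition good_count (p k : nat) : Z := Z.of_nat (length (filter (good_a p k) (seq 0 (S k)))).

Lemma length_basis_idx (p k : nat) :
  Z.of_nat (length (basis_idx p k)) = (good_count p k * (Z.of_nat k + 1))%Z.
Proof. unfold basis_idx, good_count. rewrite length_prod, length_seq. lia. Qed.

Lemma good_count_residue_class (p k : nat) (c d : Z) : (1 <= p)%nat -> (0 < d)%Z ->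
  (forall a, (Z.of_nat p | 2 * a - Z.of_nat k)%Z <-> (d | a - c)%Z) ->
  good_count p k = ((Z.of_nat k - c) / d - (-1 - c) / d)%Z.
Proof.
  intros Hp Hd H. unfold good_count.
  replace (Z.of_nat k - c)%Z with (Z.of_nat (S k) - 1 - c)%Z by lia.
  rewrite <- count_residue_class by exact Hd. do 2 f_equal. apply filter_ext_in.
  intros a Ha. apply in_seq in Ha. apply Bool.eq_iff_eq_true.
  rewrite good_a_iff, Z.eqb_eq, Z.mod_divide by lia. apply H.
Qed.

Lemma good_count_even_even (n l : nat) : (1 <= n)%nat ->
  good_count (2 * n) (2 * l) = (2 * (Z.of_nat l / Z.of_nat n) + 1)%Z.
Proof.
  intro Hn. rewrite (good_count_residue_class _ _ (Z.of_nat l) (Z.of_nat n)); [|lia|lia|].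
  - rewrite div_opp_pred by lia.
    replace (Z.of_nat (2 * l) - Z.of_nat l)%Z with (Z.of_nat l) by lia. lia.
  - intro a. split; intros [q Hq]; exists q; lia.
Qed.

Lemma good_count_even_odd (n l : nat) : (1 <= n)%nat -> good_count (2 * n) (2 * l + 1) = 0%Z.
Proof.
  intro Hn. unfold good_count.
  rewrite (filter_ext_in _ (fun _ => false)).
  - induction (seq 0 _); [reflexivity|assumption].
  - intros a Ha. apply in_seq in Ha. apply Bool.not_true_is_false.
    rewrite good_a_iff by lia. intros [q Hq]. lia.
Qed.

Lemma odd_divide_double (n : nat) (x : Z) :
  (Z.of_nat (2 * n + 1) | 2 * x)%Z <-> (Z.of_nat (2 * n + 1) | x)%Z.
Proof.
  split; [|apply Z.divide_mul_r]. intro H. apply (Z.gauss _ 2); [exact H|].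
  apply Z.bezout_1_gcd. exists 1%Z, (- Z.of_nat n)%Z. lia.
Qed.

Lemma good_count_odd_even (n l : nat) :
  good_count (2 * n + 1) (2 * l) = (2 * (Z.of_nat l / Z.of_nat (2 * n + 1)) + 1)%Z.
Proof.
  rewrite (good_count_residue_class _ _ (Z.of_nat l) (Z.of_nat (2 * n + 1))); [|lia|lia|].
  - rewrite div_opp_pred by lia.
    replace (Z.of_nat (2 * l) - Z.of_nat l)%Z with (Z.of_nat l) by lia. lia.
  - intro a. replace (2 * a - Z.of_nat (2 * l))%Z with (2 * (a - Z.of_nat l))%Z by lia.
    apply odd_divide_double.
Qed.

Lemma good_count_odd_odd (n l : nat) :
  good_count (2 * n + 1) (2 * l + 1)
  = (2 * ((Z.of_nat l - Z.of_nat n) / Z.of_nat (2 * n + 1) + 1))%Z.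
Proof.
  set (p := Z.of_nat (2 * n + 1)). set (m := (Z.of_nat l - Z.of_nat n)%Z).
  rewrite (good_count_residue_class _ _ (m + p) p); [|lia|lia|].
  - replace (-1 - (m + p))%Z with (-1 - m + -1 * p)%Z by lia.
    replace (Z.of_nat (2 * l + 1) - (m + p))%Z with m by lia.
    rewrite Z.div_add, div_opp_pred by lia. lia.
  - intro a. rewrite <- (odd_divide_double n : forall x, (p | 2 * x)%Z <-> (p | x)%Z).
    replace (2 * a - Z.of_nat (2 * l + 1))%Z with (2 * (a - (m + p)) + p)%Z by lia.
    split; intro H.
    + apply (Z.divide_add_cancel_r _ p); [apply Z.divide_refl|]. rewrite Z.add_comm. exact H.
    + apply Z.divide_add_r; [exact H|apply Z.divide_refl].
Qed.

Lemma parity_cases (n : nat) :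
  (Nat.even n = true /\ exists m, n = (2 * m)%nat) \/
  (Nat.even n = false /\ exists m, n = (2 * m + 1)%nat).
Proof.
  destruct (Nat.even n) eqn:E; [left|right]; split; try reflexivity.
  - apply Nat.even_spec. exact E.
  - apply Nat.odd_spec. unfold Nat.odd. rewrite E. reflexivity.
Qed.

Lemma length_basis_idx_even (n k : nat) : (1 <= n)%nat ->
  Z.of_nat (length (basis_idx (2 * n) k)) =
    (if Nat.even k then (2 * ((Z.of_nat k / 2) / Z.of_nat n) + 1) * (Z.of_nat k + 1) else 0)%Z.
Proof.
  intro Hn. rewrite length_basis_idx.
  destruct (parity_cases k) as [[-> [l ->]]|[-> [l ->]]].
  - rewrite good_count_even_even by exact Hn.
    replace (Z.of_nat (2 * l)) with (Z.of_nat l * 2)%Z by lia.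
    rewrite Z.div_mul by lia. reflexivity.
  - rewrite good_count_even_odd by exact Hn. reflexivity.
Qed.

Lemma length_basis_idx_odd (n k : nat) :
  Z.of_nat (length (basis_idx (2 * n + 1) k)) = dim_formula (2 * n + 1) k.
Proof.
  rewrite length_basis_idx. unfold dim_formula. rewrite Nat.add_1_r, Nat.even_succ, Nat.odd_mul.
  cbn [Nat.odd Nat.even negb andb]. rewrite <- Nat.add_1_r.
  destruct (parity_cases k) as [[-> [l ->]]|[-> [l ->]]].
  - rewrite good_count_odd_even. replace (Z.of_nat (2 * l)) with (2 * Z.of_nat l)%Z by lia.
    rewrite Z.div_mul_cancel_l by lia. reflexivity.
  - rewrite good_count_odd_odd.
    replace (Z.of_nat (2 * l + 1) - Z.of_nat (2 * n + 1))%Z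
      with (2 * (Z.of_nat l - Z.of_nat n))%Z by lia.
    rewrite Z.div_mul_cancel_l by lia. reflexivity.
Qed.

Lemma length_basis_idx_dim_formula (p k : nat) : (1 <= p)%nat ->
  Z.of_nat (length (basis_idx p k)) = dim_formula p k.
Proof.
  intro Hp. destruct (parity_cases p) as [[E [n ->]]|[_ [n ->]]]; [|apply length_basis_idx_odd].
  rewrite length_basis_idx_even by lia. unfold dim_formula. rewrite E.
  rewrite Z.div_div, <- (Nat2Z.inj_mul 2) by lia. reflexivity.
Qed.

Theorem theorem14p1 (p k : nat) (hp : (1 <= p)%nat) :
  (* every proposed basis element (restricted to S^3) is a mode *)
  (forall aj, In aj (basis_idx p k) -> mode p k (basis_fn k aj)) /\
  (* they are linearly independent over C as functions on S^3 *)
  (forall c : nat * nat -> C,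
     (forall x y z w, onS3 x y z w -> lincomb k (basis_idx p k) c x y z w = RtoC 0) ->
     forall aj, In aj (basis_idx p k) -> c aj = RtoC 0) /\
  (* they span the space of modes *)
  (forall F : fn4C, mode p k F ->
     exists c : nat * nat -> C,
       forall x y z w, onS3 x y z w -> F x y z w = lincomb k (basis_idx p k) c x y z w) /\
  (* the basis is duplicate-free, so the dimension is its length *)
  NoDup (basis_idx p k) /\
  Z.of_nat (length (basis_idx p k)) = dim_formula p k /\
  (* the special case p = 2n *)
  (forall n : nat, p = (2 * n)%nat ->
     Z.of_nat (length (basis_idx p k)) =
       (if Nat.even k
        then (2 * ((Z.of_nat k / 2) / Z.of_nat n) + 1) * (Z.of_nat k + 1)
        else 0)%Z).
Proof.
  split; [|split; [|split; [|split; [|split]]]].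
  - intros aj. apply mode_basis_fn, hp.
  - apply basis_independent.
  - intro F. apply modes_span, hp.
  - apply NoDup_basis_idx.
  - apply length_basis_idx_dim_formula, hp.
  - intros n Hn. subst p. apply length_basis_idx_even. lia.
Qed.
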